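(* Let $p\in(1,\infty)$ and let $q$ be the Hölder conjugate of $p$ ($\frac1p+\frac1q=1$). Let $(\mathbb{H},d,\mathcal{L}^3)$ be the sub-Finsler $\ell^p$-Heisenberg group equipped with the Lebesgue measure. 1) If $p\in(1,3]$, the geodesic dimension of $(\mathbb{H},d,\mathcal{L}^3)$ is $5$. 2) If $p\in[3,\infty)$, the geodesic dimension of $(\mathbb{H},d,\mathcal{L}^3)$ is $2q+2$.
   Context: **The $\ell^p$-Heisenberg group.** The Heisenberg group $\mathbb{H}$ is $\mathbb{R}^3$ with group law $(x,y,z)\cdot(x',y',z')=(x+x',y+y',z+z'+\frac12(xy'-x'y))$ and left-invariant vector fields $X=\partial_x-\frac y2\partial_z$, $Y=\partial_y+\frac x2\partial_z$. An absolutely continuous curve $\gamma:[0,1]\to\mathbb{H}$ is horizontal if $\dot\gamma(t)=u_1(t)X(\gamma(t))+u_2(t)Y(\gamma(t))$ for a.e. $t$; its length is $\mathrm{L}(\gamma)=\int_0^1(|u_1|^p+|u_2|^p)^{1/p}\,dt$. The distance $d(g_0,g_1)$ is the infimum of the lengths of horizontal curves joining $g_0$ to $g_1$. $\mathcal{L}^3$ is the Lebesgue measure on $\mathbb{R}^3$. **Geodesic dimension.** Let $(X,d,\mathfrak{m})$ be a geodesic metric measure space. For $x\in X$, a Borel set $\Omega\subseteq X$ and $t\in[0,1]$, the $t$-intermediate set of $\Omega$ from $x$ is $$\Omega_t=\{\gamma(t)\mid \gamma:[0,1]\to X\text{ constant speed minimising geodesic},\ \gamma(0)=x,\ \gamma(1)\in\Omega\}.$$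 For $s>0$ let $$C_s(x)=\sup\left\{\limsup_{t\to0^+}\frac1{t^s}\frac{\mathfrak{m}(\Omega_t)}{\mathfrak{m}(\Omega)}\ \Big|\ \Omega\text{ Borel, bounded, }\mathfrak{m}(\Omega)\in(0,\infty)\right\}.$$ The geodesic dimension at $x$ is $N_{\mathrm{geo}}(x)=\inf\{s>0\mid C_s(x)=+\infty\}=\sup\{s>0\mid C_s(x)=0\}$, and the geodesic dimension of the space is $N_{\mathrm{geo}}=\sup_{x\in X}N_{\mathrm{geo}}(x)$. *)

(* Defs.v *)
From HB Require Import structures.
From mathcomp Require Import all_boot all_order all_algebra.
From mathcomp Require Import ring.
From mathcomp Require Import all_classical all_reals all_analysis.

Set Implicit Arguments.
Unset Strict Implicit.
Unset Printing Implicit Defensive.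

Import Order.TTheory GRing.Theory Num.Theory.
Import numFieldNormedType.Exports.

Local Open Scope classical_set_scope.
Local Open Scope ring_scope.

Section MetricMeasure.
Context {R : realType} {disp : measure_display} {T : measurableType disp}.
(* Distances take values in \bar R, so that the infimum defining a length
   distance needs no default value.  The measurable sets of T play the role of
   the Borel sets. *)
Variables (m : {measure set T -> \bar R}) (d : T -> T -> \bar R).

(* Curves are total functions on R; only their values on [0, 1] matter. *)
Definition constant_speed_geodesic (g : R -> T) : Prop :=
  forall s t : R, 0 <= s <= 1 -> 0 <= t <= 1 ->
    d (g s) (g t) = (`|t - s|%:E * d (g 0%R) (g 1%R))%E.

Definition intermediate_set (x : T) (A : set T) (t : R) : set T :=
  [set y | exists g : R -> T,
     [/\ constant_speed_geodesic g, g 0 = x, A (g 1) & g t = y]].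

Definition metric_bounded (A : set T) : Prop :=
  exists r : R, forall x y, A x -> A y -> (d x y <= r%:E)%E.

(* intermediate_set x A t need not be Borel, hence the outer measure m^*; it
   agrees with the completion of m on all completion-measurable sets. *)
Definition contraction_limsup (s : R) (x : T) (A : set T) : \bar R :=
  limf_esup
    (fun t : R => ((t `^ s)^-1%:E *
                   ((m^*)%mu (intermediate_set x A t) / m A))%E)
    (0 : R)^'+.

Definition contraction_const (s : R) (x : T) : \bar R :=
  ereal_sup [set contraction_limsup s x A | A in
    [set A : set T | [/\ measurable A, metric_bounded A &
                         (0 < m A < +oo)%E]]].

(* contraction_const is nondecreasing in s, and infinite at every s' > s once it
   is positive at s; hence this infimum is also the supremum of the s > 0 where
   it vanishes (0 if there are none). *)
Definition geodesic_dim_at (x : T) : \bar R :=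
  ereal_inf [set s%:E | s in
    [set s : R | 0 < s /\ contraction_const s x = +oo%E]].

Definition geodesic_dim : \bar R := ereal_sup (range geodesic_dim_at).

End MetricMeasure.

Definition absolutely_continuous {R : realType} {V : normedModType R}
    (a b : R) (f : R -> V) : Prop :=
  forall e : R, 0 < e -> exists2 del : R, 0 < del &
    forall (n : nat) (l r : 'I_n -> R),
      (forall i, [/\ a <= l i, l i <= r i & r i <= b]) ->
      trivIset setT (fun i => `]l i, r i[%classic) ->
      \sum_(i < n) (r i - l i) < del ->
      \sum_(i < n) `|f (r i) - f (l i)| < e.

Section Heisenberg.
Context {R : realType}.

(* A point (x, y, z) is encoded as ((x, y), z). *)
Local Notation heis := (R * R * R)%type.

Definition heis_mul (g h : heis) : heis :=
  (g.1.1 + h.1.1, g.1.2 + h.1.2,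
   g.2 + h.2 + 2^-1 * (g.1.1 * h.1.2 - h.1.1 * g.1.2)).

Definition vfX (g : heis) : heis := (1, 0, - (g.1.2 / 2)).
Definition vfY (g : heis) : heis := (0, 1, g.1.1 / 2).

(* vfX and vfY are the velocities at g of right translations along the x and y
   axes, i.e. the left-invariant fields extending d/dx and d/dy at the origin. *)
Lemma heis_mul_expX (g : heis) (h : R) : heis_mul g (h, 0, 0) = g + h *: vfX g.
Proof.
case: g => -[x y] z; rewrite /heis_mul.
have scaleRE (a b : R) : a *: b = a * b by [].
by congr (_, _, _); rewrite /= scaleRE; field.
Qed.

Lemma heis_mul_expY (g : heis) (h : R) : heis_mul g (0, h, 0) = g + h *: vfY g.
Proof.
case: g => -[x y] z; rewrite /heis_mul.
have scaleRE (a b : R) : a *: b = a * b by [].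
by congr (_, _, _); rewrite /= scaleRE; field.
Qed.

(* u1 and u2 are determined by gam up to a null set; the measurability
   requirement fixes Borel representatives, so that their integral below is the
   Lebesgue integral. *)
Definition horizontal (gam : R -> heis) (u1 u2 : R -> R) : Prop :=
  [/\ absolutely_continuous 0 1 gam,
      measurable_fun (`[0, 1]%classic : set R) u1,
      measurable_fun (`[0, 1]%classic : set R) u2 &
      {ae lebesgue_measure, forall t : R, 0 <= t <= 1 ->
         is_derive t 1 gam (u1 t *: vfX (gam t) + u2 t *: vfY (gam t))}].

Definition lp_length (p : R) (u1 u2 : R -> R) : \bar R :=
  (\int[lebesgue_measure]_(t in `[0%R, 1%R])
     ((`|u1 t| `^ p + `|u2 t| `^ p) `^ p^-1)%:E)%E.

Definition heis_dist (p : R) (g0 g1 : heis) : \bar R :=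
  ereal_inf [set l | exists (gam : R -> heis) (u1 u2 : R -> R),
    [/\ horizontal gam u1 u2, gam 0 = g0, gam 1 = g1 & l = lp_length p u1 u2]].


(* Its domain is the Borel sigma-algebra of R^3; heis_dist induces the Euclidean
   topology, so these are also the Borel sets of the metric space. *)
Definition lebesgue3 :
    {measure set (measurableTypeR R * measurableTypeR R * measurableTypeR R)
      -> \bar R} :=
  ((@lebesgue_measure R \x @lebesgue_measure R) \x @lebesgue_measure R)%E.

End Heisenberg.

(* Main.v *)
(* Write K(h) = (1 - |h|^q)^(1/q) and phi(h) = - K'(h), so that (1, phi(h)) is the
   direction dual to the unit covector (K(h), h).  If H' = K(c + w x), the
   function H(x) + c y + w (z + x y / 2) has horizontal differential
   (K(c + w x), c + w x), of dual norm 1: it is a calibration as long as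
   |c + w x| <= 1, and the lifts of the graphs y' = phi(c + w x) are minimising.

   Upper bound on the intermediate sets of the origin.  Let a geodesic of length L
   be at (x, y, z) at time t, with 0 <= y <= x.  Replacing the initial arc by a
   segment and correcting the height of the end point gives
   t L - |(x, y)|_p <= B |z| / L, and a calibration with w = 2 B sgn(z) / L gives
   an inequality in the other direction with a second-order error of K at the
   covector dual to (x, y).  Hence either |z| <= C L^2 t^3 (y/x)^(2-p), or
   y <= C t^(q-1) x and |z| <= C L^2 t^(q+1).  Slicing [t^(q-1), 1] into finitely
   many intervals [t^((i+1)e), t^(ie)] for y/x, one covers the set by boxes of
   volume O(t^(N - e |2-p|)) with N = min(5, 2q + 2).

   Lower bound.  The calibrated extremals with covector between two fixed
   positive values fill a box of volume of order t^5, and those with covector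
   O(t) fill a box of volume of order t^(2q+2) when q <= 2; left translations
   carry these boxes to any base point. *)

(* Geodesics are never classified: the covering has to catch every minimiser, so the upper bound
   uses minimality alone, through competitors and calibrations. The obstacle is that [K] is not
   uniformly C^2 near the covector 0: phi'(h) is of order |h|^(q-2) there, which vanishes or blows
   up unless q = 2. The second-order error is therefore weighted by the covector, and so by
   (y/x)^(2-p), because the covector dual to (1, v) is of order v^(p-1) and (p-1)(q-2) = 2-p. A slab
   y/x ~ t^a then has volume t^(5 + a(3-p)) with 0 <= a <= q-1. This exponent is affine in a; its
   values at the two ends are 5 and 2q+2, and they exchange roles at p = 3. As the dimension of the
   space is a supremum over base points, small intermediate sets are wanted at one point only,
   whereas large ones are wanted at every point. *)
From HB Require Import structures.
Require Import Defs.
From mathcomp Require Import all_boot all_order all_algebra.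
From mathcomp Require Import ring lra.
From mathcomp Require Import all_classical all_reals all_analysis measurable_realfun.

Set Implicit Arguments.
Unset Strict Implicit.
Unset Printing Implicit Defensive.

Import Order.TTheory GRing.Theory Num.Theory.
Import numFieldNormedType.Exports.

Local Open Scope classical_set_scope.
Local Open Scope ring_scope.

(** * Horizontal curves *)

Section Growth.
Context {R : realType}.
Implicit Types (a b t : R).

(** Cousin's lemma: it turns a pointwise estimate into a global one with no covering theorem. The
    supremum of the points reachable from [a] is itself reachable, and if it were less than [b] it
    could be passed. Since [ok] holds on every short interval around [t], tags need not be
    recorded. *)
Lemma cousin (ok : R -> R -> Prop) a b : a <= b ->
  (forall t, a <= t <= b -> exists2 d : R, 0 < d &
    forall x y, a <= x <= t -> t <= y <= b -> x < y -> y - x < d -> ok x y) ->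
  exists s : seq R, path (fun x y => (x < y) && `[< ok x y >]) a s /\ last a s = b.
Proof.
move=> ab H.
pose r x y := (x < y) && `[< ok x y >].
pose S := [set t | a <= t <= b /\ exists s, path r a s /\ last a s = t].
have Sa : S a by split; [rewrite lexx|exists [::]].
have supS : has_sup S by split; [exists a|exists b => t -[/andP[]]].
have at_ : a <= sup S by exact: (sup_upper_bound supS).
have tb : sup S <= b by apply: ge_sup; [exists a|move=> t -[/andP[]]].
have ext x y : S x -> x < y -> y <= b -> ok x y -> S y.
  move=> [/andP[ax xb] [s [ps ls]]] xy yb oxy; split.
    by rewrite yb andbT (le_trans ax)// ltW.
  exists (rcons s y); rewrite rcons_path last_rcons; split => //.
  by rewrite ps ls /r xy/=; apply/asboolP.
have [|d d0 Hd] := H (sup S); first by rewrite at_ tb.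
have [t1 St1 t1S] := sup_adherent (divr_gt0 d0 (ltr0Sn _ 1)) supS.
have t1le : t1 <= sup S by exact: (sup_upper_bound supS).
have at1 : a <= t1 by case: St1 => /andP[].
have Ssup : S (sup S).
  move: t1le; rewrite le_eqVlt => /predU1P[<-//|t1lt].
  apply: (ext t1) => //; apply: Hd => //; last by lra.
    by rewrite at1 ltW.
  by rewrite lexx.
have [supb|] := ltP (sup S) b; last first.
  move=> bs; have e : sup S = b by apply/eqP; rewrite eq_le bs tb.
  by case: Ssup => _; rewrite e.
pose y := Num.min b (sup S + d / 2).
have yb : y <= b by rewrite /y ge_min lexx.
have ys : sup S < y by rewrite /y lt_min supb/= ltrDl divr_gt0.
have yd : y <= sup S + d / 2 by rewrite /y ge_min lexx orbT.
have : S y.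
  apply: (ext (sup S)) => //; apply: Hd => //; last by lra.
    by rewrite at_ lexx.
  by rewrite yb ltW.
by move/(sup_upper_bound supS); rewrite leNgt ys.
Qed.


Let ball_within (a b t x y z d : R) : a <= x <= t -> t <= y <= b -> x <= z <= y ->
  y - x < d -> ball t d z.
Proof. by move=> ? ? ? ?; rewrite /ball/= ltr_norml; lra. Qed.

Lemma is_derive_approx (D : R -> R) (t dD e : R) : is_derive t 1 D dD -> 0 < e ->
  exists2 d, 0 < d & forall h, `|h| < d -> `|D (t + h) - D t - dD * h| <= e * `|h|.
Proof.
move=> [dv DE] e0.
have /cvgrPdist_le/(_ e e0) : h^-1 *: (D (h *: 1 + t) - D t) @[h --> 0^'] --> dD.
  by rewrite -DE; exact: dv.
rewrite /= => -[d /= d0 Hd]; exists d => // h hd.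
have [->|h0] := eqVneq h 0; first by rewrite addr0 subrr mulr0 subr0 normr0 mulr0.
have := Hd h; rewrite /= sub0r normrN => /(_ hd h0).
have -> : h *: 1 + t = t + h by rewrite addrC; congr (_ + _); exact: mulr1.
have -> : D (t + h) - D t - dD * h = - (h * (dD - h^-1 *: (D (t + h) - D t))).
  have sE (u v : R) : u *: v = u * v by [].
  by rewrite sE; field.
by rewrite normrN normrM mulrC => /ler_wpM2r; apply.
Qed.

(** Straddle form: [t] may lie anywhere in the interval, as the partitions of [cousin] require. The
    two sides of [t] are estimated separately. *)
Lemma is_derive_le0_incr (D : R -> R) (t dD e : R) :
  is_derive t 1 D dD -> dD <= 0 -> 0 < e ->
  exists2 d, 0 < d & forall x y, x <= t -> t <= y -> y - x < d ->
    D y - D x <= e * (y - x).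
Proof.
move=> DD dD0 e0; have [d d0 Hd] := is_derive_approx DD e0; exists d => // x y xt ty xyd.
have h1 : `|x - t| < d by rewrite ltr_norml; lra.
have h2 : `|y - t| < d by rewrite ltr_norml; lra.
have := Hd _ h1; have := Hd _ h2; rewrite !subrKC.
have yt : 0 <= y - t by rewrite subr_ge0.
have xt' : x - t <= 0 by rewrite subr_le0.
rewrite (ger0_norm yt) (ler0_norm xt') !ler_norml => /andP[_ h3] /andP[h4 _].
have h7 : dD * (y - t) <= 0 by rewrite mulr_le0_ge0.
have h8 : 0 <= dD * (x - t) by rewrite mulr_le0.
clear -h3 h4 h7 h8; lra.
Qed.

Local Notation mu := (@lebesgue_measure R).

(** If [F] is the primitive of the bound, [D = G - F] has a nonpositive derivative off a null set.
    Each interval of a fine partition either satisfies the straddle estimate for [D] or lies in an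
    open set of small measure around the null set; on the latter intervals [G] gains less than [e]
    in total by absolute continuity, and [F] is monotone. *)
Lemma AC_growth (G l : R -> R) a b :
  absolutely_continuous 0 1 G -> measurable_fun (`[0, 1]%classic : set R) l ->
  (forall t, 0 <= l t) ->
  {ae mu, forall t, 0 <= t <= 1 -> exists2 dG : R, is_derive t 1 G dG & dG <= l t} ->
  0 <= a -> a <= b -> b <= 1 ->
  ((G b - G a)%:E <= \int[mu]_(t in `[0%R, 1%R]) (l t)%:E)%E.
Proof.
move=> AC ml l0 dG a0 ab b1.
have [->|/eqP intfin] := eqVneq (\int[mu]_(t in `[0%R, 1%R]) (l t)%:E)%E +oo%E.
  by rewrite leey.
have il : mu.-integrable `[0, 1] (EFin \o l).
  apply/integrableP; split; first exact/measurable_EFinP.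
  under eq_integral => t _ do rewrite /= ger0_norm//.
  by rewrite ltey; apply/eqP.
(* Extension by 0 to the line, where the almost everywhere form of the fundamental theorem is
   applied. *)
pose f : R -> R := l \_ `[0, 1].
have ifT : mu.-integrable setT (EFin \o f).
  rewrite /f -restrict_EFin; apply/integrable_restrict => //=.
  by rewrite setTI.
have f0 t : 0 <= f t by rewrite /f patchE; case: ifP.
have ifS A : measurable A -> mu.-integrable A (EFin \o f).
  by move=> mA; apply: (integrableS measurableT).
pose F := fun x : R => (\int[mu]_(t in `]-oo, x]) f t)%R.
have locf : locally_integrable setT f.
  by apply: integrable_locally.
have dF : {ae mu, forall x, derivable F x 1 /\ (F^`()%classic) x = f x}.
  by apply: FTC1Ny => // y; exact: ifS.
have Fmono x y : x <= y -> F x <= F y.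
  move=> xy; rewrite /F /Rintegral fine_le//.
  - by apply: integrable_fin_num => //; exact: ifS.
  - by apply: integrable_fin_num => //; exact: ifS.
  apply: ge0_subset_integral => //=.
  - by apply/measurable_EFinP; case/integrableP: (ifS _ (@measurable_itv _ `]-oo, y])) => /measurable_EFinP.
  - by move=> t _; rewrite lee_fin.
  - by move=> t /=; rewrite !in_itv/= => /le_trans; apply.
have Fle1 x y : ((F y - F x)%:E <= \int[mu]_(t in `[0%R, 1%R]) (l t)%:E)%E.
  have -> : (\int[mu]_(t in `[0%R, 1%R]) (l t)%:E = \int[mu]_t (f t)%:E)%E.
    by rewrite integral_mkcond restrict_EFin.
  apply: (@le_trans _ _ (F y)%:E).
    rewrite lee_fin lerBlDr lerDl /F.
    by apply: Rintegral_ge0 => t _.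
  rewrite /F /Rintegral fineK; last by apply: integrable_fin_num => //; exact: ifS.
  apply: ge0_subset_integral => //=.
  - by case/integrableP: ifT.
  - by move=> t _; rewrite lee_fin.
suff H : forall e, 0 < e -> (G b - F b) - (G a - F a) <= e * (b - a) + e.
  apply: le_trans (Fle1 a b); rewrite lee_fin.
  apply/ler_addgt0Pr => e e0.
  have h1 := H (e / 2) (divr_gt0 e0 (ltr0Sn _ 1)).
  have h2 : (e / 2) * (b - a) <= e / 2 * 1.
    by rewrite ler_wpM2l ?divr_ge0 ?(ltW e0)// lerBlDr (le_trans b1)// lerDl.
  clear -h1 h2; lra.
move=> e e0.
have [del del0 Hdel] := AC e e0.
have [N [mN N0 NP]] := @filterI _ _ (ae_filter_ringOfSetsType mu) _ _ dG dF.
have [U [oU NU muU]] : exists U : set R, [/\ open U, N `<=` U & (mu U < del%:E)%E].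
  have [|U [oU NU UN]] := lebesgue_regularity_outer mN _ del0.
    by rewrite [X in (X < _)%E]N0.
  exists U; split => //.
  rewrite -(setDUK NU) measureU//; last 2 first.
    by apply: measurableD => //; exact: open_measurable.
    by rewrite setDE setICA setICr setI0.
  by rewrite [X in (X + _ < _)%E]N0 add0e.
pose D t := G t - F t.
pose ok x y := D y - D x <= e * (y - x) \/ `[x, y] `<=` U.
have [t /andP[at_ tb]|s [ps ls]] := @cousin ok a b ab.
  have [Nt|nNt] := pselect (N t).
    have [d /= d0 dU] := (nbhs_ballP _ _).1 (open_nbhs_nbhs (conj oU (NU _ Nt))).
    exists d => // x y xt ty xy xyd; right => z /=; rewrite in_itv/= => zxy.
    by apply/dU/(ball_within xt ty zxy xyd).
  have [Gt [dFt Ft]] : (0 <= t <= 1 -> exists2 dG : R, is_derive t 1 G dG & dG <= l t) /\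
      (derivable F t 1 /\ (F^`()%classic) t = f t).
    by apply: contrapT => H; exact/nNt/NP.
  have t01 : 0 <= t <= 1 by rewrite (le_trans a0 at_) (le_trans tb b1).
  have [g dGt gl] := Gt t01.
  have ft : f t = l t by rewrite /f patchE mem_set//= in_itv.
  have dFt' : is_derive t 1 F (f t) by rewrite -Ft derive1E; apply: derivableP.
  have dD : is_derive t 1 D (g - f t) by apply: is_deriveB.
  have gf : g - f t <= 0 by rewrite subr_le0 ft.
  have [d d0 Hd] := is_derive_le0_incr dD gf e0.
  by exists d => // x y /andP[_ xt] /andP[ty _] xy xyd; left; exact: Hd.
pose x i := nth a (a :: s) i.
have xlt i : (i < size s)%N -> x i < x i.+1 /\ ok (x i) (x i.+1).
  move=> ils; have /andP[? /asboolP ?] := (pathP a ps) _ ils.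
  by [].
have xmono i j : (i <= j <= size s)%N -> x i <= x j.
  case/andP; elim: j => [|j IH]; first by rewrite leqn0 => /eqP->.
  rewrite leq_eqVlt => /predU1P[->//|ij] js.
  by rewrite (le_trans (IH ij (ltnW js)))// ltW//; case: (xlt j js).
have x0 : x 0%N = a by [].
have xs : x (size s) = b by rewrite -ls -[RHS](nth_last a (a :: s)).
pose inU i := `[< `[x i, x i.+1] `<=` U >].
(* Intervals not inside [U] are collapsed to a point, so that the absolute continuity of [G] applies
   to one family indexed by all [i]. *)
pose r i := if inU i then x i.+1 else x i.
have xr i : (i < size s)%N -> x i <= r i <= x i.+1.
  move=> ils; have [/ltW xx _] := xlt _ ils.
  by rewrite /r; case: ifP => _; rewrite lexx xx.
have xj01 i : (i <= size s)%N -> 0 <= x i <= 1.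
  move=> ils; apply/andP; split.
    by rewrite (le_trans a0)// -x0 xmono.
  by apply: le_trans b1; rewrite -xs xmono// ils leqnn.
have tI : trivIset setT (fun i : 'I_(size s) => `]x i, r i[%classic).
  move=> i j _ _ [z /=]; rewrite !in_itv/= => -[/andP[zi1 zi2] /andP[zj1 zj2]].
  apply: val_inj => /=; case: (ltngtP i j) => // ij.
    have := @xmono i.+1 j; rewrite ij ltnW// => /(_ isT) h.
    have /andP[_ h2] := xr i (ltn_ord i).
    by have := lt_trans zj1 (lt_le_trans zi2 (le_trans h2 h)); rewrite ltxx.
  have := @xmono j.+1 i; rewrite ij ltnW// => /(_ isT) h.
  have /andP[_ h2] := xr j (ltn_ord j).
  by have := lt_trans zi1 (lt_le_trans zj2 (le_trans h2 h)); rewrite ltxx.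
have sdel : \sum_(i < size s) (r i - x i) < del.
  rewrite -lte_fin; apply: le_lt_trans muU.
  pose A i : set R := if (i < size s)%N then `]x i, r i[%classic else set0.
  have mA i : measurable (A i) by rewrite /A; case: ifP.
  have tA : trivIset setT A.
    move=> i j _ _; rewrite /A; case: ifPn => [iz|_]; case: ifPn => [jz|_];
      rewrite ?set0I ?setI0; try by case.
    by move=> H; have [] := tI (Ordinal iz) (Ordinal jz) I I H.
  apply: (@le_trans _ _ (mu (\big[setU/set0]_(i < size s) A i))); last first.
    apply: le_measure; rewrite ?inE.
    - by apply: bigsetU_measurable => i _; exact: mA.
    - exact: open_measurable.
    - move=> z; rewrite -bigcup_mkord => -[i /= iz]; rewrite /A iz/= in_itv/= => /andP[z1 z2].
      move: z2; rewrite /r /inU; case: ifPn => [/asboolP sub z2|_ z2]; last by move: (lt_trans z1 z2); rewrite ltxx.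
      by apply: sub; rewrite /= in_itv/= !ltW.
  rewrite measure_bigsetU// -sumEFin lee_sum// => i _.
  rewrite /A ltn_ord [leRHS]lebesgue_measure_itv/= lte_fin.
  case: ifPn => //; rewrite -leNgt lee_fin => ?.
  by rewrite subr_le0.
have cond (i : 'I_(size s)) : [/\ 0 <= x i, x i <= r i & r i <= 1].
  have /andP[? ?] := xr i (ltn_ord i).
  have /andP[? _] := xj01 i (ltnW (ltn_ord i)).
  have /andP[_ ?] := xj01 i.+1 (ltn_ord i).
  by split => //; apply: le_trans (_ : x i.+1 <= 1).
have HG := Hdel _ (fun i : 'I_(size s) => x i) (fun i => r i) cond tI sdel.
rewrite -/(D b) -/(D a) -x0 -xs -(telescope_sumr (fun i => D (x i)))// big_mkord.
rewrite -(telescope_sumr (fun i => x i))// big_mkord mulr_sumr.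
apply: le_trans (lerD (lexx _) (ltW HG)).
rewrite -big_split/=; apply: ler_sum => i _.
have [xx okx] := xlt i (ltn_ord i).
rewrite /r /inU; case: ifPn => [_|/asboolP nU].
  have h1 := Fmono _ _ (ltW xx).
  have h2 : 0 <= e * (x i.+1 - x i) by apply: mulr_ge0; rewrite ?subr_ge0 ltW.
  have h3 := ler_norm (G (x i.+1) - G (x i)).
  by rewrite /D; clear -h1 h2 h3; lra.
rewrite subrr normr0 addr0.
by case: okx.
Qed.
End Growth.

(** * Stability of absolute continuity *)

Section AbsolutelyContinuous.
Context {R : realType}.

(** Source of most of the stability results: for components, products and Lipschitz functions it
    suffices to compare increments. *)
Lemma AC_dominated {V W : normedModType R} (f : R -> V) (g : R -> W) (C : R) :
  (forall s t, 0 <= s <= 1 -> 0 <= t <= 1 -> `|g s - g t| <= C * `|f s - f t|) ->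
  absolutely_continuous 0 1 f -> absolutely_continuous 0 1 g.
Proof.
move=> gf ACf e e0.
have C1 : 0 < `|C| + 1 by rewrite ltr_wpDl.
have [d d0 Hd] := ACf (e / (`|C| + 1)) (divr_gt0 e0 C1).
exists d => // n l r lr tI slr.
have := Hd n l r lr tI slr; rewrite ltr_pdivlMr// mulr_suml.
apply: le_lt_trans; apply: ler_sum => i _.
have [li lri ri] := lr i.
have h1 : 0 <= r i <= 1 by rewrite ri (le_trans li lri).
have h2 : 0 <= l i <= 1 by rewrite li (le_trans lri ri).
rewrite (le_trans (gf _ _ h1 h2))// mulrC ler_wpM2l//.
by rewrite (le_trans (ler_norm C))// lerDl.
Qed.

Lemma AC_lipschitz {V : normedModType R} (f : R -> V) (C : R) :
  (forall s t, 0 <= s <= 1 -> 0 <= t <= 1 -> `|f s - f t| <= C * `|s - t|) ->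
  absolutely_continuous 0 1 f.
Proof.
move=> H; apply: (@AC_dominated _ _ (id : R -> R) f C H) => e e0.
exists e => // n l r lr _; apply: le_lt_trans; apply: ler_sum => i _.
by have [? ? ?] := lr i; rewrite ger0_norm// subr_ge0.
Qed.

Lemma ACMl (f : R -> R) (c : R) :
  absolutely_continuous 0 1 f -> absolutely_continuous 0 1 (fun t => c * f t).
Proof.
apply: (@AC_dominated _ _ f _ `|c|) => s t _ _.
by rewrite -mulrBr normrM.
Qed.

Lemma AC_cst {V : normedModType R} (c : V) :
  absolutely_continuous 0 1 (fun _ : R => c).
Proof. by apply: (@AC_lipschitz _ _ 0) => s t _ _; rewrite subrr normr0 mul0r. Qed.

Lemma ACD {V : normedModType R} (f g : R -> V) :
  absolutely_continuous 0 1 f -> absolutely_continuous 0 1 g ->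
  absolutely_continuous 0 1 (fun t => f t + g t).
Proof.
move=> ACf ACg e e0; have e20 : 0 < e / 2 by rewrite divr_gt0.
have [d d0 Hd] := ACf _ e20; have [d' d'0 Hd'] := ACg _ e20.
exists (Num.min d d'); first by rewrite lt_min d0.
move=> n l r lr tI; rewrite lt_min => /andP[s1 s2].
have := ltrD (Hd n l r lr tI s1) (Hd' n l r lr tI s2).
rewrite -splitr -big_split; apply: le_lt_trans; apply: ler_sum => i _ /=.
by rewrite opprD addrACA ler_normD.
Qed.

Lemma AC_pair {V W : normedModType R} (f : R -> V) (g : R -> W) :
  absolutely_continuous 0 1 f -> absolutely_continuous 0 1 g ->
  absolutely_continuous 0 1 (fun t => (f t, g t)).
Proof.
move=> ACf ACg.
have -> : (fun t => (f t, g t)) = (fun t => (f t, 0) + (0, g t) : V * W).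
  by apply/funext => t; congr (_, _) => /=; rewrite ?addr0 ?add0r.
apply: ACD.
  apply: (@AC_dominated _ _ f _ 1) => // s t _ _.
  by rewrite mul1r prod_normE/= subr0 normr0 ge_max lexx/=.
apply: (@AC_dominated _ _ g _ 1) => // s t _ _.
by rewrite mul1r prod_normE/= subr0 normr0 ge_max lexx/= andbT.
Qed.

Lemma AC_fst {V W : normedModType R} (f : R -> V * W) :
  absolutely_continuous 0 1 f -> absolutely_continuous 0 1 (fun t => (f t).1).
Proof.
apply: (@AC_dominated _ _ _ _ 1) => s t _ _.
by rewrite mul1r prod_normE le_max lexx.
Qed.

Lemma AC_snd {V W : normedModType R} (f : R -> V * W) :
  absolutely_continuous 0 1 f -> absolutely_continuous 0 1 (fun t => (f t).2).
Proof.
apply: (@AC_dominated _ _ _ _ 1) => s t _ _.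
by rewrite mul1r prod_normE le_max lexx orbT.
Qed.

(** Meant for the clamped reparametrisations of [concat_curve], which are constant on half of the
    line; hence [phi] is nondecreasing but not injective. *)
Lemma AC_comp {V : normedModType R} (f : R -> V) (phi : R -> R) (C : R) :
  0 < C ->
  (forall s t, s <= t -> phi s <= phi t /\ phi t - phi s <= C * (t - s)) ->
  (forall t, 0 <= t <= 1 -> 0 <= phi t <= 1) ->
  absolutely_continuous 0 1 f -> absolutely_continuous 0 1 (f \o phi).
Proof.
move=> C0 phiP phi01 ACf e e0; have [d d0 Hd] := ACf e e0.
exists (d / C); first by rewrite divr_gt0.
move=> n l r lr tI; rewrite ltr_pdivlMr// mulrC => slr.
apply: (Hd n (phi \o l) (phi \o r)) => [i|i j _ _ [z /=]|].
- have [li lri ri] := lr i; have [? _] := phiP _ _ lri.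
  have /andP[? _] : 0 <= phi (l i) <= 1 by apply: phi01; rewrite li (le_trans lri ri).
  have /andP[_ ?] : 0 <= phi (r i) <= 1 by apply: phi01; rewrite ri (le_trans li lri).
  by split.
- rewrite !in_itv/= => -[/andP[z1 z2] /andP[z3 z4]].
  apply: (tI i j I I).
  have phi_lt s t : phi s < phi t -> s < t.
    by rewrite !ltNge; apply: contra => /phiP[].
  have [_ lri _] := lr i; have [_ lrj _] := lr j.
  (* If the images of two intervals overlap, so do the intervals; the midpoint of their intersection
     is the common point. *)
  pose m := Num.max (l i) (l j); pose M := Num.min (r i) (r j).
  have mM : m < M.
    rewrite /m /M lt_min !gt_max; apply/andP; split; apply/andP; split.
    - exact: phi_lt (lt_trans z1 z2).
    - exact: phi_lt (lt_trans z3 z2).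
    - exact: phi_lt (lt_trans z1 z4).
    - exact: phi_lt (lt_trans z3 z4).
  have := midf_lt mM; set c := (m + M) / 2 => -[mc cM].
  exists c; rewrite /= !in_itv/=.
  by move: mc cM; rewrite /m /M lt_min !gt_max => /andP[-> ->] /andP[-> ->].
- apply: le_lt_trans slr; rewrite mulr_sumr; apply: ler_sum => i _ /=.
  by have [_ lri _] := lr i; have [] := phiP _ _ lri.
Qed.

(** By steps of length d/2, each of which changes [f] by at most 1. The bound is needed for
    products, in [ACM]. *)
Lemma AC_bounded {V : normedModType R} (f : R -> V) :
  absolutely_continuous 0 1 f ->
  exists M, forall t, 0 <= t <= 1 -> `|f t| <= M.
Proof.
move=> ACf; have [d d0 Hd] := ACf 1 ltr01.
have step s t : 0 <= s -> s <= t -> t <= 1 -> t - s < d -> `|f t - f s| <= 1.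
  move=> s0 st t1 std.
  have := Hd 1%N (fun=> s) (fun=> t); rewrite !big_ord1 => /(_ _ _ _)/ltW; apply => //.
  by move=> i j _ _ _; rewrite !ord1.
have H k t : 0 <= t <= 1 -> t <= k%:R * (d / 2) -> `|f t| <= `|f 0| + k%:R.
  elim: k t => [|k IH] t /andP[t0 t1].
    rewrite mul0r addr0 => tle.
    by have -> : t = 0 by apply/le_anti; rewrite tle t0.
  move=> tk.
  pose s := Num.max 0 (t - d / 2).
  have s0 : 0 <= s by rewrite /s le_max lexx.
  have st : s <= t by rewrite /s ge_max t0 lerBlDr lerDl divr_ge0// ltW.
  have ts : t - s < d.
    have h : t - d / 2 <= s by rewrite /s le_max lexx orbT.
    by clear -d0 h; lra.
  have sk : s <= k%:R * (d / 2).
    rewrite /s ge_max mulr_ge0 ?divr_ge0 ?(ltW d0)//=.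
    by move: tk; rewrite -natr1 mulrDl mul1r lerBlDr.
  have h1 := IH s _ sk; have h2 := step s t s0 st t1 ts.
  have h3 : `|f t| <= `|f t - f s| + `|f s| by rewrite -{1}(subrK (f s) (f t)) ler_normD.
  have h4 : `|f s| <= `|f 0| + k%:R by apply: h1; rewrite s0 (le_trans st t1).
  by rewrite -natr1; clear -h2 h3 h4; lra.
have d20 : 0 < d / 2 by rewrite divr_gt0.
exists (`|f 0| + (Num.truncn ((d / 2)^-1)).+1%:R) => t t01.
apply: H => //; have /andP[_ t1] := t01; apply: (le_trans t1).
by rewrite -ler_pdivrMr// mul1r ltW// truncnS_gt.
Qed.

Lemma AC_C1 (f f' : R -> R) : (forall t : R, is_derive t 1 f (f' t)) ->
  continuous f' -> absolutely_continuous 0 1 f.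
Proof.
move=> df cf'.
have [M HM] : exists M, forall t, 0 <= t <= 1 -> `|f' t| <= M.
  have cn : {within `[0, 1], continuous (fun t => `|f' t|)}.
    by apply: continuous_subspaceT => t; apply: cvg_norm; exact: cf'.
  have [c _ Hc] := EVT_max ler01 cn.
  by exists `|f' c| => t t01; apply: Hc; rewrite in_itv.
have key s t : 0 <= s -> s <= t -> t <= 1 -> `|f t - f s| <= M * `|t - s|.
  move=> s0 st t1.
  have [|c] := MVT_segment st (fun x _ => df x).
    by apply: derivable_within_continuous => x _; exact: (@ex_derive _ _ _ _ _ _ _ (df x)).
  rewrite in_itv/= => /andP[sc ct] ->; rewrite normrM ler_wpM2r// HM//.
  by rewrite (le_trans s0 sc) (le_trans ct t1).
apply: (@AC_lipschitz _ _ M) => s t /andP[s0 s1] /andP[t0 t1].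
have [st|ts] := leP s t; last exact: key (ltW ts) _.
by rewrite distrC (distrC s) key.
Qed.

End AbsolutelyContinuous.

(** * Horizontal curves in coordinates and their affine images *)

Section Horizontal.
Context {R : realType}.
Local Notation mu := (@lebesgue_measure R).
Local Notation heis := (R * R * R)%type.
Implicit Types (g h : heis) (t : R).

Lemma ae_imply (P Q : R -> Prop) : (forall t, P t -> Q t) ->
  {ae mu, forall t, P t} -> {ae mu, forall t, Q t}.
Proof. by move=> PQ; apply: (@filterS _ _ (ae_filter_ringOfSetsType mu)). Qed.

Lemma ae_and (P Q : R -> Prop) : {ae mu, forall t, P t} -> {ae mu, forall t, Q t} ->
  {ae mu, forall t, P t /\ Q t}.
Proof. exact: (@filterI _ _ (ae_filter_ringOfSetsType mu)). Qed.

Lemma is_derive_cvgP {V : normedModType R} (f : R -> V) t (v : V) :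
  is_derive t 1 f v <->
  (fun h : R => h^-1 *: (f (h *: 1 + t) - f t)) @ 0^' --> v.
Proof.
split=> [[dv <-]|cv]; first exact: dv.
by split; [apply/cvg_ex; exists v|apply: cvg_lim].
Qed.

Lemma is_derive_pairP {V W : normedModType R} (f : R -> V * W) t (v : V * W) :
  is_derive t 1 f v <->
  is_derive t 1 (fun s => (f s).1) v.1 /\ is_derive t 1 (fun s => (f s).2) v.2.
Proof.
split=> [/is_derive_cvgP cv|[/is_derive_cvgP c1 /is_derive_cvgP c2]].
  split; apply/is_derive_cvgP.
    exact: (cvg_comp _ _ cv (@cvg_fst _ _ _ _ _)).
  exact: (cvg_comp _ _ cv (@cvg_snd _ _ _ _ _)).
apply/is_derive_cvgP; rewrite [v]surjective_pairing.
exact: cvg_pair c1 c2.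
Qed.

Definition lp_norm (p a b : R) : R := (`|a| `^ p + `|b| `^ p) `^ p^-1.

Lemma lp_norm_ge0 p a b : 0 <= lp_norm p a b.
Proof. exact: powR_ge0. Qed.

Lemma horizontalP (gam : R -> heis) (u1 u2 : R -> R) :
  horizontal gam u1 u2 <->
  [/\ absolutely_continuous 0 1 gam,
      measurable_fun (`[0, 1]%classic : set R) u1,
      measurable_fun (`[0, 1]%classic : set R) u2 &
      {ae mu, forall t : R, 0 <= t <= 1 ->
        [/\ is_derive t 1 (fun s => (gam s).1.1) (u1 t),
            is_derive t 1 (fun s => (gam s).1.2) (u2 t) &
            is_derive t 1 (fun s => (gam s).2)
              (((gam t).1.1 * u2 t - (gam t).1.2 * u1 t) / 2)]}].
Proof.
have sE (a b : R) : a *: (b : R) = a * b by [].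
have E t : u1 t *: vfX (gam t) + u2 t *: vfY (gam t) =
    (u1 t, u2 t, ((gam t).1.1 * u2 t - (gam t).1.2 * u1 t) / 2).
  rewrite /vfX /vfY; congr (_, _, _) => /=; rewrite !sE ?mulr1 ?mulr0 ?add0r ?addr0//.
  by field.
split=> -[AC m1 m2 dg]; split => //; move: dg; apply: ae_imply => t H t01;
  have {H} := H t01; rewrite ?E.
  by move=> /is_derive_pairP[/is_derive_pairP[d1 d2] d3]; split.
by move=> [d1 d2 d3]; apply/is_derive_pairP; split => //; apply/is_derive_pairP.
Qed.

Lemma measurable_lp_norm (D : set R) p (u1 u2 : R -> R) :
  measurable D -> measurable_fun D u1 -> measurable_fun D u2 ->
  measurable_fun D (fun t => lp_norm p (u1 t) (u2 t)).
Proof.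
move=> mD m1 m2; apply: (measurableT_comp (measurable_powR p^-1)).
apply: measurable_funD; apply: (measurableT_comp (measurable_powR p)).
  exact: measurableT_comp.
exact: measurableT_comp.
Qed.

Lemma horizontal_growth p K (gam : R -> heis) (u1 u2 G : R -> R) a b :
  horizontal gam u1 u2 -> absolutely_continuous 0 1 G -> 0 <= K ->
  {ae mu, forall t : R, 0 <= t <= 1 ->
    exists2 dG : R, is_derive t 1 G dG & dG <= K * lp_norm p (u1 t) (u2 t)} ->
  0 <= a -> a <= b -> b <= 1 ->
  ((G b - G a)%:E <= K%:E * lp_length p u1 u2)%E.
Proof.
move=> [_ m1 m2 _] ACG K0 dG a0 ab b1.
rewrite /lp_length -ge0_integralZl//; last first.
  by apply/measurable_EFinP; exact: measurable_lp_norm.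
under eq_integral => t _ do rewrite -EFinM.
apply: AC_growth => //.
  apply: measurable_funM => //; exact: measurable_lp_norm.
by move=> t; rewrite mulr_ge0// powR_ge0.
Qed.

Definition joins p g h (l : \bar R) := exists (gam : R -> heis) (u1 u2 : R -> R),
  [/\ horizontal gam u1 u2, gam 0 = g, gam 1 = h & l = lp_length p u1 u2].

Lemma lp_length_ge0 p (u1 u2 : R -> R) : (0 <= lp_length p u1 u2)%E.
Proof. by apply: integral_ge0 => t _; rewrite lee_fin powR_ge0. Qed.

Lemma heis_dist_le p g h l : joins p g h l -> (heis_dist p g h <= l)%E.
Proof. by move=> H; apply: ereal_inf_lbound. Qed.

Lemma le_heis_dist p g h (l : \bar R) :
  (forall l', joins p g h l' -> (l <= l')%E) -> (l <= heis_dist p g h)%E.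
Proof. by move=> H; apply: le_ereal_inf_tmp => l'; exact: H. Qed.

Lemma heis_dist_ge0 p g h : (0 <= heis_dist p g h)%E.
Proof.
by apply: le_heis_dist => l [gam [u1 [u2 [_ _ _ ->]]]]; exact: lp_length_ge0.
Qed.

Lemma is_derive_lin2 (X Y : R -> R) t dX dY a b c :
  is_derive t 1 X dX -> is_derive t 1 Y dY ->
  is_derive t 1 (fun s => a * X s + b * Y s + c) (a * dX + b * dY).
Proof.
move=> hX hY.
have := is_deriveD (is_deriveD (is_deriveZ a hX) (is_deriveZ b hY)) (is_derive_cst c t 1).
by rewrite addr0.
Qed.

Lemma is_derive_lin3 (X Y Z : R -> R) t dX dY dZ a b e c :
  is_derive t 1 X dX -> is_derive t 1 Y dY -> is_derive t 1 Z dZ ->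
  is_derive t 1 (fun s => a * X s + b * Y s + e * Z s + c) (a * dX + b * dY + e * dZ).
Proof.
move=> hX hY hZ.
have := is_deriveD (is_deriveD (is_deriveD (is_deriveZ a hX) (is_deriveZ b hY))
  (is_deriveZ e hZ)) (is_derive_cst c t 1).
by rewrite addr0.
Qed.

Definition heis_affine (a1 a2 b1 b2 e1 e2 e3 : R) (k : heis) (g : heis) : heis :=
  (a1 * g.1.1 + a2 * g.1.2 + k.1.1, b1 * g.1.1 + b2 * g.1.2 + k.1.2,
   e1 * g.1.1 + e2 * g.1.2 + e3 * g.2 + k.2).

(** Left translations, dilations and the symmetries exchanging or reflecting the axes all have this
    form. The identity required of [Phi] says that it maps horizontal velocities to horizontal
    velocities; [K] bounds its linear part for the l^p norm. *)
Lemma heis_dist_affine p (a1 a2 b1 b2 e1 e2 e3 : R) k K g h l :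
  let Phi := heis_affine a1 a2 b1 b2 e1 e2 e3 k in
  0 <= K ->
  (forall u v, lp_norm p (a1 * u + a2 * v) (b1 * u + b2 * v) <= K * lp_norm p u v) ->
  (forall (w : heis) u v,
     ((Phi w).1.1 * (b1 * u + b2 * v) - (Phi w).1.2 * (a1 * u + a2 * v)) / 2 =
     e1 * u + e2 * v + e3 * ((w.1.1 * v - w.1.2 * u) / 2)) ->
  joins p g h l -> (heis_dist p (Phi g) (Phi h) <= K%:E * l)%E.
Proof.
move=> Phi K0 HK Hz [gam [u1 [u2 [hor g0 g1 ->]]]].
pose v1 t := a1 * u1 t + a2 * u2 t; pose v2 t := b1 * u1 t + b2 * u2 t.
apply: (@le_trans _ _ (lp_length p v1 v2)).
  apply: heis_dist_le; exists (Phi \o gam), v1, v2; split => //=; rewrite ?g0 ?g1//.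
  have [ACg m1 m2 dg] := (horizontalP _ _ _).1 hor.
  apply/horizontalP; split.
  - have ACX := AC_fst (AC_fst ACg); have ACY := AC_snd (AC_fst ACg); have ACZ := AC_snd ACg.
    apply: AC_pair; first apply: AC_pair; rewrite /=; repeat apply: ACD => //;
      by [exact: ACMl|exact: AC_cst].
  - by apply: measurable_funD; apply: measurable_funM.
  - by apply: measurable_funD; apply: measurable_funM.
  - move: dg; apply: ae_imply => t H t01; have [dX dY dZ] := H t01; split => /=.
    + exact: is_derive_lin2.
    + exact: is_derive_lin2.
    + rewrite Hz; exact: is_derive_lin3.
have [_ m1 m2 _] := hor.
have mv1 : measurable_fun (`[0, 1]%classic : set R) v1.
  by apply: measurable_funD; apply: measurable_funM.
have mv2 : measurable_fun (`[0, 1]%classic : set R) v2.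
  by apply: measurable_funD; apply: measurable_funM.
rewrite /lp_length -ge0_integralZl//; last first.
  by apply/measurable_EFinP; exact: measurable_lp_norm.
apply: ge0_le_integral => //.
- by apply/measurable_EFinP; exact: measurable_lp_norm.
- apply: measurable_funeM; apply/measurable_EFinP; exact: measurable_lp_norm.
by move=> t _; rewrite -EFinM lee_fin; exact: HK.
Qed.
Lemma is_derive_continuous (f f' : R -> R) :
  (forall t, is_derive t 1 f (f' t)) -> continuous f.
Proof.
move=> df t; apply: differentiable_continuous; apply/derivable1_diffP.
exact: (@ex_derive _ _ _ _ _ _ _ (df t)).
Qed.

(** The length is supplied through a primitive [L] of the speed, so that applications have no
    integral to compute. *)
Lemma heis_dist_C1 p (X Y Z u1 u2 L : R -> R) :
  continuous u1 -> continuous u2 -> continuous (fun t => lp_norm p (u1 t) (u2 t)) ->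
  (forall t, is_derive t 1 X (u1 t)) -> (forall t, is_derive t 1 Y (u2 t)) ->
  (forall t, is_derive t 1 Z ((X t * u2 t - Y t * u1 t) / 2)) ->
  (forall t, is_derive t 1 L (lp_norm p (u1 t) (u2 t))) ->
  (heis_dist p (X 0%R, Y 0%R, Z 0%R) (X 1%R, Y 1%R, Z 1%R) <= (L 1 - L 0)%:E)%E.
Proof.
move=> c1 c2 cn dX dY dZ dL.
have cX := is_derive_continuous dX; have cY := is_derive_continuous dY.
have cZ' : continuous (fun t => (X t * u2 t - Y t * u1 t) / 2).
  move=> t; apply: cvgMl; apply: cvgB; apply: cvgM;
    by [exact: cX|exact: cY|exact: c1|exact: c2].
have -> : ((L 1 - L 0)%:E = lp_length p u1 u2)%E.
  rewrite /lp_length (@continuous_FTC2 _ _ L) ?EFinB//.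
  - exact: continuous_subspaceT.
  - have cL := is_derive_continuous dL; split.
    + by move=> t _; exact: (@ex_derive _ _ _ _ _ _ _ (dL t)).
    + by apply: cvg_at_right_filter; exact: cL.
    + by apply: cvg_at_left_filter; exact: cL.
  - by move=> t _; rewrite derive1E; exact: (@derive_val _ _ _ _ _ _ _ (dL t)).
apply: heis_dist_le; exists (fun t => (X t, Y t, Z t)), u1, u2; split => //.
apply/horizontalP; split.
- by apply: AC_pair; first apply: AC_pair; apply: AC_C1; eassumption.
- by apply: measurable_funTS; exact: continuous_measurable_fun.
- by apply: measurable_funTS; exact: continuous_measurable_fun.
- by apply: (@filterE _ _ (ae_filter_ringOfSetsType mu)) => t _; split => /=.
Qed.

End Horizontal.

(** * Affine change of variable for Lebesgue measure *)

Section AffineChange.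
Context {R : realType}.
Local Notation mu := (@lebesgue_measure R).
Local Notation borelR := (measurableTypeR R).
Variables (a b : R).
Hypothesis a0 : 0 < a.
Let phi : borelR -> borelR := fun t => a * t + b.

Let mphi : measurable_fun setT phi.
Proof. by apply: measurable_funD => //; apply: measurable_funM. Qed.

Let aN : {nonneg R} := NngNum (ltW a0).

Let nu : {measure set borelR -> \bar R} :=
  mscale aN (measure_function_pushforward__canonical__measure_function_Measure mu mphi).

(** Uniqueness of Lebesgue measure: the rescaled push-forward [nu] agrees with it on half-open
    intervals. *)
Lemma lebesgue_measure_affine (A : set R) : measurable A ->
  mu A = (a%:E * mu (phi @^-1` A))%E.
Proof.
apply: (@lebesgue_measure_unique _ nu) => X [[x y] _ <-] /=.
have -> : nu `]x, y]%classic = (a%:E * mu (phi @^-1` `]x, y]%classic))%E by [].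
have -> : phi @^-1` `]x, y]%classic = `]((x - b) / a), ((y - b) / a)]%classic.
  apply/seteqP; split => t /=; rewrite !in_itv/= /phi.
    by rewrite ltr_pdivrMr// ler_pdivlMr// (mulrC t) ltrBlDr lerBrDr.
  by rewrite ltr_pdivrMr// ler_pdivlMr// (mulrC t) ltrBlDr lerBrDr.
have -> : mu `]x, y]%classic = if x < y then (y - x)%:E else 0%E.
  by rewrite [LHS]lebesgue_measure_itv/= lte_fin -EFinB.
have -> : mu `]((x - b) / a), ((y - b) / a)]%classic = if x < y then ((y - x) / a)%:E else 0%E.
  rewrite [LHS]lebesgue_measure_itv/= lte_fin ltr_pM2r ?invr_gt0// ltrBlDr subrK.
  by case: ifP => // _; rewrite -EFinB; congr EFin; field; rewrite gt_eqF.
case: ifP => _; last by rewrite mule0.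
by rewrite -EFinM; congr EFin; field; rewrite gt_eqF.
Qed.

Lemma ae_affine (P : R -> Prop) : {ae mu, forall t, P t} ->
  {ae mu, forall t, P (a * t + b)}.
Proof.
move=> [N [mN N0 NP]]; exists (phi @^-1` N); split.
- by rewrite -[X in measurable X]setTI; exact: mphi.
- have := lebesgue_measure_affine mN; rewrite [X in X = _ -> _]N0 => /esym/eqP.
  by rewrite mule_eq0 => /orP[|/eqP//]; rewrite eqe gt_eqF.
- by move=> t /= nP; exact: NP.
Qed.

Lemma integral_affine (D : set R) (f : R -> R) : measurable D ->
  measurable_fun D f -> (forall t, D t -> 0 <= f t) ->
  (\int[mu]_(t in D) (f t)%:E =
   \int[mu]_(t in [set t | D (a * t + b)%R]) (a * f (a * t + b))%:E)%E.
Proof.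
move=> mD mf f0.
have mef : measurable_fun D (EFin \o f) by apply/measurable_EFinP.
rewrite (@eq_measure_integral _ _ _ _ nu); last first.
  by move=> A mA _; exact: lebesgue_measure_affine.
rewrite /nu/= ge0_integral_mscale//=.
rewrite ge0_integral_pushforward//=; last by move=> t /set_mem Dt; rewrite lee_fin f0.
rewrite -ge0_integralZl//=.
- by rewrite -[X in measurable X]setTI; exact: mphi.
- by apply: (measurable_comp mD _ mef (measurable_funTS mphi)) => _ [t Dt <-].
- by move=> t Dt; rewrite lee_fin f0.
- by rewrite lee_fin ltW.
Qed.
End AffineChange.

(** * Concatenation of curves and the triangle inequality *)

Section Triangle.
Context {R : realType}.
Local Notation mu := (@lebesgue_measure R).
Local Notation heis := (R * R * R)%type.

Lemma lp_normZ p (c u v : R) : 0 < p -> 0 <= c ->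
  lp_norm p (c * u) (c * v) = c * lp_norm p u v.
Proof.
move=> p0 c0; rewrite /lp_norm !normrM (ger0_norm c0) !powRM// -mulrDr.
rewrite powRM ?addr_ge0 ?powR_ge0//.
by rewrite -powRrM mulfV ?gt_eqF// powRr1.
Qed.

Lemma is_derive_affine_comp (f : R -> R) (t a b d : R) : is_derive (a * t + b) 1 f d ->
  is_derive t 1 (fun s => f (a * s + b)) (a * d).
Proof.
move=> df.
have dg : is_derive t 1 (fun s : R => a * s + b) a.
  have := is_deriveD (is_deriveZ a (is_derive_id t 1)) (is_derive_cst b t 1).
  by rewrite addr0 [a *: _]mulr1.
rewrite mulrC; exact: (@is_derive1_comp R f (fun s => a * s + b) t d a df dg).
Qed.

(** Clamping writes the concatenation as a sum of two absolutely continuous curves, each constant on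
    one half, so that nothing has to be glued. The terms [+ 0] and [+ -1] match the form of the
    affine change of variable. *)
Definition concat_curve (c1 c2 : R -> heis) (t : R) : heis :=
  c1 (Num.min (2 * t + 0) 1) + (c2 (Num.max (2 * t + -1) 0) - c2 0).

Definition concat_control (u1 u2 : R -> R) (t : R) : R :=
  if t < 2^-1 then 2 * u1 (2 * t + 0) else 2 * u2 (2 * t + -1).

Let half_lt t : (t < 2^-1) = (2 * t + 0 < 1 :> R).
Proof. by rewrite addr0 -ltr_pdivlMl// mulr1. Qed.

Let half1 : 2 * 0 + 0 = 0 :> R. Proof. by rewrite mulr0 addr0. Qed.
Let half2 : 2 * 2^-1 + 0 = 1 :> R. Proof. by rewrite divff// addr0. Qed.
Let half3 : 2 * 2^-1 + -1 = 0 :> R. Proof. by rewrite divff// subrr. Qed.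
Let half4 : 2 * 1 + -1 = 1 :> R. Proof. by rewrite mulr1 -[X in X + _](natrD _ 1 1) addrK. Qed.

Lemma measurable_concat_control (u1 u2 : R -> R) :
  measurable_fun (`[0, 1]%classic : set R) u1 ->
  measurable_fun (`[0, 1]%classic : set R) u2 ->
  measurable_fun (`[0, 1]%classic : set R) (concat_control u1 u2).
Proof.
move=> m1 m2.
have -> : (`[0, 1]%classic : set R) = `[0, 2^-1[%classic `|` `[2^-1, 1]%classic.
  rewrite -(@itv_bndbnd_setU _ _ _ (BLeft 2^-1))// bnd_simp.
    by rewrite invr_ge0.
  by rewrite invf_le1// ler1n.
have mA c : measurable_fun setT (fun t : R => 2 * t + c).
  by apply: measurable_funD => //; apply: measurable_funM.
have H1 : measurable_fun (`[0, 2^-1[%classic : set R) (fun t => 2 * u1 (2 * t + 0)).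
  apply: measurable_funM => //.
  apply: (measurable_comp _ _ m1 (measurable_funTS (mA 0))) => //.
  by move=> _ [t + <-]; rewrite /= !in_itv/= half_lt addr0 => /andP[? /ltW ->]; rewrite mulr_ge0.
have H2 : measurable_fun (`[2^-1, 1]%classic : set R) (fun t => 2 * u2 (2 * t + -1)).
  apply: measurable_funM => //.
  apply: (measurable_comp _ _ m2 (measurable_funTS (mA (-1)))) => //.
  move=> _ [t + <-]; rewrite /= !in_itv/= => /andP[t1 t2].
  by apply/andP; split; lra.
apply/measurable_funU => //; split.
  apply: eq_measurable_fun H1.
  by move=> t; rewrite inE/= in_itv/= => /andP[_ t2]; rewrite /concat_control t2.
apply: eq_measurable_fun H2.
by move=> t; rewrite inE/= in_itv/= => /andP[t2 _]; rewrite /concat_control ltNge t2.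
Qed.

Lemma lp_lengthE p (u1 u2 : R -> R) : lp_length p u1 u2 =
  (\int[mu]_(t in `[0%R, 1%R]) (lp_norm p (u1 t) (u2 t))%:E)%E.
Proof. by []. Qed.

Lemma lp_length_affine p (u1 u2 : R -> R) (a b c d : R) : 0 < a ->
  a * c + b = 0 -> a * d + b = 1 ->
  measurable_fun (`[0, 1]%classic : set R) u1 ->
  measurable_fun (`[0, 1]%classic : set R) u2 ->
  lp_length p u1 u2 = (\int[mu]_(t in `[c, d])
    (a * lp_norm p (u1 (a * t + b)) (u2 (a * t + b)))%:E)%E.
Proof.
move=> a0 ac ad m1 m2.
have mN := measurable_lp_norm p (measurable_itv `[0, 1]) m1 m2.
rewrite lp_lengthE (integral_affine b a0 (measurable_itv `[0, 1]) mN); last first.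
  by move=> t _; exact: lp_norm_ge0.
have -> // : [set t | `[0%R, 1%R]%classic (a * t + b)%R] = `[c, d]%classic.
apply/seteqP; split => t /=; rewrite !in_itv/= -{1}ac -{1}ad !lerD2r !ler_pM2l//.
Qed.

Lemma lp_length_concat p (u1 u2 v1 v2 : R -> R) : 0 < p ->
  measurable_fun (`[0, 1]%classic : set R) u1 ->
  measurable_fun (`[0, 1]%classic : set R) u2 ->
  measurable_fun (`[0, 1]%classic : set R) v1 ->
  measurable_fun (`[0, 1]%classic : set R) v2 ->
  lp_length p (concat_control u1 v1) (concat_control u2 v2) =
  (lp_length p u1 u2 + lp_length p v1 v2)%E.
Proof.
move=> p0 mu1 mu2 mv1 mv2.
have I01 : (`[0, 1]%classic : set R) = `[0, 2^-1[%classic `|` `[2^-1, 1]%classic.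
  rewrite -(@itv_bndbnd_setU _ _ _ (BLeft 2^-1))// bnd_simp.
    by rewrite invr_ge0.
  by rewrite invf_le1// ler1n.
pose N t := lp_norm p (concat_control u1 v1 t) (concat_control u2 v2 t).
have mN : measurable_fun (`[0, 1]%classic : set R) N.
  by apply: measurable_lp_norm => //; exact: measurable_concat_control.
have sub1 : `[0, 2^-1[%classic `<=` (`[0, 1]%classic : set R) by rewrite I01; exact: subsetUl.
have -> : lp_length p (concat_control u1 v1) (concat_control u2 v2) =
    (\int[mu]_(t in `[0%R, 2^-1%R[) (N t)%:E + \int[mu]_(t in `[2^-1%R, 1%R]) (N t)%:E)%E.
  rewrite /lp_length -/(lp_norm _ _ _) I01 ge0_integral_setU//.
  - by rewrite -I01; apply/measurable_EFinP.
  - apply/disj_setPS => t /=; rewrite !in_itv/= => -[/andP[_ t1] /andP[t2 _]].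
    by move: (lt_le_trans t1 t2); rewrite ltxx.
have E1 : (\int[mu]_(t in `[0%R, 2^-1%R[) (N t)%:E = lp_length p u1 u2)%E.
  rewrite (lp_length_affine p (ltr0Sn R 1) half1 half2 mu1 mu2).
  have NE : {in (`[0, 2^-1[%classic : set R), (EFin \o N) =1
      (fun t => (2 * lp_norm p (u1 (2 * t + 0)) (u2 (2 * t + 0)))%:E)}.
    move=> t; rewrite inE/= in_itv/= => /andP[_ t2].
    by rewrite /N /concat_control t2 lp_normZ.
  rewrite -[RHS]integral_itv_bndo_bndc; first exact: eq_integral.
  apply: eq_measurable_fun NE _; apply/measurable_EFinP.
  exact: (measurable_funS _ sub1 mN).
have E2 : (\int[mu]_(t in `[2^-1%R, 1%R]) (N t)%:E = lp_length p v1 v2)%E.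
  rewrite (lp_length_affine p (ltr0Sn R 1) half3 half4 mv1 mv2).
  apply: eq_integral => t; rewrite inE/= in_itv/= => /andP[t2 _].
  by rewrite /N /concat_control ltNge t2/= lp_normZ.
by rewrite E1 E2.
Qed.

Lemma joins_concat (p : R) (g h k : heis) l1 l2 : 0 < p -> joins p g h l1 -> joins p h k l2 ->
  joins p g k (l1 + l2)%E.
Proof.
move=> p0 [c1 [u1 [u2 [hor1 c10 c11 ->]]]] [c2 [v1 [v2 [hor2 c20 c21 ->]]]].
have [AC1 mu1 mu2 d1] := (horizontalP _ _ _).1 hor1.
have [AC2 mv1 mv2 d2] := (horizontalP _ _ _).1 hor2.
have cl s : s < 2^-1 -> concat_curve c1 c2 s = c1 (2 * s + 0).
  rewrite /concat_curve half_lt addr0 => s1; rewrite min_l ?(ltW s1)//.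
  by rewrite max_r ?subrr ?addr0// subr_le0 ltW.
have cr s : 2^-1 < s -> concat_curve c1 c2 s = c2 (2 * s + -1).
  move=> s1; have s1' : 1 < 2 * s by rewrite -ltr_pdivrMl// mulr1.
  rewrite /concat_curve min_r ?addr0 ?(ltW s1')// max_l ?subr_ge0 ?(ltW s1')//.
  by rewrite c11 -c20 addrC subrK.
have nl (t : R) : t < 2^-1 -> \forall s \near t, concat_curve c1 c2 s = c1 (2 * s + 0).
  by move=> th; near=> s; apply: cl; near: s; exact: lt_nbhsl.
have nr (t : R) : 2^-1 < t -> \forall s \near t, concat_curve c1 c2 s = c2 (2 * s + -1).
  by move=> th; near=> s; apply: cr; near: s; exact: lt_nbhsr.
exists (concat_curve c1 c2), (concat_control u1 v1), (concat_control u2 v2).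
split; last 1 first.
- by rewrite lp_length_concat.
- apply/horizontalP; split; [|exact: measurable_concat_control..|].
    apply: ACD.
      apply: (@AC_comp _ _ _ (fun t : R => Num.min (2 * t + 0) 1) 2) => //.
        by move=> s t st; rewrite /Num.min; case: ltP => ?; case: ltP => ?; split; lra.
      by move=> t t01; rewrite /Num.min; case: ltP => ?; lra.
    apply: (@ACD _ _ _ (fun=> - c2 0)); last exact: AC_cst.
    apply: (@AC_comp _ _ _ (fun t : R => Num.max (2 * t + -1) 0) 2) => //.
      by move=> s t st; rewrite /Num.max; case: ltP => ?; case: ltP => ?; split; lra.
    by move=> t t01; rewrite /Num.max; case: ltP => ?; lra.
  (* The derivative may fail to exist at the junction 1/2, which is a null set. *)
  have nh : {ae mu, forall t, t != 2^-1}.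
    exists [set 2^-1]; split => //; first exact: lebesgue_measure_set1.
    by move=> t /= /negP; rewrite negbK => /eqP.
  have := ae_affine 0 (ltr0Sn R 1) d1; have := ae_affine (-1) (ltr0Sn R 1) d2.
  move=> D2 D1; have := ae_and nh (ae_and D1 D2); apply: ae_imply.
  move=> t [th [H1 H2]] t01.
  have [th'|th'|th'] := ltgtP t 2^-1; last by rewrite th' eqxx in th.
    have [|X1 X2 X3] := H1; first by lra.
    rewrite cl// /concat_control th'.
    have HZ : ((c1 (2 * t + 0)).1.1 * (2 * u2 (2 * t + 0)) -
      (c1 (2 * t + 0)).1.2 * (2 * u1 (2 * t + 0))) / 2 = 2 *
      (((c1 (2 * t + 0)).1.1 * u2 (2 * t + 0) - (c1 (2 * t + 0)).1.2 * u1 (2 * t + 0)) / 2).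
      by field.
    rewrite HZ; split.
    + apply: near_eq_is_derive (is_derive_affine_comp X1) => //.
      by move: (nl t th'); apply: filterS => s ->.
    + apply: near_eq_is_derive (is_derive_affine_comp X2) => //.
      by move: (nl t th'); apply: filterS => s ->.
    + apply: near_eq_is_derive (is_derive_affine_comp X3) => //.
      by move: (nl t th'); apply: filterS => s ->.
  have [|X1 X2 X3] := H2; first by lra.
  rewrite cr// /concat_control (lt_gtF th').
  have HZ : ((c2 (2 * t + -1)).1.1 * (2 * v2 (2 * t + -1)) -
    (c2 (2 * t + -1)).1.2 * (2 * v1 (2 * t + -1))) / 2 = 2 *
    (((c2 (2 * t + -1)).1.1 * v2 (2 * t + -1) - (c2 (2 * t + -1)).1.2 * v1 (2 * t + -1)) / 2).
    by field.
  rewrite HZ; split.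
  + apply: near_eq_is_derive (is_derive_affine_comp X1) => //.
    by move: (nr t th'); apply: filterS => s ->.
  + apply: near_eq_is_derive (is_derive_affine_comp X2) => //.
    by move: (nr t th'); apply: filterS => s ->.
  + apply: near_eq_is_derive (is_derive_affine_comp X3) => //.
    by move: (nr t th'); apply: filterS => s ->.
- rewrite cl ?invr_gt0// mulr0 addr0//.
- by rewrite cr ?invf_lt1 ?ltr1n// mulr1 -[X in X + _](natrD _ 1 1) addrK.
Unshelve. all: by end_near.
Qed.

Lemma heis_dist_triangle (p : R) (g h k : heis) : 0 < p ->
  (heis_dist p g k <= heis_dist p g h + heis_dist p h k)%E.
Proof.
move=> p0.
have n1 := heis_dist_ge0 p g h; have n2 := heis_dist_ge0 p h k.
have [->|f1] := eqVneq (heis_dist p g h) +oo%E.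
  by rewrite addye ?leey// gt_eqF// (lt_le_trans _ n2)// ltNy0.
have [->|f2] := eqVneq (heis_dist p h k) +oo%E.
  by rewrite addey ?leey// gt_eqF// (lt_le_trans _ n1)// ltNy0.
have F1 : heis_dist p g h \is a fin_num by rewrite ge0_fin_numE// ltey.
have F2 : heis_dist p h k \is a fin_num by rewrite ge0_fin_numE// ltey.
apply/lee_addgt0Pr => e e0; have e20 : 0 < e / 2 by rewrite divr_gt0.
have [l1 j1 l1e] := lb_ereal_inf_adherent e20 F1.
have [l2 j2 l2e] := lb_ereal_inf_adherent e20 F2.
apply: (le_trans (heis_dist_le (joins_concat p0 j1 j2))).
apply: (le_trans (leeD (ltW l1e) (ltW l2e))).
rewrite -/(heis_dist p g h) -/(heis_dist p h k).
by rewrite addeACA -EFinD -splitr.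
Qed.
End Triangle.

(** * Calibrations *)

(* (dual_height q h, h) lies on the l^q unit sphere when [`|h| <= 1]; otherwise
   the value is 0. *)
HB.lock Definition dual_height {R : realType} (q h : R) : R :=
  Num.max 0 (1 - `|h| `^ q) `^ q^-1.

Section Calibration.
Context {R : realType}.
Local Notation mu := (@lebesgue_measure R).
Local Notation heis := (R * R * R)%type.

Implicit Types (p q h u v : R).

Lemma continuous_max_powR (r : R) : 0 < r ->
  continuous (fun x : R => Num.max 0 x `^ r).
Proof.
move=> r0 x.
have [x0|x0|x0] := ltgtP x 0.
- rewrite /continuous_at (max_l (ltW x0)) powR0 ?gt_eqF//.
  apply: cvg_near_cst; near=> y; have y0 : y < 0 by near: y; exact: lt_nbhsl.
  by rewrite max_l ?powR0 ?gt_eqF// ltW.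
- have c : {for x, continuous (fun y : R => y `^ r)}.
    apply: differentiable_continuous; apply/derivable1_diffP.
    by apply: derivable_powR; rewrite in_itv/= x0.
  rewrite /continuous_at (max_r (ltW x0)).
  apply: cvg_trans c; apply: near_eq_cvg; near=> y.
  have y0 : 0 < y by near: y; exact: lt_nbhsr.
  by rewrite max_r// ltW.
- rewrite /continuous_at x0 maxxx powR0 ?gt_eqF//.
  apply/cvgrPdist_lt => e e0; near=> y.
  rewrite sub0r normrN ger0_norm ?powR_ge0//.
  have ye : y < e `^ r^-1.
    by near: y; apply: lt_nbhsl; rewrite powR_gt0.
  have [y0|y0] := leP y 0; first by rewrite powR0 ?gt_eqF.
  rewrite -[ltRHS](@powRr1 _ e) ?ltW// -(@mulVf _ r) ?gt_eqF// powRrM.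
  by rewrite gt0_ltr_powR// nnegrE ?powR_ge0// ltW.
Unshelve. all: by end_near. Qed.

Lemma continuous_norm_powR (r : R) : 0 < r -> continuous (fun x : R => `|x| `^ r).
Proof.
move=> r0 x.
have -> : (fun x : R => `|x| `^ r) = (fun x : R => Num.max 0 x `^ r) \o (fun x => `|x|).
  by apply/funext => y /=; rewrite max_r.
apply: continuous_comp; first exact: norm_continuous.
exact: continuous_max_powR.
Qed.

Lemma continuous_dual_height q : 0 < q -> continuous (dual_height q).
Proof.
move=> q0 x; rewrite dual_height.unlock.
apply: (@continuous_comp _ _ _ (fun h : R => 1 - `|h| `^ q) (fun y : R => Num.max 0 y `^ q^-1)).
  by apply: cvgB; [exact: cvg_cst|exact: continuous_norm_powR].
by apply: continuous_max_powR; rewrite invr_gt0.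
Qed.

Lemma dual_height_ge0 q h : 0 <= dual_height q h.
Proof. by rewrite dual_height.unlock powR_ge0. Qed.

Lemma norm_powR_le1 q h : 0 <= q -> `|h| <= 1 -> `|h| `^ q <= 1.
Proof.
move=> q0 h1; have := @ge0_ler_powR _ q q0 `|h| 1.
by rewrite !nnegrE normr_ge0 ler01 powR1 => /(_ isT isT h1).
Qed.

Lemma dual_heightE q h : 0 <= q -> `|h| <= 1 ->
  dual_height q h = (1 - `|h| `^ q) `^ q^-1.
Proof. by move=> q0 h1; rewrite dual_height.unlock max_r// subr_ge0 norm_powR_le1. Qed.

Lemma dual_height_powR q h : 0 < q -> `|h| <= 1 -> dual_height q h `^ q + `|h| `^ q = 1.
Proof.
move=> q0 h1; rewrite dual_heightE ?(ltW q0)// -powRrM mulVf ?gt_eqF// powRr1 ?subrK//.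
by rewrite subr_ge0 norm_powR_le1// ltW.
Qed.

Lemma dual_height_le1 q h : 0 < q -> dual_height q h <= 1.
Proof.
move=> q0; have a1 : Num.max 0 (1 - `|h| `^ q) <= 1.
  by rewrite ge_max ler01/= lerBlDr lerDl powR_ge0.
rewrite dual_height.unlock.
have := @ge0_ler_powR _ q^-1 _ (Num.max 0 (1 - `|h| `^ q)) 1.
by rewrite powR1 !nnegrE invr_ge0 le_max lexx/= ler01 => /(_ (ltW q0) isT isT a1).
Qed.

Lemma dual_pairing_le p q h u v : 0 < p -> 0 < q -> p^-1 + q^-1 = 1 -> `|h| <= 1 ->
  dual_height q h * u + h * v <= lp_norm p u v.
Proof.
move=> p0 q0 pq h1.
apply: (@le_trans _ _ (`|u| * dual_height q h + `|v| * `|h|)).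
  rewrite mulrC; apply: lerD.
    by rewrite ler_wpM2r ?dual_height_ge0// ler_norm.
  by rewrite (le_trans (ler_norm _))// normrM mulrC.
have := @hoelder2 R `|u| `|v| (dual_height q h) `|h| p q.
rewrite !normr_ge0 dual_height_ge0 => /(_ isT isT isT isT p0 q0 pq) H.
by apply: (le_trans H); rewrite dual_height_powR// powR1 mulr1.
Qed.

Lemma lp_norm_gel p u v : 0 < p -> `|u| <= lp_norm p u v.
Proof.
move=> p0; rewrite /lp_norm -{1}(@powRr1 _ `|u|)// -(@mulfV _ p) ?gt_eqF// powRrM.
apply: ge0_ler_powR; rewrite ?nnegrE ?invr_ge0 ?(ltW p0) ?addr_ge0 ?powR_ge0//.
by rewrite lerDl powR_ge0.
Qed.

Lemma lp_normC p u v : lp_norm p u v = lp_norm p v u.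
Proof. by rewrite /lp_norm addrC. Qed.

Lemma lp_norm_ger p u v : 0 < p -> `|v| <= lp_norm p u v.
Proof. by rewrite lp_normC; exact: lp_norm_gel. Qed.

Lemma lp_norm_le p u v : 1 <= p -> lp_norm p u v <= `|u| + `|v|.
Proof.
move=> p1; have p0 : 0 < p by exact: lt_le_trans p1.
set s := `|u| + `|v|; have s0 : 0 <= s by rewrite addr_ge0.
have H x : 0 <= x -> x <= s -> x `^ p <= x * s `^ (p - 1).
  move=> x0 xs; rewrite -(mulr_powRB1 x0 p0) ler_wpM2l//.
  by apply: ge0_ler_powR; rewrite ?nnegrE ?subr_ge0.
rewrite /lp_norm -[leRHS](@powRr1 _ s)// -(@mulfV _ p) ?gt_eqF// powRrM.
apply: ge0_ler_powR; rewrite ?nnegrE ?invr_ge0 ?(ltW p0) ?addr_ge0 ?powR_ge0//.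
rewrite -(mulr_powRB1 s0 p0) {1}/s mulrDl; apply: lerD; apply: H => //.
  by rewrite lerDl.
by rewrite lerDr.
Qed.

(** Calibrations need a primitive on the whole line, while the fundamental theorem is available on
    segments. The primitives on growing segments, normalised at 0, agree where both are defined. *)
Lemma continuous_antiderivative (f : R -> R) : continuous f ->
  exists2 F : R -> R, forall x : R, is_derive x 1 F (f x) & F 0 = 0.
Proof.
move=> cf.
have loc (n : nat) : exists2 F : R -> R,
    forall x : R, `|x| < n.+1%:R -> is_derive x 1 F (f x) & F 0 = 0.
  pose a : R := - n.+1%:R; pose G x := (\int[mu]_(t in `[a, x]) f t)%R.
  exists (fun x => G x - G 0); last by rewrite subrr.
  move=> x; rewrite ltr_norml => /andP[ax xn].
  have ii : mu.-integrable `[a, n.+1%:R] (EFin \o f).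
    apply: continuous_compact_integrable; first exact: segment_compact.
    exact: continuous_subspaceT.
  have [dG dGE] := continuous_FTC1_closed xn ii ax (cf x).
  have h : is_derive x 1 G (f x) by rewrite -dGE derive1E; exact: derivableP.
  by have := is_deriveB h (is_derive_cst (G 0) x 1); rewrite subr0.
have {loc}/choice[F HF] : forall n : nat, exists F : R -> R,
    (forall x : R, `|x| < n.+1%:R -> is_derive x 1 F (f x)) /\ F 0 = 0.
  by move=> n; have [F H1 H2] := loc n; exists F.
have agree m n x : (m <= n)%N -> `|x| < m.+1%:R -> F m x = F n x.
  move=> mn xm; pose D y := F m y - F n y.
  have dD (y : R) : `|y| < m.+1%:R -> is_derive y 1 D 0.
    move=> ym; have yn : `|y| < n.+1%:R by rewrite (lt_le_trans ym)// ler_nat.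
    by have := is_deriveB ((HF m).1 y ym) ((HF n).1 y yn); rewrite subrr.
  have D0 : D 0 = 0 by rewrite /D (HF m).2 (HF n).2 subrr.
  suff : D x = 0 by move=> /eqP; rewrite subr_eq0 => /eqP.
  have seg (u v : R) : u <= v -> (forall y, u <= y <= v -> `|y| < m.+1%:R) -> D u = D v.
    move=> uv Huv; have [||c _] := @MVT_segment _ D (fun=> 0) u v uv.
    - by move=> y; rewrite in_itv/= => /andP[/ltW ? /ltW ?]; apply/dD/Huv/andP.
    - apply: derivable_within_continuous => y; rewrite in_itv/= => uyv.
      exact: (@ex_derive _ _ _ _ _ _ _ (dD y (Huv y uyv))).
    by rewrite mul0r => /eqP; rewrite subr_eq0 => /eqP.
  have [x0|/ltW x0] := leP 0 x.
    rewrite -(seg 0 x)// => y /andP[y0 yx].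
    by rewrite ger0_norm// (le_lt_trans yx)// -(ger0_norm x0).
  rewrite (seg x 0)// => y /andP[xy y0].
  by rewrite ler0_norm// (le_lt_trans _ xm)// ler0_norm// lerN2.
(* The index depends on [x], but near [x] the chosen primitive agrees with the one of the next
   index, which is differentiable there. *)
exists (fun x => F (Num.truncn `|x|) x); last exact: (HF _).2.
move=> x; set n := (Num.truncn `|x|).+1.
have xn : `|x| < n.+1%:R by rewrite (lt_trans (truncnS_gt _))// ltr_nat.
apply: near_eq_is_derive ((HF n).1 x xn) => //.
near=> y; apply/esym/agree; last exact: truncnS_gt.
have yn : `|y| < n%:R.
  near: y; apply: cvgr_lt; first exact: norm_continuous.
  exact: truncnS_gt.
by rewrite ltnW// -(@ltr_nat R) (le_lt_trans _ yn)// truncn_le.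
Unshelve. all: by end_near. Qed.
End Calibration.

(** * The calibration inequality and bounds on the coordinates *)

Section Metric.
Context {R : realType}.
Local Notation mu := (@lebesgue_measure R).
Local Notation heis := (R * R * R)%type.
Implicit Types (p q u v : R) (g h : heis).

Lemma ACM (f g : R -> R) : absolutely_continuous 0 1 f -> absolutely_continuous 0 1 g ->
  absolutely_continuous 0 1 (fun t => f t * g t).
Proof.
move=> ACf ACg; have [M HM] := AC_bounded ACf; have [M' HM'] := AC_bounded ACg.
apply: (@AC_dominated _ _ _ _ _ (M + M') _ (AC_pair ACf ACg)) => s t s01 t01.
have -> : f s * g s - f t * g t = f s * (g s - g t) + (f s - f t) * g t by ring.
rewrite (le_trans (ler_normD _ _))// !normrM mulrDl.
have M0 : 0 <= M by exact: le_trans (HM s s01).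
have M'0 : 0 <= M' by exact: le_trans (HM' s s01).
rewrite prod_normE/=; apply: lerD.
  by rewrite ler_pM// ?HM// le_max lexx orbT.
by rewrite mulrC ler_pM// ?HM'// le_max lexx.
Qed.

Lemma horizontal_fst_le p (gam : R -> heis) (u1 u2 : R -> R) t : 0 < p ->
  horizontal gam u1 u2 -> 0 <= t <= 1 ->
  (`|(gam t).1.1 - (gam 0%R).1.1|%:E <= lp_length p u1 u2)%E.
Proof.
move=> p0 hor /andP[t0 t1]; have [AC _ _ dg] := (horizontalP _ _ _).1 hor.
have ACX := AC_fst (AC_fst AC).
have [h|h] := leP 0 ((gam t).1.1 - (gam 0%R).1.1).
  rewrite ger0_norm// -[leRHS]mul1e.
  apply: (horizontal_growth hor ACX ler01 _ (lexx 0) t0 t1).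
  apply: ae_imply dg => s H s01; have [dX _ _] := H s01; exists (u1 s) => //.
  by rewrite mul1r (le_trans (ler_norm _))// lp_norm_gel.
rewrite ltr0_norm// opprB addrC -[leRHS]mul1e.
have -> : - (gam t).1.1 + (gam 0%R).1.1 = -1 * (gam t).1.1 - -1 * (gam 0%R).1.1 by ring.
apply: (horizontal_growth hor (ACMl (-1) ACX) ler01 _ (lexx 0) t0 t1).
apply: ae_imply dg => s H s01; have [dX _ _] := H s01; exists (-1 * u1 s).
  exact: is_deriveZ.
by rewrite mul1r mulN1r (le_trans (ler_norm _))// normrN lp_norm_gel.
Qed.

Lemma horizontal_snd_le p (gam : R -> heis) (u1 u2 : R -> R) t : 0 < p ->
  horizontal gam u1 u2 -> 0 <= t <= 1 ->
  (`|(gam t).1.2 - (gam 0%R).1.2|%:E <= lp_length p u1 u2)%E.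
Proof.
move=> p0 hor /andP[t0 t1]; have [AC _ _ dg] := (horizontalP _ _ _).1 hor.
have ACY := AC_snd (AC_fst AC).
have [h|h] := leP 0 ((gam t).1.2 - (gam 0%R).1.2).
  rewrite ger0_norm// -[leRHS]mul1e.
  apply: (horizontal_growth hor ACY ler01 _ (lexx 0) t0 t1).
  apply: ae_imply dg => s H s01; have [_ dY _] := H s01; exists (u2 s) => //.
  by rewrite mul1r (le_trans (ler_norm _))// lp_norm_ger.
rewrite ltr0_norm// opprB addrC -[leRHS]mul1e.
have -> : - (gam t).1.2 + (gam 0%R).1.2 = -1 * (gam t).1.2 - -1 * (gam 0%R).1.2 by ring.
apply: (horizontal_growth hor (ACMl (-1) ACY) ler01 _ (lexx 0) t0 t1).
apply: ae_imply dg => s H s01; have [_ dY _] := H s01; exists (-1 * u2 s).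
  exact: is_deriveZ.
by rewrite mul1r mulN1r (le_trans (ler_norm _))// normrN lp_norm_ger.
Qed.

Definition calib (H : R -> R) (c w : R) (g : heis) : R :=
  H g.1.1 + c * g.1.2 + w * (g.2 + g.1.1 * g.1.2 / 2).

(* The derivative of [calib] along a horizontal curve is the pairing of the
   control with the covector (K(c + w x), c + w x) of l^q norm 1. *)
Lemma heis_dist_calib p q (H : R -> R) (c w rho : R) g0 g1 :
  0 < p -> 0 < q -> p^-1 + q^-1 = 1 ->
  (forall x : R, is_derive x 1 H (dual_height q (c + w * x))) ->
  (forall x, `|x - g0.1.1| <= rho -> `|c + w * x| <= 1) ->
  (heis_dist p g0 g1 < rho%:E)%E ->
  ((calib H c w g1 - calib H c w g0)%:E <= heis_dist p g0 g1)%E.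
Proof.
move=> p0 q0 pq dH Hc drho.
have key l : joins p g0 g1 l -> (l < rho%:E)%E ->
    ((calib H c w g1 - calib H c w g0)%:E <= l)%E.
  move=> [gam [u1 [u2 [hor g00 g11 ->]]]] lrho.
  have [AC _ _ dg] := (horizontalP _ _ _).1 hor.
  have ACX := AC_fst (AC_fst AC); have ACY := AC_snd (AC_fst AC); have ACZ := AC_snd AC.
  have ACH : absolutely_continuous 0 1 (fun t => H (gam t).1.1).
    have key s t : s <= t -> `|H t - H s| <= 1 * `|t - s|.
      move=> st; have [|x _ ->] := MVT_segment st (fun x _ => dH x).
        by apply: derivable_within_continuous => x _; exact: (@ex_derive _ _ _ _ _ _ _ (dH x)).
      by rewrite normrM ler_wpM2r// ger0_norm ?dual_height_ge0// dual_height_le1.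
    apply: (@AC_dominated _ _ _ _ _ 1 _ ACX) => s t _ _.
    have [st|ts] := leP (gam s).1.1 (gam t).1.1; last exact: key (ltW ts).
    by rewrite distrC (distrC (gam s).1.1) key.
  have ACS : absolutely_continuous 0 1 (fun t => H (gam t).1.1 + c * (gam t).1.2 +
      w * ((gam t).2 + 2^-1 * ((gam t).1.1 * (gam t).1.2))).
    apply: ACD; first by apply: ACD => //; exact: ACMl.
    by apply: ACMl; apply: ACD => //; apply: ACMl; exact: ACM.
  have := @horizontal_growth _ p 1 gam u1 u2 _ 0 1 hor ACS ler01 _ (lexx 0) ler01 (lexx 1).
  rewrite mul1e g00 g11 /calib !(mulrC _ 2^-1); apply.
  apply: ae_imply dg => t Ht t01; have [dX dY dZ] := Ht t01.
  have dHX : is_derive t 1 (fun s => H (gam s).1.1) (dual_height q (c + w * (gam t).1.1) * u1 t).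
    exact: (@is_derive1_comp R H (fun s => (gam s).1.1) t _ _ (dH _) dX).
  have := is_deriveD (is_deriveD dHX (is_deriveZ c dY))
    (is_deriveZ w (is_deriveD dZ (is_deriveZ 2^-1 (is_deriveM dX dY)))).
  set dG := (X in is_derive _ _ _ X) => dS; exists dG => //.
  have -> : dG = dual_height q (c + w * (gam t).1.1) * u1 t + (c + w * (gam t).1.1) * u2 t.
    rewrite /dG; have sE (a b : R) : a *: b = a * b by [].
    by rewrite !sE; field.
  rewrite mul1r dual_pairing_le// Hc// -g00.
  rewrite -lee_fin; apply: le_trans (ltW lrho); exact: horizontal_fst_le.
(* A curve of length at least [rho] may leave the strip where the calibration is valid; it is
   compared with one curve shorter than [rho]. *)
have [l j lr] : exists2 l, joins p g0 g1 l & (l < rho%:E)%E by exact: ereal_inf_lt.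
apply: le_heis_dist => l' j'.
have [lr'|rl'] := ltP l' rho%:E; first exact: key.
by apply: le_trans rl'; apply: le_trans (ltW lr); exact: key.
Qed.

Lemma norm_fst_le_dist p g h : 0 < p ->
  (`|h.1.1 - g.1.1|%:E <= heis_dist p g h)%E.
Proof.
move=> p0; apply: le_heis_dist => l [gam [u1 [u2 [hor <- <- ->]]]].
by apply: horizontal_fst_le => //; rewrite ler01 lexx.
Qed.

Lemma norm_snd_le_dist p g h : 0 < p ->
  (`|h.1.2 - g.1.2|%:E <= heis_dist p g h)%E.
Proof.
move=> p0; apply: le_heis_dist => l [gam [u1 [u2 [hor <- <- ->]]]].
by apply: horizontal_snd_le => //; rewrite ler01 lexx.
Qed.

(** Both horizontal coordinates stay below [l], so the vertical speed is at most [l] times the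
    horizontal one. *)
Lemma norm_height_le_dist p g l : 0 < p -> joins p (0, 0, 0) g l%:E ->
  `|g.2| <= l ^+ 2.
Proof.
move=> p0 [gam [u1 [u2 [hor g0 <- lE]]]].
have [AC _ _ dg] := (horizontalP _ _ _).1 hor; have ACZ := AC_snd AC.
have l0 : 0 <= l by rewrite -lee_fin lE lp_length_ge0.
have HX t : 0 <= t <= 1 -> `|(gam t).1.1| <= l.
  move=> t01; have := horizontal_fst_le p0 hor t01.
  by rewrite g0 subr0 -lE lee_fin.
have HY t : 0 <= t <= 1 -> `|(gam t).1.2| <= l.
  move=> t01; have := horizontal_snd_le p0 hor t01.
  by rewrite g0 subr0 -lE lee_fin.
have der t : 0 <= t <= 1 ->
    `|((gam t).1.1 * u2 t - (gam t).1.2 * u1 t) / 2| <= l * lp_norm p (u1 t) (u2 t).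
  move=> t01; rewrite normrM (ger0_norm (_ : 0 <= 2^-1))// ler_pdivrMr//.
  rewrite (le_trans (ler_normB _ _))// !normrM mulr_natr mulr2n; apply: lerD.
    by rewrite ler_pM ?HX// lp_norm_ger.
  by rewrite ler_pM ?HY// lp_norm_gel.
have [h|h] := leP 0 (gam 1).2.
  rewrite ger0_norm// -[X in X <= _]subr0 -[X in _ - X](_ : (gam 0).2 = 0); last by rewrite g0.
  rewrite -lee_fin expr2 EFinM lE.
  have := @horizontal_growth _ p l gam u1 u2 _ 0 1 hor ACZ l0 _ (lexx 0) ler01 (lexx 1).
  rewrite -lE; apply; apply: ae_imply dg => t Ht t01; have [_ _ dZ] := Ht t01.
  by eexists; [exact: dZ|exact: le_trans (ler_norm _) (der t t01)].
rewrite ltr0_norm// -mulN1r -[X in X <= _]subr0 -[X in _ - X](_ : -1 * (gam 0).2 = 0); last first.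
  by rewrite g0 mulr0.
rewrite -lee_fin expr2 EFinM lE.
have := @horizontal_growth _ p l gam u1 u2 _ 0 1 hor (ACMl (-1) ACZ) l0 _ (lexx 0) ler01 (lexx 1).
rewrite -lE; apply; apply: ae_imply dg => t Ht t01; have [_ _ dZ] := Ht t01.
eexists; first exact: is_deriveZ dZ.
by rewrite [_ *: _]mulN1r (le_trans (ler_norm _))// normrN der.
Qed.

End Metric.

(** * Distance to the origin: group law, dilations, reflections *)

HB.lock Definition heis_norm {R : realType} (p : R) (g : R * R * R) : R :=
  fine (heis_dist p (0, 0, 0) g).

Section HeisNorm.
Context {R : realType}.
Local Notation mu := (@lebesgue_measure R).
Local Notation heis := (R * R * R)%type.
Local Notation heis0 := (0 : R, 0 : R, 0 : R).
Variable p : R.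
Hypothesis p1 : 1 < p.
Implicit Types (u v : R) (g h : heis).

Let p0 : 0 < p. Proof. exact: lt_trans p1. Qed.

Definition heis_inv g : heis := (- g.1.1, - g.1.2, - g.2).

Let heis_eq (a b c a' b' c' : R) : a = a' -> b = b' -> c = c' -> (a, b, c) = (a', b', c').
Proof. by move=> -> -> ->. Qed.

Lemma heis_mulA g h k : heis_mul g (heis_mul h k) = heis_mul (heis_mul g h) k.
Proof. by apply: heis_eq => /=; field. Qed.

Lemma heis_mul0 g : heis_mul g heis0 = g.
Proof. by case: g => -[x y] z; apply: heis_eq => /=; ring. Qed.

Lemma heis_mul0l g : heis_mul heis0 g = g.
Proof. by case: g => -[x y] z; apply: heis_eq => /=; ring. Qed.

Lemma heis_mulVg g : heis_mul (heis_inv g) g = heis0.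
Proof. by apply: heis_eq => /=; ring. Qed.

Lemma heis_mulgV g : heis_mul g (heis_inv g) = heis0.
Proof. by apply: heis_eq => /=; ring. Qed.

Lemma heis_mulKg g h : heis_mul g (heis_mul (heis_inv g) h) = h.
Proof. by rewrite heis_mulA heis_mulgV heis_mul0l. Qed.

Let le_mull k g h : (heis_dist p (heis_mul k g) (heis_mul k h) <= heis_dist p g h)%E.
Proof.
apply: le_heis_dist => l j.
pose e1 := - (k.1.2 / 2); pose e2 := k.1.1 / 2.
have E w : heis_mul k w = heis_affine 1 0 0 1 e1 e2 1 k w.
  by apply: heis_eq; rewrite /e1 /e2; field.
rewrite !E -[leRHS]mul1e; apply: heis_dist_affine j => //.
  by move=> u v; rewrite !mul1r !mul0r addr0 add0r.
by move=> w u v; rewrite /heis_affine/= /e1 /e2; field.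
Qed.

Lemma heis_dist_mull k g h :
  heis_dist p (heis_mul k g) (heis_mul k h) = heis_dist p g h.
Proof.
apply/eqP; rewrite eq_le le_mull/=.
have := le_mull (heis_inv k) (heis_mul k g) (heis_mul k h).
by rewrite !heis_mulA heis_mulVg !heis_mul0l.
Qed.

Lemma heis_dist_segment (a b : R) :
  (heis_dist p heis0 (a, b, 0%R) <= (lp_norm p a b)%:E)%E.
Proof.
have dl c (t : R) : is_derive t 1 (fun s : R => c * s) c.
  by have := is_deriveZ c (is_derive_id t 1); rewrite [_ *: _]mulr1.
have := @heis_dist_C1 R p (fun t => a * t) (fun t => b * t) (fun=> 0) (fun=> a) (fun=> b)
  (fun t => lp_norm p a b * t).
rewrite !mulr0 !mulr1 subr0; apply; try exact: cst_continuous; try exact: dl.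
move=> t; have -> : (a * t * b - b * t * a) / 2 = 0 by field.
exact: is_derive_cst.
Qed.

(** The lift of a square loop of side s rises by the enclosed area s^2; the other orientation gives
    - s^2. *)
Let vertical_lt (s : R) : (heis_dist p heis0 (0%R, 0%R, (s * s)%R) < +oo)%E /\
  (heis_dist p heis0 (0%R, 0%R, (s * s)%R) <= (4 * `|s|)%:E)%E /\
  (heis_dist p heis0 (0%R, 0%R, (- (s * s))%R) <= (4 * `|s|)%:E)%E.
Proof.
have step g (a b : R) : (heis_dist p heis0 (heis_mul g (a, b, 0%R)) <=
    heis_dist p heis0 g + (lp_norm p a b)%:E)%E.
  apply: (le_trans (heis_dist_triangle _ g _ p0)); rewrite leeD2l//.
  by rewrite -{1}[g]heis_mul0 heis_dist_mull heis_dist_segment.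
have np0 a : lp_norm p a 0 = `|a|.
  rewrite /lp_norm normr0 powR0 ?gt_eqF// addr0 -powRrM mulfV ?gt_eqF//.
  by rewrite powRr1.
have four (a b : R) : `|a| = `|s| -> `|b| = `|s| ->
   (heis_dist p heis0 (heis_mul (heis_mul (heis_mul (a, 0, 0) (0, b, 0)) (- a, 0, 0))
     (0, - b, 0))%R <= (4 * `|s|)%:E)%E /\
   (heis_dist p heis0 (heis_mul (heis_mul (heis_mul (0, b, 0) (a, 0, 0)) (0, - b, 0))
     (- a, 0, 0))%R <= (4 * `|s|)%:E)%E.
  move=> Ha Hb; split.
    apply: (le_trans (step _ _ _)); rewrite lp_normC np0 normrN Hb.
    have -> : 4 * `|s| = `|s| + `|s| + `|s| + `|s| by ring.
    rewrite !EFinD leeD2r//; apply: (le_trans (step _ _ _)); rewrite np0 normrN Ha.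
    rewrite leeD2r//; apply: (le_trans (step _ _ _)); rewrite lp_normC np0 Hb.
    by rewrite leeD2r// (le_trans (heis_dist_segment _ _))// np0 Ha.
  apply: (le_trans (step _ _ _)); rewrite np0 normrN Ha.
  have -> : 4 * `|s| = `|s| + `|s| + `|s| + `|s| by ring.
  rewrite !EFinD leeD2r//; apply: (le_trans (step _ _ _)); rewrite lp_normC np0 normrN Hb.
  rewrite leeD2r//; apply: (le_trans (step _ _ _)); rewrite np0 Ha.
  by rewrite leeD2r// (le_trans (heis_dist_segment _ _))// lp_normC np0 Hb.
have [h1 h2] := four s s erefl erefl.
have E1 : heis_mul (heis_mul (heis_mul (s, 0, 0) (0, s, 0)) (- s, 0, 0)) (0, - s, 0) = (0, 0, s * s).
  by apply: heis_eq => /=; field.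
have E2 : heis_mul (heis_mul (heis_mul (0, s, 0) (s, 0, 0)) (0, - s, 0)) (- s, 0, 0) = (0, 0, - (s * s)).
  by apply: heis_eq => /=; field.
rewrite E1 in h1; rewrite E2 in h2; split => //.
by rewrite (le_lt_trans h1)// ltry.
Qed.

Lemma heis_dist_vertical (e : R) :
  (heis_dist p heis0 (0%R, 0%R, e) <= (4 * Num.sqrt `|e|)%:E)%E.
Proof.
have [_ [h1 h2]] := vertical_lt (Num.sqrt `|e|).
move: h1 h2; rewrite -expr2 sqr_sqrtr// (ger0_norm (sqrtr_ge0 _)).
by have [e0|e0] := leP 0 e; rewrite ?(ger0_norm e0) ?(ltr0_norm e0) ?opprK.
Qed.

Lemma heis_dist_fin g h : heis_dist p g h \is a fin_num.
Proof.
rewrite ge0_fin_numE ?heis_dist_ge0//.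
rewrite -(heis_dist_mull (heis_inv g)) heis_mulVg.
case: (heis_mul _ _) => -[a b] e.
apply: (le_lt_trans (heis_dist_triangle _ (a, b, 0) _ p0)).
rewrite lte_add_pinfty//.
  by rewrite (le_lt_trans (heis_dist_segment _ _))// ltry.
have -> : (a, b, e) = heis_mul (a, b, 0) (0, 0, e) by apply: heis_eq => /=; ring.
rewrite -{1}[(a, b, 0)]heis_mul0 heis_dist_mull.
by rewrite (le_lt_trans (heis_dist_vertical _))// ltry.
Qed.

Local Notation heis_norm := (heis_norm p).

Lemma heis_normE g : heis_dist p heis0 g = (heis_norm g)%:E.
Proof. by rewrite heis_norm.unlock fineK// heis_dist_fin. Qed.

Lemma heis_distE g h : heis_dist p g h = (heis_norm (heis_mul (heis_inv g) h))%:E.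
Proof. by rewrite -heis_normE -(heis_dist_mull (heis_inv g)) heis_mulVg. Qed.

Lemma heis_norm_ge0 g : 0 <= heis_norm g.
Proof. by rewrite -lee_fin -heis_normE heis_dist_ge0. Qed.

Lemma heis_normM g h : heis_norm (heis_mul g h) <= heis_norm g + heis_norm h.
Proof.
rewrite -lee_fin EFinD -!heis_normE; apply: (le_trans (heis_dist_triangle _ g _ p0)).
by rewrite leeD2l// -{1}[g]heis_mul0 heis_dist_mull.
Qed.

Lemma heis_norm_segment a b : heis_norm (a, b, 0) <= lp_norm p a b.
Proof. by rewrite -lee_fin -heis_normE heis_dist_segment. Qed.

Lemma heis_norm_vertical e : heis_norm (0, 0, e) <= 4 * Num.sqrt `|e|.
Proof. by rewrite -lee_fin -heis_normE heis_dist_vertical. Qed.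

Lemma norm_fst_le g : `|g.1.1| <= heis_norm g.
Proof.
by rewrite -lee_fin -heis_normE; have := norm_fst_le_dist heis0 g p0; rewrite subr0.
Qed.

Lemma norm_snd_le g : `|g.1.2| <= heis_norm g.
Proof.
by rewrite -lee_fin -heis_normE; have := norm_snd_le_dist heis0 g p0; rewrite subr0.
Qed.

Lemma heis_norm_adherent g (e : R) : 0 < e ->
  exists2 l, joins p heis0 g l%:E & l < heis_norm g + e.
Proof.
move=> e0; have [l j le] := lb_ereal_inf_adherent e0 (heis_dist_fin heis0 g).
rewrite -/(heis_dist _ _ _) heis_normE -EFinD in le.
have l0 : (0 <= l)%E by case: j => ? [? [? [_ _ _ ->]]]; exact: lp_length_ge0.
have lf : l \is a fin_num by rewrite ge0_fin_numE// (lt_trans le)// ltry.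
by exists (fine l); rewrite -?lte_fin fineK.
Qed.

(** The bound for lengths passes to the infimum: if it failed, some curve would be shorter than the
    square root of |z|. *)
Lemma norm_height_le g : `|g.2| <= heis_norm g ^+ 2.
Proof.
rewrite leNgt; apply/negP => H.
have n0 := heis_norm_ge0 g.
pose s := Num.sqrt `|g.2|.
have ns : heis_norm g < s.
  by rewrite -(ger0_norm n0) -sqrtr_sqr ltr_sqrt// (le_lt_trans _ H)// sqr_ge0.
have [l j ls] := @heis_norm_adherent g (s - heis_norm g) ltac:(by rewrite subr_gt0).
rewrite addrC subrK in ls.
have l0 : 0 <= l.
  by rewrite -lee_fin; case: j => ? [? [? [_ _ _ ->]]]; exact: lp_length_ge0.
have := norm_height_le_dist p0 j; rewrite leNgt.
rewrite -[X in _ < X]sqr_sqrtr// -/s ltr_sqr ?nnegrE ?ls// ltW//.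
exact: le_lt_trans ls.
Qed.

Lemma heis_norm_affine (a1 a2 b1 b2 e3 K : R) g :
  0 < K ->
  (forall u v, lp_norm p (a1 * u + a2 * v) (b1 * u + b2 * v) <= K * lp_norm p u v) ->
  (forall (w : heis) u v,
     (a1 * w.1.1 + a2 * w.1.2) * (b1 * u + b2 * v) - (b1 * w.1.1 + b2 * w.1.2) * (a1 * u + a2 * v) =
     e3 * (w.1.1 * v - w.1.2 * u)) ->
  heis_norm (a1 * g.1.1 + a2 * g.1.2, b1 * g.1.1 + b2 * g.1.2, e3 * g.2) <= K * heis_norm g.
Proof.
move=> K0 HK Hz; apply/ler_addgt0Pr => e e0.
have [l j le] := heis_norm_adherent g (divr_gt0 e0 K0).
have := @heis_dist_affine R p a1 a2 b1 b2 0 0 e3 heis0 K _ _ _ (ltW K0) HK _ j.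
rewrite /heis_affine /= !mulr0 !mul0r !addr0 !add0r heis_normE -EFinM lee_fin => H.
apply: (@le_trans _ _ (K * l)).
  apply: H => w u v; rewrite -[LHS]/(_ / 2) -!/(_ * _).
  rewrite !mul0r !add0r mulrA -Hz !addr0.
  by [].
have -> : K * heis_norm g + e = K * (heis_norm g + e / K) by field; rewrite gt_eqF.
by rewrite ler_pM2l// ltW.
Qed.

Lemma heis_norm_dilation (c : R) g : 0 < c ->
  heis_norm (c * g.1.1, c * g.1.2, c ^+ 2 * g.2) <= c * heis_norm g.
Proof.
move=> c0; have := @heis_norm_affine c 0 0 c (c ^+ 2) c g c0.
rewrite !mul0r !addr0 !add0r; apply.
  by move=> u v; rewrite !mul0r !addr0 !add0r lp_normZ// ltW.
by move=> w u v; ring.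
Qed.

Lemma heis_norm_swap g : heis_norm (g.1.2, g.1.1, - g.2) <= heis_norm g.
Proof.
have := @heis_norm_affine 0 1 1 0 (-1) 1 g ltr01.
rewrite !mul0r !mul1r !addr0 !add0r mulN1r; apply.
  by move=> u v; rewrite !mul0r !mul1r !addr0 !add0r lp_normC.
by move=> w u v; ring.
Qed.

Lemma lp_normN u v : lp_norm p (- u) v = lp_norm p u v.
Proof. by rewrite /lp_norm normrN. Qed.

Lemma heis_norm_reflect g : heis_norm (- g.1.1, g.1.2, - g.2) <= heis_norm g.
Proof.
have := @heis_norm_affine (-1) 0 0 1 (-1) 1 g ltr01.
rewrite !mul0r !mul1r !mulN1r !addr0 !add0r; apply.
  by move=> u v; rewrite !mul0r !mul1r !mulN1r !addr0 !add0r lp_normN.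
by move=> w u v; ring.
Qed.

End HeisNorm.

(** * Excess of a geodesic over the segment below it *)

Section GeodesicHeight.
Context {R : realType}.
Local Notation heis := (R * R * R)%type.
Local Notation heis0 := (0 : R, 0 : R, 0 : R).
Variable p : R.
Hypothesis p1 : 1 < p.
Implicit Types (a b e z x y : R) (g h : heis).
Local Notation N := (heis_norm p).

Let heis_eq (a b c a' b' c' : R) : a = a' -> b = b' -> c = c' -> (a, b, c) = (a', b', c').
Proof. by move=> -> -> ->. Qed.

Lemma heis_norm_horizontal_le a b : N (a, b, 0) <= `|a| + `|b|.
Proof. by rewrite (le_trans (heis_norm_segment p1 _ _))// lp_norm_le// ltW. Qed.

Lemma heis_norm_le a b e : N (a, b, e) <= `|a| + `|b| + 4 * Num.sqrt `|e|.
Proof.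
have -> : (a, b, e) = heis_mul (a, b, 0) (0, 0, e) by apply: heis_eq => /=; ring.
rewrite (le_trans (heis_normM p1 _ _))// lerD ?heis_norm_horizontal_le//.
exact: heis_norm_vertical.
Qed.

(** Conjugation by a horizontal vector fixes the horizontal part and moves only the height, at twice
    the cost of the vector. *)
Let conj_bound a b e (v1 v2 : R) :
  N (a, b, e + (v1 * b - v2 * a)) <= N (a, b, e) + 2 * (`|v1| + `|v2|).
Proof.
have -> : (a, b, e + (v1 * b - v2 * a)) =
    heis_mul (heis_mul (v1, v2, 0) (a, b, e)) (- v1, - v2, 0).
  by apply: heis_eq => /=; field.
have h1 := heis_normM p1 (heis_mul (v1, v2, 0) (a, b, e)) (- v1, - v2, 0).
have h2 := heis_normM p1 (v1, v2, 0) (a, b, e).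
have h3 := heis_norm_horizontal_le v1 v2; have h4 := heis_norm_horizontal_le (- v1) (- v2).
rewrite !normrN in h4; lra.
Qed.

(** The dilation by c with c^2 e = e + z produces the new height; a horizontal vector (1 - c)(a, b)
    then restores the horizontal part. *)
Let dilation_bound a b e z : e != 0 -> `|z| < `|e| ->
  N (a, b, e + z) <= N (a, b, e) + (N (a, b, e) + `|a| + `|b|) * (`|z| / `|e|).
Proof.
move=> e0 ze; have ne : 0 < `|e| by rewrite normr_gt0.
pose r := z / e; have nr : `|r| = `|z| / `|e| by rewrite /r normrM normfV.
have r1 : `|r| < 1 by rewrite nr ltr_pdivrMr// mul1r.
have r0 : 0 < 1 + r by move: r1; rewrite ltr_norml; lra.
pose c := Num.sqrt (1 + r).
have c0 : 0 < c by rewrite sqrtr_gt0.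
have cE : c ^+ 2 = 1 + r by rewrite sqr_sqrtr// ltW.
have c1 : `|1 - c| <= `|r|.
  have -> : r = (c - 1) * (c + 1) by rewrite -subr_sqr cE expr1n addrAC subrr add0r.
  rewrite normrM distrC ler_peMr// ger0_norm ?addr_ge0// ?(ltW c0)//.
  by rewrite lerDr ltW.
have -> : (a, b, e + z) = heis_mul (c * a, c * b, c ^+ 2 * e) ((1 - c) * a, (1 - c) * b, 0).
  by apply: heis_eq; rewrite /= ?cE /r; field.
have h1 := heis_normM p1 (c * a, c * b, c ^+ 2 * e) ((1 - c) * a, (1 - c) * b, 0).
have h2 := heis_norm_dilation p1 (a, b, e) c0.
have h3 := heis_norm_horizontal_le ((1 - c) * a) ((1 - c) * b).
rewrite !normrM in h3; rewrite /= in h2.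
have n0 := heis_norm_ge0 p1 (a, b, e).
have h4 : c * N (a, b, e) <= N (a, b, e) + `|1 - c| * N (a, b, e).
  rewrite -{2}[N _]mul1r -mulrDl ler_wpM2r//.
  have := ler_norm (c - 1); rewrite distrC; lra.
have h5 : `|1 - c| * (N (a, b, e) + `|a| + `|b|) <= `|r| * (N (a, b, e) + `|a| + `|b|).
  by rewrite ler_wpM2r// !addr_ge0.
rewrite -nr; move: h1 h2 h3 h4 h5; clear; lra.
Qed.

(** If |a| or |b| is at least n/16, conjugation moves the height cheaply. Otherwise n <= |a| + |b| +
    4 |e|^(1/2) forces |e| >= n^2/64 and a dilation does it; this case gives the constant, as 2n |z|
    / (n^2/64) = 128 |z|/n. *)
Lemma heis_norm_vertical_lipschitz a b e z :
  0 < N (a, b, e) -> `|z| <= N (a, b, e) ^+ 2 / 128 ->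
  N (a, b, e + z) <= N (a, b, e) + 128 * `|z| / N (a, b, e).
Proof.
set n := N (a, b, e) => n0 zn.
have z0 : 0 <= `|z| by [].
have zn0 : 0 <= `|z| / n by rewrite divr_ge0// ltW.
have [an|an] := leP (n / 16) `|a|.
  have a0 : 0 < `|a| by rewrite (lt_le_trans _ an)// divr_gt0.
  have a0' : a != 0 by rewrite -normr_gt0.
  have := conj_bound a b e 0 (- z / a).
  have -> : 0 * b - - z / a * a = z by field.
  rewrite normr0 add0r normrM normrN normfV => /le_trans; apply.
  have h : `|z| / `|a| <= `|z| / (n / 16).
    by rewrite ler_wpM2l// lef_pV2 ?posrE// divr_gt0.
  have -> : 128 * `|z| / n = 128 * (`|z| / n) by rewrite mulrA.
  rewrite -/n; have e1 : `|z| / (n / 16) = 16 * (`|z| / n) by field; rewrite gt_eqF.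
  move: h zn0; rewrite e1; clear; lra.
have [bn|bn] := leP (n / 16) `|b|.
  have b0 : 0 < `|b| by rewrite (lt_le_trans _ bn)// divr_gt0.
  have b0' : b != 0 by rewrite -normr_gt0.
  have := conj_bound a b e (z / b) 0.
  have -> : z / b * b - 0 * a = z by field.
  rewrite normr0 addr0 normrM normfV => /le_trans; apply.
  have h : `|z| / `|b| <= `|z| / (n / 16).
    by rewrite ler_wpM2l// lef_pV2 ?posrE// divr_gt0.
  have -> : 128 * `|z| / n = 128 * (`|z| / n) by rewrite mulrA.
  rewrite -/n; have e1 : `|z| / (n / 16) = 16 * (`|z| / n) by field; rewrite gt_eqF.
  move: h zn0; rewrite e1; clear; lra.
have s0 := sqrtr_ge0 `|e|.
have ns : n / 8 <= Num.sqrt `|e|.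
  have := heis_norm_le a b e; rewrite -/n; move: an bn n0; clear; lra.
have ne : n ^+ 2 / 64 <= `|e|.
  rewrite -(sqr_sqrtr (normr_ge0 e)).
  have -> : n ^+ 2 / 64 = (n / 8) ^+ 2 by field.
  by rewrite ler_sqr ?nnegrE// divr_ge0// ltW.
have n20 : 0 < n ^+ 2 by rewrite exprn_gt0.
have e0 : 0 < `|e| by move: ne n20; clear; lra.
have e0' : e != 0 by rewrite -normr_gt0.
apply: (le_trans (@dilation_bound a b e z e0' _)).
  by move: ne zn n20; clear; lra.
rewrite -/n lerD2l.
apply: (@le_trans _ _ (2 * n * (`|z| / (n ^+ 2 / 64)))).
  apply: ler_pM.
  - by rewrite !addr_ge0// ltW.
  - by rewrite divr_ge0.
  - by move: an bn n0; clear; lra.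
  - by rewrite ler_wpM2l// lef_pV2 ?posrE// divr_gt0.
by rewrite le_eqVlt; apply/orP; left; apply/eqP; field; rewrite gt_eqF.
Qed.

(* Replace the initial arc of a minimiser by the straight segment: the length
   gained is at most the cost of moving the end point of the rest vertically. *)
Lemma geodesic_excess (gam : R -> heis) (t : R) :
  constant_speed_geodesic (heis_dist p) gam -> gam 0 = heis0 ->
  0 < t -> t <= 32^-1 -> 0 < N (gam 1) ->
  N (gam t) = t * N (gam 1) /\
  t * N (gam 1) - lp_norm p (gam t).1.1 (gam t).1.2 <= 256 * `|(gam t).2| / N (gam 1).
Proof.
move=> geo g0 t0 t32 L0; set L := N (gam 1).
have t1 : t <= 1 by lra.
have NP : N (gam t) = t * L.
  have := geo 0 t; rewrite g0 lexx ler01 (ltW t0) t1 => /(_ isT isT).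
  by rewrite subr0 (ger0_norm (ltW t0)) !heis_normE// -EFinM => -[].
split => //.
pose W := heis_mul (heis_inv (gam t)) (gam 1).
have NW : N W = (1 - t) * L.
  have := geo t 1; rewrite lexx ler01 (ltW t0) t1 => /(_ isT isT).
  rewrite heis_distE// -/W ger0_norm ?subr_ge0// g0 heis_normE// -EFinM.
  by move=> -[].
case EP : (gam t) NP => [[x y] z] /= NP; case EW : W NW => [[a b] e] NW.
(* The vertical direction is central, so the height [z] of the initial arc can be moved to the
   second factor, leaving a segment as the first. *)
have Q : gam 1 = heis_mul (x, y, 0) (a, b, e + z).
  have -> : gam 1 = heis_mul (gam t) W by rewrite /W heis_mulKg.
  by rewrite EP EW; apply: heis_eq => /=; ring.
have h1 : L <= lp_norm p x y + N (a, b, e + z).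
  rewrite /L Q (le_trans (heis_normM p1 _ _))// lerD2r.
  exact: heis_norm_segment.
have n0 : 0 < N (a, b, e).
  by rewrite NW mulr_gt0// subr_gt0; lra.
have zz : `|z| <= t ^+ 2 * L ^+ 2.
  by have := norm_height_le p1 (x, y, z); rewrite NP exprMn.
have L20 : 0 < L ^+ 2 by rewrite exprn_gt0.
have tt : t ^+ 2 <= 32^-1 ^+ 2 by rewrite ler_sqr ?nnegrE ?(ltW t0) ?invr_ge0.
have tL : t ^+ 2 * L ^+ 2 <= 32^-1 ^+ 2 * L ^+ 2 by rewrite ler_pM2r.
have ut : (31 / 32) ^+ 2 <= (1 - t) ^+ 2.
  by rewrite ler_sqr ?nnegrE ?subr_ge0//; lra.
have uL : (31 / 32) ^+ 2 * L ^+ 2 <= (1 - t) ^+ 2 * L ^+ 2 by rewrite ler_pM2r.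
(* From t <= 1/32 one gets |z| <= L^2/1024, and N(a, b, e)^2/128 >= (31/32)^2 L^2/128. Below, N(a,
   b, e) >= L/2 turns 128 into 256. *)
have zn : `|z| <= N (a, b, e) ^+ 2 / 128.
  rewrite NW exprMn; lra.
have h2 := heis_norm_vertical_lipschitz n0 zn.
have h3 : 128 * `|z| / N (a, b, e) <= 256 * `|z| / L.
  have -> : 256 * `|z| / L = 128 * `|z| / (L / 2) by field; rewrite gt_eqF.
  rewrite ler_wpM2l ?mulr_ge0// lef_pV2 ?posrE ?divr_gt0// NW mulrC ler_wpM2r ?(ltW L0)//.
  by lra.
have h4 : N (a, b, e) = L - t * L by rewrite NW; ring.
lra.
Qed.

End GeodesicHeight.

(* (1, dual_slope p q h) is the direction paired maximally with the covector
   (dual_height q h, h), for [`|h| < 1]. *)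
HB.lock Definition dual_slope {R : realType} (p q h : R) : R :=
  Num.sg h * `|h| `^ (q - 1) * (1 - `|h| `^ q) `^ (- p^-1).

(** * Equality in Hölder's inequality and growth of the dual slope *)

Section DualSlope.

Context {R : realType}.
Variables p q : R.
Hypotheses (p1 : 1 < p) (pq : p^-1 + q^-1 = 1).
Implicit Types (a b h s : R).

Let p0 : 0 < p. Proof. exact: lt_trans p1. Qed.

Let powR_antitone a b (r : R) : 0 < a -> a <= b -> 0 <= r -> b `^ (- r) <= a `^ (- r).
Proof.
move=> a0 ab r0; have b0 : 0 < b := lt_le_trans a0 ab.
rewrite !powRN lef_pV2 ?posrE ?powR_gt0//.
by apply: ge0_ler_powR; rewrite ?nnegrE ?(ltW a0) ?(ltW b0).
Qed.

Lemma conj_gt1 : 1 < q.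
Proof.
have ip : 0 < p^-1 < 1 by rewrite invr_gt0 p0 invf_lt1.
have iq : 0 < q^-1 < 1 by move: ip pq; lra.
have q0 : 0 < q by rewrite -invr_gt0; case/andP: iq.
by rewrite -invf_lt1//; case/andP: iq.
Qed.

Let q1 : 1 < q := conj_gt1.
Let q0 : 0 < q. Proof. exact: lt_trans q1. Qed.

Lemma conj_mul : p + q = p * q.
Proof.
have -> : p + q = p * q * (p^-1 + q^-1) by field; rewrite !gt_eqF.
by rewrite pq mulr1.
Qed.

Lemma conj_mul1 : (p - 1) * (q - 1) = 1.
Proof. by have := conj_mul; lra. Qed.

Local Notation dual_slope := (dual_slope p q).

Let one_sub h : `|h| < 1 -> 0 < 1 - `|h| `^ q.
Proof.
move=> h1; rewrite subr_gt0; have := @gt0_ltr_powR _ q q0 `|h| 1.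
by rewrite !nnegrE powR1 normr_ge0 ler01; apply.
Qed.

(** The right-hand side is also that of [dual_pairing_slope]: together they are the equality case of
    Hölder's inequality for the direction (1, phi(h)). *)
Lemma lp_norm_dual_slope h : `|h| < 1 ->
  lp_norm p 1 (dual_slope h) = (1 - `|h| `^ q) `^ (- p^-1).
Proof.
move=> h1; have m0 := one_sub h1; set m := 1 - _ in m0 *.
have E : `|dual_slope h| `^ p = `|h| `^ q * m^-1.
  rewrite dual_slope.unlock -/m !normrM (ger0_norm (powR_ge0 _ _)) (ger0_norm (powR_ge0 m _)).
  have [->|hn] := eqVneq h 0.
    by rewrite sgr0 !normr0 !mul0r !powR0 ?gt_eqF// mul0r.
  rewrite normr_sg hn mul1r powRM ?powR_ge0// -!powRrM mulNr mulVf ?gt_eqF//.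
  rewrite powR_inv1 ?(ltW m0)//; congr (_ `^ _ * _).
  by have := conj_mul; lra.
rewrite /lp_norm E normr1 powR1.
have -> : 1 + `|h| `^ q * m^-1 = m `^ (-1).
  rewrite powR_inv1 ?(ltW m0)// /m; field; rewrite gt_eqF//.
by rewrite -powRrM mulN1r.
Qed.

Lemma dual_pairing_slope h : `|h| < 1 ->
  dual_height q h + h * dual_slope h = (1 - `|h| `^ q) `^ (- p^-1).
Proof.
move=> h1; have m0 := one_sub h1.
rewrite dual_heightE ?(ltW q0) ?(ltW h1)// dual_slope.unlock; set m := 1 - _ in m0 *.
have -> : q^-1 = 1 + - p^-1 by move: pq; lra.
rewrite [m `^ (1 + _)]powRD; last by rewrite (gt_eqF m0) implybT.
have E (A B : R) : h * (Num.sg h * A * B) = `|h| * A * B by rewrite [`|h|]normrEsg; ring.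
rewrite (powRr1 (ltW m0)) E (mulr_powRB1 (normr_ge0 h) q0) -mulrDl /m subrK.
exact: mul1r.
Qed.

(** Hölder's inequality for the direction (1, phi(s)) holds at the covector of [h] and is an
    equality at that of [s]. Concavity of [K] follows without differentiating [K]. *)
Lemma dual_height_supergradient h s : `|h| <= 1 -> `|s| < 1 ->
  dual_height q h <= dual_height q s + (s - h) * dual_slope s.
Proof.
move=> h1 s1.
have := @dual_pairing_le _ p q h 1 (dual_slope s) p0 q0 pq h1.
rewrite (lp_norm_dual_slope s1) -(dual_pairing_slope s1) mulr1.
by move: (dual_height q h) (dual_height q s) (dual_slope s) => A B D; lra.
Qed.

Lemma dual_slopeN h : dual_slope (- h) = - dual_slope h.
Proof. by rewrite dual_slope.unlock sgrN normrN !mulNr. Qed.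

Lemma dual_slope0 : dual_slope 0 = 0.
Proof. by rewrite dual_slope.unlock sgr0 !mul0r. Qed.

Lemma dual_slopeE h : 0 < h ->
  dual_slope h = h `^ (q - 1) * (1 - h `^ q) `^ (- p^-1).
Proof. by move=> h0; rewrite dual_slope.unlock (gtr0_sg h0) mul1r (gtr0_norm h0). Qed.

Lemma dual_slope_MVT m : 0 < m -> m < 1 -> exists2 C : R, 0 < C &
  forall a b, 0 < a -> a <= b -> b <= m -> exists2 x, a <= x <= b &
    (q - 1) * x `^ (q - 2) * (b - a) <= dual_slope b - dual_slope a <=
    C * x `^ (q - 2) * (b - a).
Proof.
move=> m0 m1.
pose wm := (1 - m `^ q) `^ (- p^-1); pose wm' := (1 - m `^ q) `^ (- p^-1 - 1).
have m1' : `|m| < 1 by rewrite gtr0_norm.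
have om : 0 < 1 - m `^ q by have := one_sub m1'; rewrite gtr0_norm.
exists ((q - 1) * wm + p^-1 * q * wm').
  have h1 : 0 < wm by exact: powR_gt0.
  have h2 : 0 < wm' by exact: powR_gt0.
  have h3 : 0 < p^-1 by rewrite invr_gt0.
  have h4 : 0 < q - 1 by rewrite subr_gt0.
  by rewrite addr_gt0 ?mulr_gt0.
move=> a b a0 ab bm.
pose df x := x `^ (q - 1) * (- p^-1 * (1 - x `^ q) `^ (- p^-1 - 1) * (- (q * x `^ (q - 1)))) +
   (1 - x `^ q) `^ (- p^-1) * ((q - 1) * x `^ (q - 1 - 1)).
have pos x : a <= x <= b -> 0 < x /\ 0 < 1 - x `^ q.
  move=> /andP[ax xb]; have x0 : 0 < x := lt_le_trans a0 ax; split => //.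
  have := @one_sub x; rewrite gtr0_norm//; apply.
  by rewrite (le_lt_trans xb)// (le_lt_trans bm).
have der x : a <= x <= b ->
    is_derive x 1 (fun h => h `^ (q - 1) * (1 - h `^ q) `^ (- p^-1)) (df x).
  move=> axb; have [x0 ox] := pos x axb.
  have d1 := @is_derive1_powR R (q - 1) x x0.
  have d2 : is_derive x 1 (fun h => 1 - h `^ q) (- (q * x `^ (q - 1))).
    have := is_deriveB (is_derive_cst (1 : R) x 1) (@is_derive1_powR R q x x0).
    by rewrite sub0r.
  have d3 := @is_derive1_comp R (fun y => y `^ (- p^-1)) (fun h => 1 - h `^ q) x _ _
    (@is_derive1_powR R (- p^-1) (1 - x `^ q) ox) d2.
  exact: is_deriveM d1 d3.
have [||x] := @MVT_segment _ (fun h => h `^ (q - 1) * (1 - h `^ q) `^ (- p^-1)) df a b ab.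
- by move=> x; rewrite in_itv/= => /andP[/ltW ax /ltW xb]; apply: der; rewrite ax.
- apply: derivable_within_continuous => x; rewrite in_itv/= => axb.
  exact: (@ex_derive _ _ _ _ _ _ _ (der x axb)).
rewrite in_itv/= => axb E; exists x => //.
rewrite (dual_slopeE a0) (dual_slopeE (lt_le_trans a0 ab)).
suff key Y : Y = df x * (b - a) -> (q - 1) * x `^ (q - 2) * (b - a) <= Y <=
    ((q - 1) * wm + p^-1 * q * wm') * x `^ (q - 2) * (b - a) by exact: key _ E.
move=> ->; clear E; have [x0 ox] := pos x axb.
have ba : 0 <= b - a by rewrite subr_ge0.
have xm : x <= m by case/andP: axb => _ xb; exact: le_trans bm.
have xq : x `^ q <= m `^ q.
  by apply: ge0_ler_powR; rewrite ?nnegrE ?(ltW q0) ?(ltW x0) ?(ltW m0).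
have mono r : 0 <= r -> (1 - x `^ q) `^ (- r) <= (1 - m `^ q) `^ (- r).
  by apply: powR_antitone om _; rewrite lerD2l lerN2.
have w1 : 1 <= (1 - x `^ q) `^ (- p^-1).
  have h1 : 1 - x `^ q <= 1 by rewrite lerBlDr lerDl powR_ge0.
  have h2 : 0 <= p^-1 by rewrite invr_ge0 ltW.
  by have := powR_antitone ox h1 h2; rewrite powR1.
have w2 : (1 - x `^ q) `^ (- p^-1) <= wm by apply: mono; rewrite invr_ge0 ltW.
have w3 : (1 - x `^ q) `^ (- p^-1 - 1) <= wm'.
  by rewrite /wm' -opprD; apply: mono; rewrite addr_ge0// invr_ge0 ltW.
have e2 : q - 1 - 1 = q - 2 by ring.
have X0 := powR_ge0 x (q - 2).
have X1 : x `^ (q - 1) * x `^ (q - 1) <= x `^ (q - 2).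
  have xD r s : x `^ (r + s) = x `^ r * x `^ s.
    by apply: powRD; rewrite (gt_eqF x0) implybT.
  rewrite -xD.
  have -> : q - 1 + (q - 1) = (q - 2) + q by ring.
  by rewrite xD ler_piMr// -subr_ge0 ltW.
have pq0 : 0 <= p^-1 * q by rewrite mulr_ge0 ?invr_ge0 ?(ltW p0) ?(ltW q0).
(* Both terms are nonnegative. The second alone gives the lower bound; the first is absorbed in the
   upper one since x^(2q-2) <= x^(q-2). *)
have -> : df x = p^-1 * q * (1 - x `^ q) `^ (- p^-1 - 1) * (x `^ (q - 1) * x `^ (q - 1)) +
    (q - 1) * (1 - x `^ q) `^ (- p^-1) * x `^ (q - 2) by rewrite /df e2; ring.
have qm : 0 <= q - 1 by rewrite subr_ge0 ltW.
have W3 := powR_ge0 (1 - x `^ q) (- p^-1 - 1).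
have V0 : 0 <= x `^ (q - 1) * x `^ (q - 1) by rewrite mulr_ge0 ?powR_ge0.
move: X0 X1 w1 w2 w3 W3 V0; clear -qm pq0 ba.
move: (x `^ (q - 2)) (x `^ (q - 1) * x `^ (q - 1)) => U V.
move: ((1 - x `^ q) `^ (- p^-1)) ((1 - x `^ q) `^ (- p^-1 - 1)) (p^-1 * q) pq0 => W W' P P0.
move=> U0 VU W1 Ww W'w W'0 V0.
have := ba; move: (b - a) => D D0; rewrite -/(wm) in Ww *.
apply/andP; split; rewrite ler_wpM2r//.
  rewrite -[leLHS]add0r lerD//; first by rewrite !mulr_ge0.
  by rewrite ler_wpM2r// ler_peMr.
rewrite [leRHS]mulrDl [leLHS]addrC lerD//; first by rewrite ler_wpM2r// ler_wpM2l.
by rewrite ler_pM ?mulr_ge0// ler_wpM2l.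
Qed.

(** Controls the size of phi instead of its variation, for intervals around 0, which
    [dual_slope_MVT] does not reach. *)
Lemma norm_dual_slope_le m : 0 < m -> m < 1 -> exists2 C : R, 0 < C &
  forall h, `|h| <= m -> `|dual_slope h| <= C * `|h| `^ (q - 1).
Proof.
move=> m0 m1; have m1' : `|m| < 1 by rewrite gtr0_norm.
have om : 0 < 1 - m `^ q by have := one_sub m1'; rewrite gtr0_norm.
exists ((1 - m `^ q) `^ (- p^-1)); first exact: powR_gt0.
move=> h hm; have h1 : `|h| < 1 by exact: le_lt_trans m1.
have oh := one_sub h1.
rewrite dual_slope.unlock !normrM (ger0_norm (powR_ge0 _ _)) (ger0_norm (powR_ge0 (1 - _) _)).
have hW : (1 - `|h| `^ q) `^ (- p^-1) <= (1 - m `^ q) `^ (- p^-1).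
  have hk : `|h| `^ q <= m `^ q.
    by apply: ge0_ler_powR; rewrite ?nnegrE ?(ltW q0) ?(ltW m0).
  have om1 : 1 - m `^ q <= 1 - `|h| `^ q by rewrite lerD2l lerN2.
  by apply: powR_antitone om om1 _; rewrite invr_ge0 ltW.
have W0 := powR_ge0 (1 - `|h| `^ q) (- p^-1).
have A0 := powR_ge0 `|h| (q - 1).
have s1 : `|Num.sg h| <= 1 by rewrite normr_sg; case: (h != 0).
have s0 := normr_ge0 (Num.sg h).
move: hW W0 A0 s1 s0; clear.
move: (powR _ _) (powR _ _) (powR _ _) `|Num.sg h| => W W' A S WW' W0 A0 S1 S0.
apply: (@le_trans _ _ (W * A)); first by rewrite ler_wpM2r// ler_piMl.
by rewrite mulrC ler_wpM2r.
Qed.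

End DualSlope.

(** * Lower bound of the norm by a calibration *)

Section HeightBound.
Context {R : realType}.
Local Notation heis := (R * R * R)%type.
Local Notation heis0 := (0 : R, 0 : R, 0 : R).
Variables p q : R.
Hypotheses (p1 : 1 < p) (pq : p^-1 + q^-1 = 1).
Local Notation N := (heis_norm p).
Local Notation K := (dual_height q).
Local Notation phi := (dual_slope p q).

Let p0 : 0 < p. Proof. exact: lt_trans p1. Qed.
Let q1 : 1 < q. Proof. exact: conj_gt1 p1 pq. Qed.
Let q0 : 0 < q. Proof. exact: lt_trans q1. Qed.

Lemma ge0_increment_ge (H dH : R -> R) (x : R) : 0 <= x ->
  (forall y : R, is_derive y 1 H (dH y)) -> (forall y, 0 <= y <= x -> 0 <= dH y) -> H 0 <= H x.
Proof.
move=> x0 dHH dH0.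
have [|y] := MVT_segment x0 (fun y _ => dHH y).
  by apply: derivable_within_continuous => y _; exact: (@ex_derive _ _ _ _ _ _ _ (dHH y)).
rewrite in_itv/= => y0x E.
by rewrite -subr_ge0 E subr0 mulr_ge0// dH0.
Qed.

(** The calibration is centred so that its covector is [c0] at abscissa x/2. The first-order error
    is then odd about the midpoint of [0, x] and integrates to 0; only [e] is left. *)
Lemma heis_norm_calib_ge (x y z c0 w a e : R) : 0 < x ->
  `|c0| + 3 * `|w| * N (x, y, z) <= 1 ->
  (forall s, `|s| <= x / 2 -> K c0 - a * (w * s) - e <= K (c0 + w * s)) ->
  x * K c0 + c0 * y + w * z - x * e <= N (x, y, z).
Proof.
move=> x0 c0w HK; set n := N (x, y, z) in c0w *.
have xn : x <= n by have := norm_fst_le p1 (x, y, z); rewrite /= gtr0_norm.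
have n0 : 0 < n by exact: lt_le_trans xn.
pose c := c0 - w * x / 2.
have [H dH _] : exists2 H : R -> R, forall x : R, is_derive x 1 H (K (c + w * x)) & H 0 = 0.
  apply: continuous_antiderivative => u.
  apply: (@continuous_comp _ _ _ (fun v => c + w * v) K).
    by apply: cvgD; [exact: cvg_cst|apply: cvgM; [exact: cvg_cst|exact: cvg_id]].
  exact: continuous_dual_height.
have Hx : x * (K c0 - e) <= H x - H 0.
  pose k := K c0 - e.
  (* The term in u (u - x) vanishes at both ends, and its derivative is the first-order error a w (u
     - x/2). *)
  have dG (u : R) : is_derive u 1 (fun u => H u - (k * u - a * w / 2 * (u * (u - x))))
      (K (c + w * u) - (k - a * w / 2 * (u + (u - x)))).
    have d1 := is_derive_id u (1 : R).
    have d2 : is_derive u 1 (fun v : R => v - x) 1.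
      by have := is_deriveB d1 (is_derive_cst x u 1); rewrite subr0.
    have := is_deriveB (dH u) (is_deriveB (is_deriveZ k d1) (is_deriveZ (a * w / 2) (is_deriveM d1 d2))).
    set D := (X in is_derive _ _ _ X) => dd.
    have <- // : D = K (c + w * u) - (k - a * w / 2 * (u + (u - x))).
    by rewrite /D; have sE (r s : R) : r *: s = r * s by []; rewrite !sE !mulr1.
  have H1 : forall u, 0 <= u <= x -> 0 <= K (c + w * u) - (k - a * w / 2 * (u + (u - x))).
    move=> u /andP[u0 ux].
    have s1 : `|u - x / 2| <= x / 2 by rewrite ler_norml; apply/andP; split; lra.
    have := HK _ s1; have -> : c0 + w * (u - x / 2) = c + w * u by rewrite /c; field.
    have -> : a * (w * (u - x / 2)) = a * w / 2 * (u + (u - x)) by field.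
    by rewrite /k; move: (K _) (K _) (_ * (u + _)) => A B D; lra.
  have := ge0_increment_ge (ltW x0) dG H1.
  have -> : H 0 - (k * 0 - a * w / 2 * (0 * (0 - x))) = H 0 by ring.
  have -> : H x - (k * x - a * w / 2 * (x * (x - x))) = H x - k * x by ring.
  by rewrite -/k [x * k]mulrC; move: (H 0) (H x) (k * x) => A B D; lra.
(* Within distance 2n of the origin, |u - x/2| <= 5n/2; the factor 3 of the hypothesis covers it. *)
have drho : (heis_dist p heis0 (x, y, z) < (2 * n)%:E)%E.
  by rewrite heis_normE// lte_fin -/n ltr_pMl// ltr1n.
have Hc u : `|u - (heis0 : heis).1.1| <= 2 * n -> `|c + w * u| <= 1.
  rewrite subr0 => un; apply: le_trans c0w.
  have -> : c + w * u = c0 + w * (u - x / 2) by rewrite /c; field.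
  rewrite (le_trans (ler_normD _ _))// lerD2l normrM mulrAC mulrC ler_wpM2r//.
  rewrite (le_trans (ler_normB _ _))// (gtr0_norm (divr_gt0 x0 (ltr0Sn R 1))).
  by move: un xn n0; clear -p1 pq p0 q1 q0; move: `|u| => U; lra.
have := heis_dist_calib p0 q0 pq dH Hc drho.
rewrite heis_normE// lee_fin -/n /calib/= !mul0r !mulr0 !addr0 mulr0 addr0.
have -> : H x + c * y + w * (z + x * y / 2) - H 0 = (H x - H 0) + c0 * y + w * z.
  by rewrite /c; field.
apply: le_trans; move: Hx; move: (K c0) (H x - H 0) => A B; lra.
Qed.

Lemma powR_comparable (c x r : R) : 0 < c -> c / 2 <= x -> x <= 2 * c ->
  x `^ r <= 2 `^ `|r| * c `^ r.
Proof.
move=> c0 cx xc; have x0 : 0 < x by apply: lt_le_trans cx; rewrite divr_gt0.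
have c20 : 0 < c / 2 by rewrite divr_gt0.
have [r0|r0] := leP 0 r.
  rewrite (ger0_norm r0) -powRM ?(ltW c0)//.
  by apply: ge0_ler_powR => //; rewrite nnegrE ?mulr_ge0 ?(ltW c0) ?(ltW x0).
have r0' : 0 <= - r by rewrite oppr_ge0 ltW.
have := @ge0_ler_powR _ (- r) r0' (c / 2) x; rewrite !nnegrE (ltW x0) (ltW c20).
move=> /(_ isT isT cx) H.
have E (b : R) : b `^ r = (b `^ (- r))^-1 by rewrite powRN invrK.
have T0 : 0 < 2 `^ (- r) :> R by rewrite powR_gt0.
have E2 : c `^ (- r) = (c / 2) `^ (- r) * 2 `^ (- r).
  by rewrite -powRM ?(ltW c20)// divfK.
have A0 : 0 < x `^ (- r) by rewrite powR_gt0.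
have B0 : 0 < c `^ (- r) by rewrite powR_gt0.
rewrite (E x) (E c) (ltr0_norm r0) -div1r ler_pdivrMr// mulrAC ler_pdivlMr// mul1r.
by rewrite mulrC E2 ler_pM2r.
Qed.

(** If c0 >= 2 eta, all covectors involved are comparable to c0, and phi has Lipschitz constant of
    order c0^(q-2) there. Otherwise the interval may contain 0, where phi' degenerates, and the size
    of phi, of order eta^(q-1), is used instead of its variation. *)
Lemma dual_height_second_order (m : R) : 0 < m -> m < 1 -> exists2 C : R, 0 < C &
  forall c0 eta s : R, 0 <= c0 -> 0 < eta -> `|s| <= eta ->
  (2 * eta <= c0 -> c0 + eta <= m ->
    K c0 - phi c0 * s - C * c0 `^ (q - 2) * eta ^+ 2 <= K (c0 + s)) /\
  (c0 < 2 * eta -> 3 * eta <= m ->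
    K c0 - phi c0 * s - C * eta `^ q <= K (c0 + s)).
Proof.
move=> m0 m1.
have [C1 C10 HC1] := dual_slope_MVT p1 pq m0 m1.
have [C2 C20 HC2] := norm_dual_slope_le p1 pq m0 m1.
exists (C1 * 2 `^ `|q - 2| + 2 * C2 * 3 `^ (q - 1)).
  by rewrite addr_gt0 ?mulr_gt0 ?powR_gt0.
move=> c0 eta s c00 eta0 seta.
have super : `|c0| <= 1 -> `|c0 + s| < 1 ->
    K c0 - phi c0 * s - s * (phi (c0 + s) - phi c0) <= K (c0 + s).
  move=> h1 h2; have := dual_height_supergradient p1 pq h1 h2.
  by rewrite addrAC subrr add0r; move: (K _) (K _) (phi _) (phi _) => A B D E; lra.
have := seta; rewrite ler_norml => /andP[s1 s2].
split=> hc hm.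
- have c0p : 0 < c0 by rewrite (lt_le_trans _ hc)// mulr_gt0.
  have a1 : `|c0| <= 1 by rewrite gtr0_norm//; move: hm m1 eta0; clear -p1 pq p0 q1 q0; lra.
  have a2 : `|c0 + s| < 1.
    by rewrite ger0_norm; move: hm m1 eta0 s1 s2 hc; clear -p1 pq p0 q1 q0; lra.
  apply: le_trans (super a1 a2); rewrite lerD2l lerN2.
  have comp x : c0 - eta <= x -> x <= c0 + eta -> x `^ (q - 2) <= 2 `^ `|q - 2| * c0 `^ (q - 2).
    move=> x1 x2; apply: powR_comparable => //; move: x1 x2 hc eta0; clear -p1 pq p0 q1 q0; lra.
  have ss : s ^+ 2 <= eta ^+ 2 by rewrite -real_normK ?num_real// ler_sqr ?nnegrE ?(ltW eta0).
  have key d x : 0 <= d -> `|s| = d -> x `^ (q - 2) <= 2 `^ `|q - 2| * c0 `^ (q - 2) ->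
      d * (C1 * x `^ (q - 2) * d) <= (C1 * 2 `^ `|q - 2| + 2 * C2 * 3 `^ (q - 1)) *
        c0 `^ (q - 2) * eta ^+ 2.
    move=> d0 sd xc.
    have -> : d * (C1 * x `^ (q - 2) * d) = C1 * x `^ (q - 2) * d ^+ 2 by ring.
    apply: ler_pM; rewrite ?mulr_ge0 ?powR_ge0 ?sqr_ge0 ?(ltW C10)//; last first.
      by rewrite -sd real_normK ?num_real.
    rewrite mulrDl -mulrA -[leLHS]addr0 lerD//.
      by rewrite ler_wpM2l // ltW.
    by rewrite !mulr_ge0 ?powR_ge0// ltW.
  have [s0|s0] := leP 0 s.
    have [||x /andP[x1 x2] /andP[_ H]] := HC1 c0 (c0 + s) c0p; first by rewrite lerDl.
      by move: hm s2; clear -p1 pq p0 q1 q0; lra.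
    have Es : c0 + s - c0 = s by ring.
    move: H; rewrite Es => H.
    apply: le_trans (key s x s0 (ger0_norm s0) _).
      by rewrite ler_wpM2l.
    by apply: comp; move: x1 x2 s2 eta0; clear -p1 pq p0 q1 q0; lra.
  have cs0 : 0 < c0 + s by move: hc s1 eta0; clear -p1 pq p0 q1 q0; lra.
  have [||x /andP[x1 x2] /andP[_ H]] := HC1 (c0 + s) c0 cs0.
    by rewrite gerDl ltW.
    by move: hm eta0; clear -p1 pq p0 q1 q0; lra.
  have Es : c0 - (c0 + s) = - s by ring.
  move: H; rewrite Es => H.
  have -> : s * (phi (c0 + s) - phi c0) = (- s) * (phi c0 - phi (c0 + s)) by ring.
  have ns0 : 0 <= - s by rewrite oppr_ge0 ltW.
  apply: le_trans (key (- s) x ns0 (ltr0_norm s0) _).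
    by rewrite ler_wpM2l.
  by apply: comp; move: x1 x2 s1 eta0; clear -p1 pq p0 q1 q0; lra.
- have a1 : `|c0| <= 1 by rewrite ger0_norm//; move: hm m1 eta0 hc; clear -p1 pq p0 q1 q0; lra.
  have a3 : `|c0 + s| <= 3 * eta by rewrite ler_norml; move: s1 s2 hc c00 eta0; clear -p1 pq p0 q1 q0; lra.
  have a2 : `|c0 + s| < 1 by apply: le_lt_trans m1; exact: le_trans hm.
  have a4 : `|c0| <= 3 * eta by rewrite ger0_norm//; move: hc eta0; clear -p1 pq p0 q1 q0; lra.
  apply: le_trans (super a1 a2); rewrite lerD2l lerN2.
  have bnd h : `|h| <= 3 * eta -> `|phi h| <= C2 * (3 `^ (q - 1) * eta `^ (q - 1)).
    move=> h3; apply: (le_trans (HC2 h (le_trans h3 hm))).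
    rewrite ler_wpM2l ?(ltW C20)// -powRM ?(ltW eta0)//.
    by apply: ge0_ler_powR; rewrite ?nnegrE ?subr_ge0 ?(ltW q1) ?mulr_ge0 ?(ltW eta0).
  apply: (le_trans (ler_norm _)); rewrite normrM.
  have h1 := bnd _ a3; have h2 := bnd _ a4.
  have h3 : `|phi (c0 + s) - phi c0| <= 2 * (C2 * (3 `^ (q - 1) * eta `^ (q - 1))).
    rewrite (le_trans (ler_normB _ _))//; move: h1 h2.
    by move: `|phi (c0 + s)| `|phi c0| (C2 * _) => A B D; lra.
  apply: (@le_trans _ _ (eta * (2 * (C2 * (3 `^ (q - 1) * eta `^ (q - 1)))))).
    by rewrite ler_pM.
  rewrite -(mulr_powRB1 (ltW eta0) q0) [leRHS]mulrDl -[leLHS]add0r lerD//.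
    by rewrite !mulr_ge0 ?powR_ge0 ?(ltW C10) ?(ltW eta0).
  by rewrite le_eqVlt; apply/orP; left; apply/eqP; ring.
Qed.

End HeightBound.

Section HeightEstimate.
Context {R : realType}.
Local Notation heis := (R * R * R)%type.
Local Notation heis0 := (0 : R, 0 : R, 0 : R).
Variables p q : R.
Hypotheses (p1 : 1 < p) (pq : p^-1 + q^-1 = 1).
Local Notation N := (heis_norm p).
Local Notation K := (dual_height q).
Local Notation phi := (dual_slope p q).

Let p0 : 0 < p. Proof. exact: lt_trans p1. Qed.
Let q1 : 1 < q. Proof. exact: conj_gt1 p1 pq. Qed.
Let q0 : 0 < q. Proof. exact: lt_trans q1. Qed.

(* [c] is the second component of the unit covector dual to (1, v). *)
Lemma dual_angle (v : R) : 0 <= v -> v <= 1 -> exists c : R,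
  [/\ 0 <= c, c <= 2^-1 `^ q^-1, K c + c * v = lp_norm p 1 v &
      c <= v `^ (p - 1) /\ v `^ (p - 1) <= 2 * c].
Proof.
move=> v0 v1.
have vp0 := powR_ge0 v p.
have vp1 : v `^ p <= 1.
  have := @ge0_ler_powR _ p (ltW p0) v 1; rewrite powR1; apply; rewrite ?nnegrE//.
set V := v `^ p in vp0 vp1.
have V10 : 0 < 1 + V by rewrite ltr_wpDr.
have iq0 : 0 <= q^-1 by rewrite invr_ge0 ltW.
(* V/(1 + V) is the share of the second component in the p-th power of the norm of (1, v), at most
   1/2 because v <= 1. *)
pose c := (V / (1 + V)) `^ q^-1.
have r0 : 0 <= V / (1 + V) by rewrite divr_ge0// ltW.
have r2 : V / (1 + V) <= 2^-1 by rewrite ler_pdivrMr//; move: vp1; clear -p1 pq p0 q1 q0; lra.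
have c0 : 0 <= c by exact: powR_ge0.
have cq : c `^ q = V / (1 + V) by rewrite /c -powRrM mulVf ?gt_eqF// powRr1.
have c1 : c <= 2^-1 `^ q^-1 by apply: ge0_ler_powR => //; rewrite nnegrE// invr_ge0.
have h1 : 2^-1 `^ q^-1 <= 1 :> R.
  have := @ge0_ler_powR _ q^-1 iq0 2^-1 1; rewrite powR1; apply; rewrite ?nnegrE ?invr_ge0//.
  by rewrite invf_le1// ler1n.
pose w := (1 + V) `^ (- q^-1).
have w0 : 0 < w by rewrite powR_gt0.
have vpq : (p - 1) * q = p by have := conj_mul p1 pq; clear -p1 pq p0 q1 q0; lra.
have cE : c = v `^ (p - 1) * w.
  have iV : (1 + V)^-1 `^ q^-1 = w.
    by rewrite -(powR_inv1 (ltW V10)) -powRrM mulN1r.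
  have pV : V `^ q^-1 = v `^ (p - 1).
    have pqE : p / q = p - 1 by rewrite -{1}vpq mulfK ?gt_eqF.
    by rewrite /V -powRrM pqE.
  have iV0 : 0 <= (1 + V)^-1 by rewrite invr_ge0 ltW.
  by rewrite /c (powRM _ vp0 iV0) iV pV.
have w1 : w <= 1.
  rewrite /w powRN invf_le1 ?powR_gt0//.
  have := @ge0_ler_powR _ q^-1 iq0 1 (1 + V); rewrite powR1; apply; rewrite ?nnegrE ?(ltW V10)//.
  by rewrite lerDl.
have w2 : 1 <= 2 * w.
  rewrite /w powRN ler_pdivlMr ?powR_gt0// mul1r.
  have iq1 : q^-1 <= 1 by rewrite invf_le1// ltW.
  apply: (@le_trans _ _ (2 `^ q^-1)).
    apply: ge0_ler_powR; rewrite ?nnegrE ?(ltW V10)//.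
    by move: vp1; clear -p1 pq p0 q1 q0; lra.
  by rewrite ler1_powR// ler1n.
have KE : K c = w.
  rewrite (dual_heightE (ltW q0)); last by rewrite (ger0_norm c0) (le_trans c1).
  have E1 : 1 - V / (1 + V) = (1 + V) `^ (-1).
    by rewrite (powR_inv1 (ltW V10)); field; rewrite gt_eqF.
  by rewrite (ger0_norm c0) cq E1 -powRrM mulN1r.
have vP0 := powR_ge0 v (p - 1).
have e4 : c <= v `^ (p - 1) /\ v `^ (p - 1) <= 2 * c.
  by rewrite cE; split; [rewrite ler_piMr|rewrite mulrCA ler_peMr].
have e3 : K c + c * v = lp_norm p 1 v.
  have E1 : w + v `^ (p - 1) * w * v = w * (1 + v * v `^ (p - 1)) by ring.
  have pE : 1 + - q^-1 = p^-1 by move: pq; clear -p1 pq p0 q1 q0; lra.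
  have wE : w * (1 + V) = (1 + V) `^ (1 + - q^-1).
    rewrite powRD; last by rewrite (gt_eqF V10) implybT.
    by rewrite (powRr1 (ltW V10)) mulrC.
  by rewrite KE cE E1 (mulr_powRB1 v0 p0) -/V wE pE /lp_norm normr1 powR1 (ger0_norm v0).
by exists c; exact: And4 c0 c1 e3 e4.
Qed.

(** [B] stands for the constant of [geodesic_excess]. The dichotomy is whether the dual covector [c]
    is at least twice its possible variation [eta = B * t] along the calibration; since [c] is of
    order (y/x)^(p-1) and (p-1)(q-1) = 1, this compares y/x with t^(q-1). *)
Lemma height_bound (B : R) : 1 <= B -> exists C t0 : R, [/\ 0 < C, 0 < t0 &
  forall t L x y z, 0 < t -> t < t0 -> 0 < L -> 0 <= y -> y <= x -> 0 < x ->
    N (x, y, z) = t * L -> t * L - lp_norm p x y <= B * `|z| / L ->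
    (y <= C * t `^ (q - 1) * x /\ `|z| <= C * L ^+ 2 * t `^ (q + 1)) \/
    (t `^ (q - 1) * x <= y /\ `|z| <= C * L ^+ 2 * t ^+ 3 * (y / x) `^ (2 - p))].
Proof.
move=> B1; have B0 : 0 < B by exact: lt_le_trans B1.
(* [k] bounds the dual covector for y <= x, and [m] lies halfway between it and 1: perturbed
   covectors stay below [m], away from the singularity of phi. *)
pose k : R := 2^-1 `^ q^-1.
have k0 : 0 < k by rewrite powR_gt0 ?invr_gt0.
have k1 : k < 1.
  have := @gt0_ltr_powR _ q^-1 _ 2^-1 1; rewrite powR1; apply; rewrite ?nnegrE ?invr_ge0 ?invr_gt0//.
  by rewrite invf_lt1// ltr1n.
pose m := (1 + k) / 2.
have m0 : 0 < m by rewrite /m; move: k0 k1; clear -p1 pq p0 q1 q0; lra.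
have m1 : m < 1 by rewrite /m; move: k0 k1; clear -p1 pq p0 q1 q0; lra.
have [C1 C10 HC1] := dual_height_second_order p1 pq m0 m1.
pose C := C1 * B ^+ 2 * 2 `^ `|q - 2| + (4 * B) `^ (q - 1) + C1 * B `^ q.
have Ca : 0 < C1 * B ^+ 2 * 2 `^ `|q - 2| by rewrite !mulr_gt0 ?exprn_gt0 ?powR_gt0.
have Cb : 0 < (4 * B) `^ (q - 1) :> R by rewrite powR_gt0// mulr_gt0.
have Cc : 0 < C1 * B `^ q by rewrite mulr_gt0// powR_gt0.
have C0 : 0 < C by rewrite !addr_gt0.
(* Then B t < (1 - k)/12, which gives k + 6 B t <= 1 for [cond], and both c + eta <= m and 3 eta <=
   m. *)
exists C, ((1 - k) / 12 / B); split => //.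
  by rewrite !divr_gt0// subr_gt0.
move=> t L x y z t0 tt0 L0 y0 yx x0 NE exc.
have Bt0 : 0 < B * t by rewrite mulr_gt0.
have Bt1 : B * t < (1 - k) / 12 by rewrite mulrC -ltr_pdivlMr.
have [v0 v1] : 0 <= y / x /\ y / x <= 1.
  by rewrite divr_ge0 ?(ltW x0)// ler_pdivrMr// mul1r.
have [c [c0 ck Kc [cv vc]]] := dual_angle v0 v1; rewrite -/k in ck.
pose eta := B * t; have eta0 : 0 < eta by [].
have n0 : 0 < t * L by rewrite mulr_gt0.
have xn : x <= t * L by rewrite -NE; have := norm_fst_le p1 (x, y, z); rewrite /= gtr0_norm.
(* The factor 2 makes w z twice the bound on the excess: combining the two inequalities leaves one
   copy of B |z|/L on the left. *)
pose w := Num.sg z * (2 * B / L).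
have wz : w * z = 2 * B * `|z| / L by rewrite /w [`|z|]normrEsg; ring.
have BL0 : 0 < 2 * B / L by rewrite divr_gt0// mulr_gt0.
have wn : `|w| <= 2 * B / L.
  rewrite /w normrM (gtr0_norm BL0) ler_piMl ?(ltW BL0)//.
  by rewrite normr_sg; case: (z != 0).
have wL : `|w| * (t * L) <= 2 * (B * t).
  have -> : 2 * (B * t) = 2 * B / L * (t * L) by field; rewrite gt_eqF.
  by rewrite ler_wpM2r// ltW.
have cond : `|c| + 3 * `|w| * N (x, y, z) <= 1.
  rewrite NE (ger0_norm c0) -[3 * _ * _]mulrA.
  move: wL ck Bt1 k1; clear -p1 pq p0 q1 q0; move: (`|w| * _) => W; lra.
have seta s : `|s| <= x / 2 -> `|w * s| <= eta.
  move=> sx; rewrite normrM (@le_trans _ _ (2 * B / L * (t * L / 2)))//.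
    rewrite ler_pM// (le_trans sx)// ler_wpM2r//.
  by rewrite le_eqVlt; apply/orP; left; apply/eqP; rewrite /eta; field; rewrite gt_eqF.
have lpE : lp_norm p x y = x * K c + c * y.
  have {1}-> : y = x * (y / x) by rewrite mulrC divfK// gt_eqF.
  rewrite -{1}[x]mulr1 (lp_normZ _ _ p0 (ltW x0)) -Kc; field; rewrite gt_eqF//.
have Lz e : 0 <= e ->
    (forall s, `|s| <= x / 2 -> K c - phi c * (w * s) - e <= K (c + w * s)) ->
    `|z| <= L ^+ 2 * t * e.
  move=> e0 He; have := heis_norm_calib_ge p1 pq x0 cond He.
  rewrite -lpE wz NE => H.
  have xe : x * e <= t * L * e by rewrite ler_wpM2r.
  have -> : L ^+ 2 * t * e = L * (t * L * e) by ring.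
  rewrite -ler_pdivrMl// mulrC.
  have zL : 0 <= `|z| / L by rewrite divr_ge0// ltW.
  have e5 : 2 * B * `|z| / L = 2 * (B * (`|z| / L)) by rewrite !mulrA.
  have e2 : B * `|z| / L = B * (`|z| / L) by rewrite mulrA.
  have BZ : `|z| / L <= B * (`|z| / L) by rewrite ler_peMl.
  move: H exc xe zL BZ; rewrite e5 e2.
  move: (B * (`|z| / L)) (`|z| / L) (x * e) (t * L * e) (lp_norm p x y) (t * L).
  clear -p1 pq p0 q1 q0 => BZ Z X E P T; lra.
have B4 : 0 <= 4 * B by rewrite mulr_ge0// ltW.
have ceta : c + eta <= m.
  rewrite /m /eta; move: ck Bt1 k1; clear -p1 pq p0 q1 q0; lra.
have eta3 : 3 * eta <= m.
  rewrite /m /eta; move: Bt1 k1 k0; clear -p1 pq p0 q1 q0; lra.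
have pq1 := conj_mul1 p1 pq.
have q10 : 0 <= q - 1 by rewrite subr_ge0 ltW.
have vq : ((y / x) `^ (p - 1)) `^ (q - 1) = y / x by rewrite -powRrM pq1 powRr1.
have [ce|ce] := ltP c (2 * eta); [left|right].
- split.
    rewrite -ler_pdivrMr// -vq.
    apply: (@le_trans _ _ ((4 * B * t) `^ (q - 1))).
      apply: ge0_ler_powR; rewrite ?nnegrE ?powR_ge0 ?mulr_ge0 ?(ltW t0) ?(ltW B0)//.
      by rewrite -mulrA; move: vc ce; rewrite /eta; move: (B * t); clear -p1 pq p0 q1 q0 => Bt; lra.
    rewrite (powRM _ B4 (ltW t0)) ler_wpM2r ?powR_ge0// /C.
    by move: Ca Cb Cc; clear -p1 pq p0 q1 q0; lra.
  apply: le_trans (Lz (C1 * eta `^ q) _ _) _.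
  + by rewrite mulr_ge0 ?powR_ge0 ?(ltW C10).
  + by move=> s sx; have [_] := HC1 c eta (w * s) c0 eta0 (seta s sx); apply.
  have -> : t `^ (q + 1) = t * t `^ q by rewrite -(mulr_powRB1 (ltW t0) (addr_gt0 q0 ltr01)) addrK.
  rewrite /eta (powRM _ (ltW B0) (ltW t0)).
  have -> : L ^+ 2 * t * (C1 * (B `^ q * t `^ q)) = (C1 * B `^ q) * (L ^+ 2 * (t * t `^ q)) by ring.
  have -> : C * L ^+ 2 * (t * t `^ q) = C * (L ^+ 2 * (t * t `^ q)) by ring.
  rewrite ler_wpM2r ?mulr_ge0 ?powR_ge0 ?sqr_ge0 ?(ltW t0) ?(ltW L0)// /C.
  by move: Ca Cb Cc; clear -p1 pq p0 q1 q0; lra.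
- split.
    rewrite -ler_pdivlMr// -vq; apply: ge0_ler_powR; rewrite ?nnegrE ?powR_ge0 ?(ltW t0)//.
    have tB : t <= B * t by rewrite ler_peMl// ltW.
    by move: cv ce t0 tB; rewrite /eta; move: (B * t); clear -p1 pq p0 q1 q0 => Bt; lra.
  have cp : 0 < c by rewrite (lt_le_trans _ ce)// mulr_gt0.
  apply: le_trans (Lz (C1 * c `^ (q - 2) * eta ^+ 2) _ _) _.
  + exact: (mulr_ge0 (mulr_ge0 (ltW C10) (powR_ge0 _ _)) (exprn_ge0 2 (ltW eta0))).
  + by move=> s sx; have [H _] := HC1 c eta (w * s) c0 eta0 (seta s sx); exact: H.
  have cc : c `^ (q - 2) <= 2 `^ `|q - 2| * (y / x) `^ (2 - p).
    have -> : (y / x) `^ (2 - p) = ((y / x) `^ (p - 1)) `^ (q - 2).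
      rewrite -powRrM; congr (_ `^ _); move: pq1; clear -p1 pq p0 q1 q0; lra.
    have c2 : 0 < (y / x) `^ (p - 1) by exact: lt_le_trans cv.
    apply: powR_comparable => //; move: cv vc c2 cp.
      by move: (_ `^ _) => V; clear -p1 pq p0 q1 q0; lra.
    by move: (_ `^ _) => V; clear -p1 pq p0 q1 q0; lra.
  rewrite /eta.
  have -> : L ^+ 2 * t * (C1 * c `^ (q - 2) * (B * t) ^+ 2) =
    (C1 * B ^+ 2 * c `^ (q - 2)) * (L ^+ 2 * t ^+ 3) by ring.
  have -> : C * L ^+ 2 * t ^+ 3 * (y / x) `^ (2 - p) = C * (y / x) `^ (2 - p) * (L ^+ 2 * t ^+ 3) by ring.
  rewrite ler_wpM2r ?mulr_ge0 ?sqr_ge0 ?exprn_ge0 ?(ltW t0) ?(ltW L0)//.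
  apply: (@le_trans _ _ (C1 * B ^+ 2 * 2 `^ `|q - 2| * (y / x) `^ (2 - p))).
    by rewrite -[leRHS]mulrA ler_wpM2l// mulr_ge0 ?sqr_ge0// ltW.
  rewrite ler_wpM2r ?powR_ge0// /C.
  by move: Ca Cb Cc; clear -p1 pq p0 q1 q0; lra.
Qed.

End HeightEstimate.

(** * Intermediate sets from the origin *)

Section Boxes.
Context {R : realType}.
Local Notation mu := (@lebesgue_measure R).
Local Notation heis := (R * R * R)%type.

Definition box (a b c : R) : set (measurableTypeR R * measurableTypeR R * measurableTypeR R) :=
  (`[- a, a]%classic `*` `[- b, b]%classic) `*` `[- c, c]%classic.

Lemma measurable_box a b c : measurable (box a b c).
Proof. by apply: measurableX; [apply: measurableX|]. Qed.

Lemma boxP a b c (g : heis) :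
  `|g.1.1| <= a -> `|g.1.2| <= b -> `|g.2| <= c -> box a b c g.
Proof. by rewrite !ler_norml => h1 h2 h3; split; [split|]; rewrite /= in_itv/=. Qed.

Lemma lebesgue_measure_itvcc (a b : R) : a <= b -> mu `[a, b]%classic = (b - a)%:E.
Proof.
move=> ab; rewrite [LHS]lebesgue_measure_itv/= lte_fin.
by case: ltP => // ba; rewrite (@le_anti _ _ a b) ?ab ?ba// subrr.
Qed.

Let mu_itv (a : R) : 0 <= a -> mu `[- a, a]%classic = (2 * a)%:E.
Proof.
move=> a0; rewrite lebesgue_measure_itvcc ?ge0_cp//.
by congr EFin; ring.
Qed.

Lemma lebesgue3_setX (A B C : set (measurableTypeR R)) :
  measurable A -> measurable B -> measurable C ->
  @lebesgue3 R ((A `*` B) `*` C) = (mu A * mu B * mu C)%E.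
Proof.
move=> mA mB mC; apply: etrans.
  by apply: product_measure1E => //; exact: measurableX.
by congr (_ * _)%E; exact: product_measure1E.
Qed.

Lemma lebesgue3_box a b c : 0 <= a -> 0 <= b -> 0 <= c ->
  @lebesgue3 R (box a b c) = (8 * a * b * c)%:E.
Proof.
move=> a0 b0 c0; rewrite lebesgue3_setX// !mu_itv// -!EFinM.
by congr EFin; ring.
Qed.

Lemma measure_bigsetU_le (F : nat -> set (measurableTypeR R * measurableTypeR R * measurableTypeR R))
  (v : R) n : (forall i, measurable (F i)) ->
  (forall i, (i < n)%N -> (@lebesgue3 R (F i) <= v%:E)%E) ->
  (@lebesgue3 R (\big[setU/set0]_(i < n) F i) <= (n%:R * v)%:E)%E.
Proof.
move=> mF; elim: n => [|n IH] Fv; first by rewrite big_ord0 measure0 mul0r.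
rewrite big_ord_recr/= -natr1 mulrDl mul1r EFinD.
apply: (le_trans (measureU2 _ _ _)) => //; first exact: bigsetU_measurable.
by apply: leeD; [apply: IH => i ni; apply: Fv; exact: ltnW|exact: Fv].
Qed.

Lemma mu_ext_le_cover (S : set (measurableTypeR R * measurableTypeR R * measurableTypeR R))
  (F : nat -> set (measurableTypeR R * measurableTypeR R * measurableTypeR R)) (v : R) n :
  (forall i, measurable (F i)) ->
  (forall i, (i < n)%N -> (@lebesgue3 R (F i) <= v%:E)%E) ->
  (forall g, S g -> exists2 i, (i < n)%N & F i g) ->
  (((@lebesgue3 R)^*)%mu S <= (n%:R * v)%:E)%E.
Proof.
move=> mF Fv SF; apply: (le_trans _ (measure_bigsetU_le mF Fv)).
rewrite -measurable_mu_extE; last exact: bigsetU_measurable.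
apply: le_mu_ext => g /SF[i ni Fi].
by rewrite -bigcup_mkord; exists i.
Qed.

End Boxes.

(** * Reduction to a quadrant, and slabs *)

Section Symmetries.
Context {R : realType}.
Variable p : R.
Hypothesis p1 : 1 < p.
Local Notation N := (heis_norm p).

Lemma heis_norm_reflectE (x y z : R) : N (- x, y, - z) = N (x, y, z).
Proof.
apply/eqP; rewrite eq_le (heis_norm_reflect p1 (x, y, z))/=.
by have := heis_norm_reflect p1 (- x, y, - z); rewrite /= !opprK.
Qed.

Lemma heis_norm_swapE (x y z : R) : N (y, x, - z) = N (x, y, z).
Proof.
apply/eqP; rewrite eq_le (heis_norm_swap p1 (x, y, z))/=.
by have := heis_norm_swap p1 (y, x, - z); rewrite /= !opprK.
Qed.

(** A reflection reverses the sign of the height too, so only |z| is kept; all later bounds are on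
    |z|. *)
Lemma heis_norm_quadrant (x y z : R) : exists2 z', `|z'| = `|z| &
  N (`|x|, `|y|, z') = N (x, y, z).
Proof.
have H (u v w : R) : exists2 w', `|w'| = `|w| & N (`|u|, v, w') = N (u, v, w).
  have [u0|u0] := leP 0 u; first by exists w => //; rewrite ger0_norm.
  exists (- w); first by rewrite normrN.
  by rewrite ltr0_norm// heis_norm_reflectE.
have [z1 h1 E1] := H x y z; have [z2 h2 E2] := H y `|x| (- z1).
exists (- z2); first by rewrite normrN h2 normrN.
by rewrite heis_norm_swapE E2 heis_norm_swapE.
Qed.

Lemma exponent_le_of_slab (v t e : R) (n : nat) : 0 < t -> 0 < e -> t < 1 ->
  0 < v -> v <= 1 -> t `^ (n%:R * e) <= v ->
  exists2 i : nat, (i < n.+1)%N & v <= t `^ (i%:R * e) /\ t `^ (i.+1%:R * e) <= v.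
Proof.
move=> t0 e0 t1 v0 v1; elim: n => [|n IH] h.
  exists 0%N => //; rewrite mul0r powRr0 in h *; split => //.
  rewrite mul1r (le_trans _ h)//.
  have := @ger_powR _ t _ 0 e (ltW e0); rewrite powRr0; apply.
  by rewrite t0 ltW.
have [h'|h'] := leP (t `^ (n%:R * e)) v.
  by have [i ni Hi] := IH h'; exists i => //; exact: ltnW.
by exists n => //; split => //; exact: ltW.
Qed.

End Symmetries.

(** * Position of a geodesic at time t *)

Section IntermediateBound.
Context {R : realType}.
Local Notation heis := (R * R * R)%type.
Local Notation heis0 := (0 : R, 0 : R, 0 : R).
Variables p q : R.
Hypotheses (p1 : 1 < p) (pq : p^-1 + q^-1 = 1).
Local Notation N := (heis_norm p).

Let p0 : 0 < p. Proof. exact: lt_trans p1. Qed.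
Let q1 : 1 < q. Proof. exact: conj_gt1 p1 pq. Qed.
Let q0 : 0 < q. Proof. exact: lt_trans q1. Qed.

(** Keeps the numeral 256 opaque; only 1 <= B matters. *)
Let geodesic_excess_ex : exists2 B : R, 1 <= B & forall (gam : R -> heis) (t : R),
  constant_speed_geodesic (heis_dist p) gam -> gam 0 = heis0 ->
  0 < t -> t <= 32^-1 -> 0 < N (gam 1) ->
  N (gam t) = t * N (gam 1) /\
  t * N (gam 1) - lp_norm p (gam t).1.1 (gam t).1.2 <= B * `|(gam t).2| / N (gam 1).
Proof. by exists 256; [rewrite ler1n|exact: geodesic_excess]. Qed.

(** [height_bound] with the length [L] replaced by its bound [r], and with the excluded case x = 0
    settled. The ratio y/x becomes [v]. *)
Let box_case (B C t0 r : R) : 0 < B -> 0 < C -> 0 < r ->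
  (forall t L x y z, 0 < t -> t < t0 -> 0 < L -> 0 <= y -> y <= x -> 0 < x ->
    N (x, y, z) = t * L -> t * L - lp_norm p x y <= B * `|z| / L ->
    (y <= C * t `^ (q - 1) * x /\ `|z| <= C * L ^+ 2 * t `^ (q + 1)) \/
    (t `^ (q - 1) * x <= y /\ `|z| <= C * L ^+ 2 * t ^+ 3 * (y / x) `^ (2 - p))) ->
  forall t L a b z, 0 < t -> t < t0 -> t < (2 * B)^-1 -> 0 < L -> L <= r ->
  0 <= b -> b <= a -> N (a, b, z) = t * L -> t * L - lp_norm p a b <= B * `|z| / L ->
  a <= r * t /\
  ((b <= (C * r + C * r ^+ 2) * t `^ q /\ `|z| <= (C * r + C * r ^+ 2) * t `^ (q + 1)) \/
  (exists v, [/\ 0 < v, v <= 1, t `^ (q - 1) <= v, b <= r * t * v &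
        `|z| <= (C * r + C * r ^+ 2) * t ^+ 3 * v `^ (2 - p)])).
Proof.
move=> B0 C0 r0 HC t L a b z tp tt0 tB L0 Nr.
set C' := C * r + C * r ^+ 2.
have Cr : 0 < C * r by rewrite mulr_gt0.
have Cr2 : 0 < C * r ^+ 2 by rewrite mulr_gt0// exprn_gt0.
have C'0 : 0 < C' by rewrite addr_gt0.
have qt := powR_ge0 t q; have qt1 := powR_ge0 t (q + 1).
move=> b0 ba Nab exab.
have a0 : 0 <= a by exact: le_trans ba.
have aN : a <= t * L.
  by rewrite -Nab -{1}(ger0_norm a0); exact: (norm_fst_le p1 (a, b, z)).
have ar : a <= r * t.
  by apply: (le_trans aN); rewrite [r * t]mulrC; exact: ler_wpM2l (ltW tp) _ _ Nr.
split => //.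
have rt0 : 0 < r * t by rewrite mulr_gt0.
have [a0'|ap] := leP a 0.
  have aE : a = 0 by apply/le_anti; rewrite a0' a0.
  have bE : b = 0 by apply/le_anti; rewrite b0 -[X in _ <= X]aE ba.
  (* Above the origin the excess is the whole of t L, while |z| <= t^2 L^2 and B t < 1/2 bound it by
     t L/2. *)
  exfalso.
  have lp0 : lp_norm p 0 0 <= 0.
    by rewrite (le_trans (lp_norm_le _ _ (ltW p1)))// normr0 addr0.
  rewrite aE bE in exab.
  have zN : `|z| <= t ^+ 2 * L ^+ 2.
    by rewrite -exprMn -Nab; exact: (norm_height_le p1 (a, b, z)).
  have tL0 : 0 < t * L by rewrite mulr_gt0.
  have h1 : B * `|z| / L <= B * t * (t * L).
    rewrite ler_pdivrMr//.
    have -> : B * t * (t * L) * L = B * (t ^+ 2 * L ^+ 2) by ring.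
    by rewrite ler_wpM2l// ltW.
  have Bt : B * t < 2^-1.
    have B20 : 0 < 2 * B by rewrite mulr_gt0.
    move: tB; rewrite -[_^-1]div1r ltr_pdivlMr// => h.
    by move: h; clear -p1 pq p0 q1 q0; lra.
  have h2 : B * t * (t * L) <= 2^-1 * (t * L) by rewrite ler_wpM2r// ltW.
  move: exab lp0 h1 h2 tL0; move: (lp_norm _ _ _) (B * `|z| / L) (t * L) (B * t * _).
  by clear -p1 pq p0 q1 q0 => A D E F; lra.
have := HC t L a b z tp tt0 L0 b0 ba ap Nab exab.
have LL : L ^+ 2 <= r ^+ 2 by rewrite ler_sqr ?nnegrE ?(ltW L0) ?(ltW r0).
have C'2 : C * r ^+ 2 <= C' by rewrite /C' lerDr ltW.
have C'1 : C * r <= C' by rewrite /C' lerDl ltW.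
have CL : C * L ^+ 2 <= C' by rewrite (le_trans _ C'2)// ler_wpM2l// ltW.
move=> [[hb hz]|[hb hz]]; [left|right].
  split; last by rewrite (le_trans hz)// ler_wpM2r.
  apply: (le_trans hb).
  have tq : t `^ q = t `^ (q - 1) * t by rewrite mulrC mulr_powRB1// ltW.
  have -> : C' * t `^ q = t `^ (q - 1) * (C' * t) by rewrite tq; ring.
  have -> : C * t `^ (q - 1) * a = t `^ (q - 1) * (C * a) by ring.
  rewrite ler_wpM2l ?powR_ge0//.
  apply: (@le_trans _ _ (C * r * t)).
    by rewrite -mulrA ler_wpM2l// ltW.
  by rewrite ler_wpM2r// ltW.
have tq0 : 0 < t `^ (q - 1) by rewrite powR_gt0.
have bp : 0 < b by rewrite (lt_le_trans _ hb)// mulr_gt0.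
exists (b / a); split.
+ by rewrite divr_gt0.
+ by rewrite ler_pdivrMr// mul1r.
+ by rewrite ler_pdivlMr.
+ by rewrite mulrCA ler_peMr ?(ltW bp)// ler_pdivlMr// mul1r.
+ apply: (le_trans hz); apply: ler_wpM2r; first exact: powR_ge0.
  by apply: ler_wpM2r CL; exact: exprn_ge0 (ltW tp).
Qed.

Lemma intermediate_bound (r : R) : 0 < r -> exists C t0 : R,
  [/\ 0 < C, 0 < t0, t0 < 1 &
  forall (gam : R -> heis) (t : R), 0 < t -> t < t0 ->
   constant_speed_geodesic (heis_dist p) gam -> gam 0 = heis0 -> N (gam 1) <= r ->
   exists a b : R, [/\ (a = `|(gam t).1.1| /\ b = `|(gam t).1.2|) \/
       (a = `|(gam t).1.2| /\ b = `|(gam t).1.1|), a <= r * t &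
     (b <= C * t `^ q /\ `|(gam t).2| <= C * t `^ (q + 1)) \/
     (exists v, [/\ 0 < v, v <= 1, t `^ (q - 1) <= v, b <= r * t * v &
        `|(gam t).2| <= C * t ^+ 3 * v `^ (2 - p)])]].
Proof.
move=> r0; have [B B1 HB] := geodesic_excess_ex.
have [C [t0 [C0 t00 HC]]] := height_bound p1 pq B1.
have B0 : 0 < B by exact: lt_le_trans B1.
pose C' := C * r + C * r ^+ 2.
have Cr : 0 < C * r by rewrite mulr_gt0.
have Cr2 : 0 < C * r ^+ 2 by rewrite mulr_gt0// exprn_gt0.
have C'0 : 0 < C' by rewrite addr_gt0.
have B20 : 0 < (2 * B)^-1 by rewrite invr_gt0 mulr_gt0.
have i32 : 0 < 32^-1 :> R by rewrite invr_gt0.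
have i321 : 32^-1 < 1 :> R by rewrite invf_lt1// ltr1n.
exists C', (Num.min t0 (Num.min 32^-1 (2 * B)^-1)); split => //.
- by rewrite !lt_min t00 i32.
- by rewrite !gt_min i321 orbT.
move=> gam t tp; rewrite !lt_min => /andP[tt0 /andP[t32 tB]] geo g0 Nr.
have qt := powR_ge0 t q; have qt1 := powR_ge0 t (q + 1).
(* A geodesic of length 0 stays at the origin. *)
have [L0|L0] := leP (N (gam 1)) 0.
  have NL : N (gam 1) = 0 by apply/le_anti; rewrite L0 heis_norm_ge0.
  have NP : N (gam t) = 0.
    have := geo 0 t; rewrite g0 lexx ler01 (ltW tp) (ltW (lt_trans t32 i321)) => /(_ isT isT).
    by rewrite !heis_normE// NL mule0 => -[].
  have h1 := norm_fst_le p1 (gam t); have h2 := norm_snd_le p1 (gam t).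
  have h3 := norm_height_le p1 (gam t).
  rewrite NP expr0n/= in h1 h2 h3.
  exists `|(gam t).1.1|, `|(gam t).1.2|; split; [by left| |left; split].
  + by rewrite (le_trans h1)// mulr_ge0 ?(ltW r0) ?(ltW tp).
  + by rewrite (le_trans h2)// mulr_ge0 ?(ltW C'0).
  + by rewrite (le_trans h3)// mulr_ge0 ?(ltW C'0).
have [NP exc] := HB gam t geo g0 tp (ltW t32) L0.
set L := N (gam 1) in L0 Nr NP exc.
case: (gam t) NP exc => -[x y] z /= NP exc.
have [z' zz' NP'] := heis_norm_quadrant p1 x y z.
have lpE : lp_norm p x y = lp_norm p `|x| `|y| by rewrite /lp_norm !normr_id.
have main a b z2 : `|z2| = `|z| -> 0 <= b -> b <= a -> N (a, b, z2) = t * L ->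
    t * L - lp_norm p a b <= B * `|z| / L ->
    a <= r * t /\ ((b <= C' * t `^ q /\ `|z| <= C' * t `^ (q + 1)) \/
     (exists v, [/\ 0 < v, v <= 1, t `^ (q - 1) <= v, b <= r * t * v &
        `|z| <= C' * t ^+ 3 * v `^ (2 - p)])).
  by move=> <-; exact: (box_case B0 C0 r0 HC tp tt0 tB L0 Nr).
have [xy|yx] := leP `|y| `|x|.
  have [|h1 h2] := main `|x| `|y| z' zz' (normr_ge0 y) xy (etrans NP' NP).
    by rewrite -lpE.
  exact: (ex_intro _ `|x| (ex_intro _ `|y| (And3 (or_introl (conj erefl erefl)) h1 h2))).
have NP2 : N (`|y|, `|x|, - z') = t * L.
  exact: (etrans (heis_norm_swapE p1 _ _ _) (etrans NP' NP)).
have nz : `|- z'| = `|z| by rewrite normrN.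
have [|h1 h2] := main `|y| `|x| (- z') nz (normr_ge0 x) (ltW yx) NP2.
  by rewrite lp_normC -lpE.
exact: (ex_intro _ `|y| (ex_intro _ `|x| (And3 (or_intror (conj erefl erefl)) h1 h2))).
Qed.

End IntermediateBound.

(** * Volume of the covering and lower bound of the dimension *)

Section UpperVolume.
Context {R : realType}.
Local Notation heis := (R * R * R)%type.
Local Notation heis0 := (0 : R, 0 : R, 0 : R).
Variables p q : R.
Hypotheses (p1 : 1 < p) (pq : p^-1 + q^-1 = 1).
Local Notation N := (heis_norm p).

Let p0 : 0 < p. Proof. exact: lt_trans p1. Qed.
Let q1 : 1 < q. Proof. exact: conj_gt1 p1 pq. Qed.
Let q0 : 0 < q. Proof. exact: lt_trans q1. Qed.

Lemma powRD_gt0 (t a b : R) : 0 < t -> t `^ (a + b) = t `^ a * t `^ b.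
Proof. by move=> t0; rewrite powRD// (gt_eqF t0) implybT. Qed.

Lemma le_powR_exponent (t a b : R) : 0 < t -> t < 1 -> a <= b -> t `^ b <= t `^ a.
Proof. by move=> t0 t1; apply: ger_powR; rewrite t0 ltW. Qed.

(** For s >= 0 the upper end of the slab is used; for s < 0 the lower end, which costs the factor
    t^(- e |s|). *)
Lemma powR_slab_le (t a e v s : R) : 0 < t -> t < 1 -> 0 <= e -> 0 < v ->
  t `^ (a + e) <= v -> v <= t `^ a -> v `^ s <= t `^ (a * s - e * `|s|).
Proof.
move=> t0 t1 e0 v0 h1 h2; have [s0|s0] := leP 0 s.
  apply: (@le_trans _ _ ((t `^ a) `^ s)).
    by apply: ge0_ler_powR; rewrite ?nnegrE ?powR_ge0// ltW.
  rewrite -powRrM; apply: le_powR_exponent => //.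
  by rewrite gerBl mulr_ge0.
have -> : s = - `|s| by rewrite ltr0_norm ?opprK.
set S := `|s|; have S0 : 0 <= S by exact: normr_ge0.
rewrite normrN (ger0_norm S0) powRN.
have -> : a * - S - e * S = - ((a + e) * S) by ring.
rewrite powRN lef_pV2 ?posrE ?powR_gt0// powRrM.
by apply: ge0_ler_powR; rewrite ?nnegrE ?powR_ge0// ltW.
Qed.

Let volume_tube (r C t : R) : 0 < r -> 0 < C -> 0 < t ->
  8 * (r * t) * (C * t `^ q) * (C * t `^ (q + 1)) = 8 * r * C ^+ 2 * t `^ (2 * q + 2).
Proof.
move=> r0 C0 t0.
have -> : 2 * q + 2 = 1 + (q + (q + 1)) by ring.
rewrite (powRD_gt0 1 _ t0) (powRD_gt0 q (q + 1) t0) (powRr1 (ltW t0)).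
by move: (t `^ q) (t `^ (q + 1)) => x y; ring.
Qed.

Let volume_slab (r C t a b : R) : 0 < r -> 0 < C -> 0 < t ->
  8 * (r * t) * (r * t * t `^ a) * (C * t ^+ 3 * t `^ b) =
  8 * r ^+ 2 * C * t `^ (5%:R + a + b).
Proof.
move=> r0 C0 t0.
rewrite (powRD_gt0 _ b t0) (powRD_gt0 _ a t0) (powR_mulrn 5 (ltW t0)).
by move: (t `^ a) (t `^ b) => x y; ring.
Qed.

Lemma intermediate_set_volume (r s : R) : 0 < r -> s < 5 -> s < 2 * q + 2 ->
  exists V t0 : R, [/\ 0 < V, 0 < t0, t0 < 1 &
  forall (A : set (measurableTypeR R * measurableTypeR R * measurableTypeR R)) (t : R),
    0 < t -> t < t0 -> (forall g, A g -> N g <= r) ->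
    (((@lebesgue3 R)^*)%mu (intermediate_set (heis_dist p) heis0 A t) <= (V * t `^ s)%:E)%E].
Proof.
move=> r0 s5 sq; have [C [t0 [C0 t00 t01 HC]]] := intermediate_bound p1 pq r0.
pose dl := Num.min (5 - s) (2 * q + 2 - s).
have dl0 : 0 < dl by rewrite lt_min !subr_gt0 s5.
have dl5 : dl <= 5 - s by rewrite ge_min lexx.
have dlq : dl <= 2 * q + 2 - s by rewrite ge_min lexx orbT.
have q10 : 0 < q - 1 by rewrite subr_gt0.
(* Enough slabs for the loss e |2 - p| to fit in the slack [dl]; the number does not depend on t. *)
pose n := (Num.truncn ((q - 1) * `|2 - p| / dl)).+1.
have nn : (q - 1) * `|2 - p| / dl <= n%:R by rewrite ltW// truncnS_gt.
have n0 : 0 < n%:R :> R by rewrite ltr0n.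
pose e := (q - 1) / n%:R.
have e0 : 0 < e by rewrite divr_gt0.
have ne : n%:R * e = q - 1 by rewrite /e mulrC divfK// gt_eqF.
have edl : e * `|2 - p| <= dl.
  have -> : e * `|2 - p| = (q - 1) * `|2 - p| / n%:R by rewrite /e mulrAC.
  by rewrite ler_pdivrMr// [dl * _]mulrC -ler_pdivrMr.
pose sz (t : R) (k : nat) : heis :=
  if k is i.+1 then (r * t, r * t * t `^ (i%:R * e),
                     C * t ^+ 3 * t `^ (i%:R * e * (2 - p) - e * `|2 - p|))
  else (r * t, C * t `^ q, C * t `^ (q + 1)).
pose V0 := 8 * r * C ^+ 2 + 8 * r ^+ 2 * C.
have Va : 0 < 8 * r * C ^+ 2 by rewrite !mulr_gt0// exprn_gt0.
have Vb : 0 < 8 * r ^+ 2 * C by rewrite !mulr_gt0// exprn_gt0.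
(* Index 0 is the tube y <= C t^q, index i.+1 the slab [i] with i < n.+1. The second [m] boxes are
   the same with x and y exchanged. *)
pose m := n.+2.
pose F (t : R) (j : nat) := if (j < m)%N then box (sz t j).1.1 (sz t j).1.2 (sz t j).2
  else box (sz t (j - m)%N).1.2 (sz t (j - m)%N).1.1 (sz t (j - m)%N).2.
have mF t j : measurable (F t j) by rewrite /F; case: ifP => _; exact: measurable_box.
have sz0 t k : 0 < t -> [/\ 0 <= (sz t k).1.1, 0 <= (sz t k).1.2 & 0 <= (sz t k).2].
  move=> tp; have rt : 0 <= r * t by rewrite ltW// mulr_gt0.
  have t3 : 0 <= C * t ^+ 3 by rewrite mulr_ge0 ?exprn_ge0// ltW.
  by case: k => [|k]; split => //=;
    [exact: mulr_ge0 (ltW C0) (powR_ge0 _ _)|exact: mulr_ge0 (ltW C0) (powR_ge0 _ _)|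
     exact: mulr_ge0 rt (powR_ge0 _ _)|exact: mulr_ge0 t3 (powR_ge0 _ _)].
have vol t k : 0 < t -> t < 1 -> (k < m)%N ->
    8 * (sz t k).1.1 * (sz t k).1.2 * (sz t k).2 <= V0 * t `^ s.
  move=> tp t1; case: k => [|k] km.
    rewrite [leLHS]volume_tube//.
    apply: (@le_trans _ _ (8 * r * C ^+ 2 * t `^ s)).
      apply: ler_wpM2l (ltW Va) _ _ _; apply: le_powR_exponent => //.
      by move: dlq dl0; clear -p1 pq p0 q1 q0; lra.
    by apply: ler_wpM2r; [exact: powR_ge0|rewrite lerDl ltW].
  rewrite [leLHS]volume_slab//.
  apply: (@le_trans _ _ (8 * r ^+ 2 * C * t `^ s)); last first.
    by apply: ler_wpM2r; [exact: powR_ge0|rewrite lerDr ltW].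
  apply: ler_wpM2l (ltW Vb) _ _ _; apply: le_powR_exponent => //.
  have a0 : 0 <= k%:R * e by rewrite mulr_ge0// ltW.
  have a1 : k%:R * e <= q - 1 by rewrite -ne ler_wpM2r ?(ltW e0)// ler_nat.
  have pq1 := conj_mul1 p1 pq.
  move: a0 a1 edl dl5 dlq; move: (k%:R * e) (e * _) => a E a0 a1 edl dl5 dlq.
  (* The exponent 5 + a (3 - p) is affine in a, and 0 <= a <= q-1: its least value is 5 at a = 0 if
     p <= 3, and 2q + 2 at a = q-1 if p >= 3. *)
  suff : dl + s <= 5 + a * (3 - p) by move: edl; clear -p1 pq p0 q1 q0; lra.
  have [p3|p3] := leP p 3.
    have : 0 <= a * (3 - p) by rewrite mulr_ge0// subr_ge0.
    by move: dl5; clear -p1 pq p0 q1 q0; lra.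
  have : (q - 1 - a) * (p - 3) >= 0 by rewrite mulr_ge0 ?subr_ge0// ltW.
  by move: dlq pq1; clear -p1 pq p0 q1 q0; lra.
have mm : 0 < (m + m)%:R :> R by rewrite ltr0n.
have V00 : 0 < V0 by rewrite addr_gt0.
exists ((m + m)%:R * V0), t0; split => //; first by rewrite mulr_gt0.
move=> A t tp tt0 Ar.
have t1 : t < 1 by exact: lt_trans t01.
rewrite -mulrA; apply: (@mu_ext_le_cover R _ (F t)) => //.
  move=> j jm; rewrite /F; case: ifPn => jm'.
    have [h1 h2 h3] := sz0 t j tp.
    by rewrite lebesgue3_box// lee_fin; exact: vol.
  have jmm : (j - m < m)%N by rewrite ltn_subLR// leqNgt.
  have [h1 h2 h3] := sz0 t (j - m)%N tp.
  by rewrite lebesgue3_box// lee_fin (mulrAC 8); exact: vol.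
move=> g [gam [geo gam0 Agam gamt]].
have [a [b [ab ar H]]] := HC gam t tp tt0 geo gam0 (Ar _ Agam).
rewrite gamt in ab H.
suff [k km [h1 h2 h3]] : exists2 k, (k < m)%N &
    [/\ a <= (sz t k).1.1, b <= (sz t k).1.2 & `|g.2| <= (sz t k).2].
  case: ab => -[aE bE].
    exists k; first by rewrite (leq_trans km)// leq_addr.
    by rewrite /F km; apply: boxP; rewrite -?aE -?bE.
  exists (k + m)%N; first by rewrite ltn_add2r.
  rewrite /F ltnNge leq_addl/= addnK.
  by apply: boxP; rewrite -?aE -?bE.
case: H => [[h1 h2]|[v [v0 v1 tv bv zv]]]; first by exists 0%N.
rewrite -ne in tv.
have [i ni [vi1 vi2]] := exponent_le_of_slab tp e0 t1 v0 v1 tv.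
exists i.+1 => //; split => //=.
  by apply: (le_trans bv); apply: ler_wpM2l vi1; rewrite ltW// mulr_gt0.
apply: (le_trans zv); apply: ler_wpM2l; first by rewrite mulr_ge0 ?exprn_ge0// ltW.
apply: powR_slab_le => //; first exact: ltW.
by rewrite -natr1 mulrDl mul1r in vi2.
Qed.

Lemma contraction_limsup_le0 (s : R) A : s < 5 -> s < 2 * q + 2 ->
  metric_bounded (heis_dist p) A -> (0 < @lebesgue3 R A < +oo)%E ->
  (contraction_limsup (@lebesgue3 R) (heis_dist p) s heis0 A <= 0)%E.
Proof.
move=> s5 sq [r Ar] /andP[mA0 mAoo].
have [mA mAE] : exists m : R, @lebesgue3 R A = m%:E.
  by exists (fine (@lebesgue3 R A)); rewrite fineK// ge0_fin_numE// ltW.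
have mp : 0 < mA by rewrite mAE lte_fin in mA0.
have [g0 Ag0] : A !=set0.
  by apply/set0P; apply: contraTN mA0 => /eqP->; rewrite measure0 ltxx.
pose r' := `|r| + N g0 + 1.
have r'0 : 0 < r' by rewrite ltr_wpDl// addr_ge0// (heis_norm_ge0 p1).
have Ar' g : A g -> N g <= r'.
  move=> Ag; have := Ar _ _ Ag0 Ag; rewrite heis_distE// lee_fin => h.
  have := heis_normM p1 g0 (heis_mul (heis_inv g0) g).
  rewrite heis_mulKg => h2.
  rewrite (le_trans h2)// /r'; move: h (ler_norm r); move: (N _) (N g0) => X Y.
  by clear -p1 pq p0 q1 q0; lra.
(* The volume bound at an exponent strictly above [s] leaves a factor t^(s' - s), which tends to
   0. *)
pose s' := (s + Num.min 5 (2 * q + 2)) / 2.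
have min0 : s < Num.min 5 (2 * q + 2) by rewrite lt_min s5.
have min5 : Num.min 5 (2 * q + 2) <= 5 by rewrite ge_min lexx.
have minq : Num.min 5 (2 * q + 2) <= 2 * q + 2 by rewrite ge_min lexx orbT.
have [ss' s'5 s'q] : [/\ s < s', s' < 5 & s' < 2 * q + 2].
  by rewrite /s'; move: min0 min5 minq s5 sq; move: (Num.min _ _) => M;
    clear -p1 pq p0 q1 q0; move=> *; split; lra.
have [V [t0 [V0 t00 t01 HV]]] := intermediate_set_volume r'0 s'5 s'q.
apply/lee_addgt0Pr => e e0; rewrite add0e.
pose d := s' - s; have d0 : 0 < d by rewrite subr_gt0.
pose t1 := Num.min t0 ((e * mA / V) `^ d^-1).
have E0 : 0 < e * mA / V by rewrite divr_gt0// mulr_gt0.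
have t10 : 0 < t1 by rewrite lt_min t00 powR_gt0.
apply: (@le_trans _ _ (ereal_sup ((fun t : R => ((t `^ s)^-1%:E *
    (((@lebesgue3 R)^*)%mu (intermediate_set (heis_dist p) heis0 A t) / @lebesgue3 R A))%E)
    @` `]0, t1[%classic))).
  apply: ereal_inf_lbound; exists `]0, t1[%classic => //.
  apply: filterS2 (@nbhs_right_gt R 0) (@nbhs_right_lt R 0 t1 t10) => y yp yt.
  by rewrite /= in_itv/= yp.
apply: ge_ereal_sup => _ [t /= +] <-; rewrite in_itv/= => /andP[tp].
rewrite lt_min => /andP[tt0 tt1].
have ts : 0 < t `^ s by rewrite powR_gt0.
rewrite mAE inver gt_eqF//.
apply: (@le_trans _ _ ((t `^ s)^-1%:E * ((V * t `^ s')%:E * (mA^-1)%:E))%E).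
  apply: lee_wpmul2l; first by rewrite lee_fin invr_ge0 ltW.
  apply: lee_wpmul2r; first by rewrite lee_fin invr_ge0 ltW.
  exact: HV.
rewrite -!EFinM lee_fin.
have -> : s' = s + d by rewrite /d; ring.
rewrite powRD_gt0//.
have -> : (t `^ s)^-1 * (V * (t `^ s * t `^ d) / mA) = V / mA * t `^ d.
  by move: ts; move: (t `^ s) (t `^ d) => x y x0; field; rewrite !gt_eqF.
have td : t `^ d <= e * mA / V.
  have -> : e * mA / V = ((e * mA / V) `^ d^-1) `^ d.
    by rewrite -powRrM mulVf ?gt_eqF// powRr1// ltW.
  by apply: ge0_ler_powR; rewrite ?nnegrE ?powR_ge0// ltW.
apply: (@le_trans _ _ (V / mA * (e * mA / V))).
  by apply: ler_wpM2l td; rewrite divr_ge0// ltW.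
by rewrite le_eqVlt; apply/orP; left; apply/eqP; field; rewrite !gt_eqF.
Qed.

Lemma geodesic_dim_at0_ge (s : R) : s <= 5 -> s <= 2 * q + 2 ->
  (s%:E <= geodesic_dim_at (@lebesgue3 R) (heis_dist p) heis0)%E.
Proof.
move=> s5 sq; apply: le_ereal_inf_tmp => _ [s' [s'0 Hs'] <-]; rewrite lee_fin leNgt.
apply/negP => s's.
have : (contraction_const (@lebesgue3 R) (heis_dist p) s' heis0 <= 0)%E.
  apply: ge_ereal_sup => _ [A [_ Ab mA] <-].
  by apply: contraction_limsup_le0 => //; exact: lt_le_trans s's _.
by rewrite Hs'.
Qed.

End UpperVolume.

(** * Extremals *)

(* Increasing continuous function on the whole line that coincides with
   [dual_slope] where [`|h| <= 3 / 4]. *)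
HB.lock Definition slope_ext {R : realType} (p q h : R) : R :=
  (Num.max 0 h `^ (q - 1) - Num.max 0 (- h) `^ (q - 1)) /
  Num.max 0 (Num.max (1 - (3 / 4) `^ q) (1 - `|h| `^ q)) `^ p^-1.

(** * The extended slope: continuity, monotonicity, lower slopes *)

Section SlopeExt.
Context {R : realType}.
Variables p q : R.
Hypotheses (p1 : 1 < p) (pq : p^-1 + q^-1 = 1).
Implicit Types (a b h s : R).
Local Notation psi := (slope_ext p q).

Let p0 : 0 < p. Proof. exact: lt_trans p1. Qed.
Let q1 : 1 < q. Proof. exact: conj_gt1 p1 pq. Qed.
Let q0 : 0 < q. Proof. exact: lt_trans q1. Qed.
Let q10 : 0 < q - 1. Proof. by rewrite subr_gt0. Qed.

Let m34 : 0 < 3 / 4 :> R. Proof. by rewrite divr_gt0. Qed.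
Let m34' : 3 / 4 < 1 :> R. Proof. by rewrite ltr_pdivrMr// mul1r ltr_nat. Qed.

Let delta := 1 - (3 / 4 : R) `^ q.

Let delta_ge : 1 / 4 <= delta.
Proof.
have h : (3 / 4 : R) `^ q <= (3 / 4) `^ 1 by apply: le_powR_exponent => //; exact: ltW.
rewrite /delta; move: h; rewrite powRr1 ?(ltW m34)//.
by move: (_ `^ _) => X; lra.
Qed.

Let delta_gt0 : 0 < delta.
Proof. by apply: lt_le_trans delta_ge; rewrite divr_gt0. Qed.

Let D h := Num.max 0 (Num.max delta (1 - `|h| `^ q)) `^ p^-1.

Let ip0 : 0 < p^-1. Proof. by rewrite invr_gt0. Qed.

Let maxdelta h : delta <= Num.max delta (1 - `|h| `^ q).
Proof. by rewrite le_max lexx. Qed.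

Let DE h : D h = Num.max delta (1 - `|h| `^ q) `^ p^-1.
Proof. by rewrite /D max_r// (le_trans (ltW delta_gt0))// maxdelta. Qed.

Let D_gt0 h : 0 < D h.
Proof. by rewrite DE powR_gt0// (lt_le_trans delta_gt0)// maxdelta. Qed.

Let D_le1 h : D h <= 1.
Proof.
rewrite DE; have m0 : 0 <= Num.max delta (1 - `|h| `^ q).
  by rewrite (le_trans (ltW delta_gt0))// maxdelta.
have := @ge0_ler_powR _ p^-1 (ltW ip0) (Num.max delta (1 - `|h| `^ q)) 1.
rewrite powR1; apply; rewrite ?nnegrE// ge_max; apply/andP; split.
  by rewrite /delta gerBl powR_ge0.
by rewrite gerBl powR_ge0.
Qed.

Let D_anti a b : 0 <= a -> a <= b -> D b <= D a.
Proof.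
move=> a0 ab; have b0 : 0 <= b := le_trans a0 ab.
have ma0 := le_trans (ltW delta_gt0) (maxdelta a).
have mb0 := le_trans (ltW delta_gt0) (maxdelta b).
rewrite !DE; apply: ge0_ler_powR; rewrite ?nnegrE//; first exact: ltW.
rewrite ge_max maxdelta/= le_max; apply/orP; right.
rewrite !ger0_norm// lerB//; apply: ge0_ler_powR => //; exact: ltW.
Qed.

Let iD_le a b : 0 <= a -> a <= b -> (D a)^-1 <= (D b)^-1.
Proof.
move=> a0 ab; have := D_anti a0 ab; move: (D_gt0 a) (D_gt0 b).
by move: (D a) (D b) => x y x0 y0 yx; rewrite lef_pV2.
Qed.

Let psiE h : psi h = (Num.max 0 h `^ (q - 1) - Num.max 0 (- h) `^ (q - 1)) / D h.
Proof. by rewrite slope_ext.unlock. Qed.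

Let psi_ge0E h : 0 <= h -> psi h = h `^ (q - 1) / D h.
Proof.
move=> h0; rewrite psiE (max_r h0) max_l ?oppr_le0//.
by rewrite powR0 ?gt_eqF// subr0.
Qed.

Lemma continuous_slope_ext : continuous psi.
Proof.
move=> x.
have -> : psi = (fun h => (Num.max 0 h `^ (q - 1) - Num.max 0 (- h) `^ (q - 1)) * (D h)^-1).
  by apply/funext => h; rewrite psiE.
apply: cvgM; last first.
  apply: cvgV; first by rewrite gt_eqF// D_gt0.
  apply: (@continuous_comp _ _ _ (fun h : R => Num.max delta (1 - `|h| `^ q))
    (fun y : R => Num.max 0 y `^ p^-1)); last exact: continuous_max_powR.
  apply: (@continuous_max _ R (fun _ => delta) (fun h => 1 - `|h| `^ q)).
    exact: cvg_cst.
  by apply: cvgB; [exact: cvg_cst|exact: continuous_norm_powR].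
apply: cvgB; first exact: continuous_max_powR.
apply: (@continuous_comp _ _ _ (fun h : R => - h) (fun y : R => Num.max 0 y `^ (q - 1))).
  exact: oppr_continuous.
exact: continuous_max_powR.
Qed.

Lemma slope_extN h : psi (- h) = - psi h.
Proof. by rewrite !psiE opprK -mulNr opprB /D normrN. Qed.

Lemma slope_ext0 : psi 0 = 0.
Proof. by rewrite psi_ge0E// powR0 ?gt_eqF// mul0r. Qed.

Lemma slope_ext_ge h : 0 <= h -> h `^ (q - 1) <= psi h.
Proof. by move=> h0; rewrite psi_ge0E// ler_peMr ?powR_ge0// invf_ge1. Qed.

Lemma slope_ext_lt a b : a < b -> psi a < psi b.
Proof.
have H s t : 0 <= s -> s < t -> psi s < psi t.
  move=> s0 st; have t0 : 0 < t := le_lt_trans s0 st.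
  rewrite (psi_ge0E s0) (psi_ge0E (ltW t0)).
  apply: (@lt_le_trans _ _ (t `^ (q - 1) / D s)).
    rewrite ltr_pM2r ?invr_gt0; last exact: D_gt0.
    by apply: gt0_ltr_powR; rewrite ?nnegrE// ltW.
  exact: ler_wpM2l (powR_ge0 _ _) _ _ (iD_le s0 (ltW st)).
move=> ab; have [a0|a0] := leP 0 a; first exact: H.
have [b0|b0] := leP b 0.
  by rewrite -ltrN2 -!slope_extN; apply: H; rewrite ?oppr_ge0// ltrN2.
have := H 0 _ (lexx 0) b0; rewrite slope_ext0 => b1.
have := H 0 (- a) (lexx 0); rewrite oppr_gt0 slope_ext0 slope_extN oppr_gt0 => /(_ a0) a1.
exact: lt_trans a1 b1.
Qed.

Let norm_powR_le h : `|h| <= 3 / 4 -> `|h| `^ q <= (3 / 4) `^ q.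
Proof. by move=> h34; apply: ge0_ler_powR; rewrite ?nnegrE ?(ltW q0) ?(ltW m34). Qed.

Lemma slope_extE h : `|h| <= 3 / 4 -> psi h = dual_slope p q h.
Proof.
have H s : 0 <= s -> `|s| <= 3 / 4 -> psi s = dual_slope p q s.
  move=> s0 sm; rewrite psi_ge0E//; have [->|sn] := eqVneq s 0.
    by rewrite dual_slope0 powR0 ?gt_eqF// mul0r.
  have sp : 0 < s by rewrite lt_neqAle eq_sym sn.
  rewrite (dual_slopeE _ _ sp) DE powRN max_r ?ger0_norm//.
  by rewrite lerB//; have := norm_powR_le sm; rewrite ger0_norm.
have [h0|h0] := leP 0 h; first exact: H.
move=> hm; have := H (- h); rewrite normrN oppr_ge0 => /(_ (ltW h0) hm).
by rewrite slope_extN dual_slopeN => /oppr_inj.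
Qed.

(** Here 1 - |h|^q >= 1/4 and 1/p <= 1. This bound on the speed explains the abscissae T <= t/4 in
    [extremal_geodesic]. *)
Lemma lp_norm_slope_ext_le h : `|h| <= 3 / 4 -> lp_norm p 1 (psi h) <= 4.
Proof.
move=> hm; rewrite slope_extE// lp_norm_dual_slope//; last exact: le_lt_trans m34'.
have d1 : delta <= 1 - `|h| `^ q by rewrite lerB// norm_powR_le.
have d2 : 1 / 4 <= 1 - `|h| `^ q := le_trans delta_ge d1.
set X := 1 - _ in d2 *.
have X0 : 0 < X by apply: lt_le_trans d2; rewrite divr_gt0.
have X1 : X <= 1 by rewrite /X gerBl powR_ge0.
rewrite powRN -[leRHS]invrK lef_pV2 ?posrE ?invr_gt0 ?powR_gt0//.
rewrite -[4^-1]div1r (le_trans d2)// -{1}[X](powRr1 (ltW X0)).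
have ip1 : p^-1 <= 1 by rewrite invf_le1// ltW.
by apply: ger_powR ip1; rewrite X0.
Qed.

Lemma lp_norm_slope_ext_ge h : 1 <= lp_norm p 1 (psi h).
Proof. by have := @lp_norm_gel _ p 1 (psi h) p0; rewrite normr1. Qed.

Lemma continuous_lp_norm (a : R) (u : R -> R) : continuous u ->
  continuous (fun t => lp_norm p a (u t)).
Proof.
move=> cu t; rewrite /lp_norm.
have -> : (fun t => (`|a| `^ p + `|u t| `^ p) `^ p^-1) =
    (fun t => Num.max 0 (`|a| `^ p + `|u t| `^ p) `^ p^-1).
  by apply/funext => s; rewrite max_r// addr_ge0// powR_ge0.
apply: (@continuous_comp _ _ _ (fun t : R => `|a| `^ p + `|u t| `^ p)
  (fun y : R => Num.max 0 y `^ p^-1)); last exact: continuous_max_powR.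
apply: cvgD; first exact: cvg_cst.
apply: (@continuous_comp _ _ _ u (fun y : R => `|y| `^ p)); first exact: cu.
exact: continuous_norm_powR.
Qed.

Lemma slope_ext_MVT a b : 0 < a -> a <= b -> b <= 3 / 4 ->
  exists2 x, a <= x <= b & (q - 1) * x `^ (q - 2) * (b - a) <= psi b - psi a.
Proof.
move=> a0 ab b34; have [C C0 HC] := dual_slope_MVT p1 pq m34 m34'.
have [x xab /andP[h _]] := HC a b a0 ab b34.
exists x => //; rewrite !slope_extE// ger0_norm ?(ltW a0) ?(le_trans ab)//.
by rewrite (le_trans (ltW a0)).
Qed.

(** For x < 1 the power x^|q-2| lies below x^(q-2) whatever the sign of q-2, and is increasing. *)
Lemma slope_ext_slope_inner : exists2 c, 0 < c & forall a b, 1 / 8 <= a -> a <= b -> b <= 5 / 8 ->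
  c * (b - a) <= psi b - psi a.
Proof.
exists ((q - 1) * (1 / 8) `^ `|q - 2|); first by rewrite mulr_gt0// powR_gt0// divr_gt0.
move=> a b a8 ab b8.
have a0 : 0 < a by apply: lt_le_trans a8; rewrite divr_gt0.
have b34 : b <= 3 / 4 by apply: (le_trans b8); lra.
have [x /andP[ax xb] h] := slope_ext_MVT a0 ab b34.
apply: le_trans h; rewrite ler_wpM2r ?subr_ge0// ler_wpM2l ?(ltW q10)//.
have x0 : 0 < x := lt_le_trans a0 ax.
have x8 : 1 / 8 <= x := le_trans a8 ax.
have x1 : x < 1 by apply: (le_lt_trans (le_trans xb b34)).
have i8 : 0 <= 1 / 8 :> R by rewrite divr_ge0.
apply: (@le_trans _ _ (x `^ `|q - 2|)).
  by apply: ge0_ler_powR => //; rewrite nnegrE// ltW.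
by apply: le_powR_exponent => //; exact: ler_norm.
Qed.

(** For q <= 2 the power x^(q-2) is least at the end [r]. Intervals starting at 0 use psi(s) >=
    s^(q-1), and those around 0 are split there, psi being odd. *)
Lemma slope_ext_slope r a b : q <= 2 -> 0 < r -> r <= 3 / 4 -> - r <= a -> a <= b -> b <= r ->
  (q - 1) * r `^ (q - 2) * (b - a) <= psi b - psi a.
Proof.
move=> q2 r0 r34.
set c := (q - 1) * _.
have Hx x : 0 < x -> x <= r -> r `^ (q - 2) <= x `^ (q - 2).
  move=> x0 xr; have -> : q - 2 = - (2 - q) by ring.
  rewrite !powRN lef_pV2 ?posrE ?powR_gt0//.
  by apply: ge0_ler_powR; rewrite ?nnegrE ?(ltW x0) ?(ltW r0)// subr_ge0.
have H0 s : 0 <= s -> s <= r -> c * s <= psi s.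
  rewrite le_eqVlt => /orP[/eqP<-|s0] sr; first by rewrite mulr0 slope_ext0.
  apply: le_trans (slope_ext_ge (ltW s0)).
  rewrite -(mulr_powRB1 (ltW s0) q10) (_ : q - 1 - 1 = q - 2); last by ring.
  rewrite mulrC; apply: ler_wpM2l; first exact: ltW.
  have h := Hx s s0 sr; apply: le_trans h; rewrite /c ler_piMl ?powR_ge0//.
  by move: q2; lra.
have H s t : 0 <= s -> s <= t -> t <= r -> c * (t - s) <= psi t - psi s.
  rewrite le_eqVlt => /orP[/eqP<-|s0] st tr.
    by rewrite slope_ext0 !subr0 H0.
  have [x /andP[sx xt] h] := slope_ext_MVT s0 st (le_trans tr r34).
  apply: le_trans h; rewrite ler_wpM2r ?subr_ge0// /c ler_wpM2l ?(ltW q10)//.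
  by apply: Hx; [exact: lt_le_trans s0 sx|exact: le_trans xt tr].
move=> ra ab br; have [a0|a0] := leP 0 a; first exact: H.
have [b0|b0] := leP b 0.
  have := H (- b) (- a); rewrite oppr_ge0 lerN2 lerNl !slope_extN => /(_ b0 ab ra).
  have -> : - a - - b = b - a by ring.
  by have -> : - psi a - - psi b = psi b - psi a by ring.
have h1 := H0 b (ltW b0) br.
have := H0 (- a); rewrite oppr_ge0 lerNl slope_extN => /(_ (ltW a0) ra).
move: h1; move: (psi a) (psi b) => A B; rewrite mulrBr mulrN.
by move: (c * a) (c * b); move=> x y; lra.
Qed.

End SlopeExt.

(** * Primitives and their comparison *)

Section Primitive.
Context {R : realType}.
Implicit Types f g : R -> R.

(* Junk if [f] has no primitive. *)
Definition primitive f : R -> R :=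
  get [set F : R -> R | (forall x : R, is_derive x 1 F (f x)) /\ F 0 = 0].

Lemma primitiveP f : continuous f ->
  (forall x : R, is_derive x 1 (primitive f) (f x)) /\ primitive f 0 = 0.
Proof.
move=> cf; have [F dF F0] := continuous_antiderivative cf.
exact: (@getPex _ [set F : R -> R | (forall x : R, is_derive x 1 F (f x)) /\ F 0 = 0]
  (ex_intro _ F (conj dF F0))).
Qed.

Lemma is_derive_MVT (F f : R -> R) a b : a <= b -> (forall x : R, is_derive x 1 F (f x)) ->
  exists2 x, a <= x <= b & F b - F a = f x * (b - a).
Proof.
move=> ab dF; have [|x xab ->] := MVT_segment ab (fun x _ => dF x).
  by apply: derivable_within_continuous => x _; exact: (@ex_derive _ _ _ _ _ _ _ (dF x)).
by exists x => //; rewrite in_itv in xab.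
Qed.

Lemma primitive_MVT2 f g (T : R) : continuous f -> continuous g -> 0 <= T ->
  exists2 x, 0 <= x <= T & primitive g T - primitive f T = (g x - f x) * T.
Proof.
move=> cf cg T0; have [df f0] := primitiveP cf; have [dg g0] := primitiveP cg.
have [x xT h] := is_derive_MVT T0 (fun s => is_deriveB (dg s) (df s)).
have {}h : primitive g T - primitive f T - (primitive g 0 - primitive f 0) = (g x - f x) * (T - 0) := h.
by exists x => //; rewrite f0 g0 !subr0 in h.
Qed.

Lemma primitiveE f F (T : R) : continuous f -> (forall x : R, is_derive x 1 F (f x)) ->
  0 <= T -> primitive f T = F T - F 0.
Proof.
move=> cf dF T0; have [df f0] := primitiveP cf.
have [x _ h] := is_derive_MVT T0 (fun s => is_deriveB (dF s) (df s)).
have {}h : F T - primitive f T - (F 0 - primitive f 0) = (f x - f x) * (T - 0) := h.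
by move: h; rewrite f0 subrr mul0r; lra.
Qed.

Lemma primitive_le f g (T : R) : continuous f -> continuous g -> 0 <= T ->
  (forall x, 0 <= x <= T -> f x <= g x) -> primitive f T <= primitive g T.
Proof.
move=> cf cg T0 fg; have [x xT h] := primitive_MVT2 cf cg T0.
by rewrite -subr_ge0 h mulr_ge0// subr_ge0 fg.
Qed.

Lemma primitive_lt f g (T : R) : continuous f -> continuous g -> 0 < T ->
  (forall x, 0 <= x <= T -> f x < g x) -> primitive f T < primitive g T.
Proof.
move=> cf cg T0 fg; have [x xT h] := primitive_MVT2 cf cg (ltW T0).
by rewrite -subr_gt0 h mulr_gt0// subr_gt0 fg.
Qed.

Lemma primitive_MVT f (T : R) : continuous f -> 0 <= T ->
  exists2 x, 0 <= x <= T & primitive f T = f x * T.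
Proof.
move=> cf T0; have [df f0] := primitiveP cf.
have [x xT] := is_derive_MVT T0 df; rewrite f0 !subr0 => ->.
by exists x.
Qed.

(** Heine's theorem with only [x] confined to the segment, since perturbed covectors may leave
    it. *)
Lemma uniformly_continuous_segment f (a b e : R) : continuous f -> 0 < e ->
  exists2 d, 0 < d & forall x y, a <= x <= b -> `|y - x| <= d -> `|f y - f x| < e.
Proof.
move=> cf e0.
have := (compact_near_coveringP `[a, b]%classic).1 (@segment_compact R a b).
move=> /(_ R (0 : R)^'+ (fun d x => forall y, `|y - x| <= d -> `|f y - f x| < e) _).
case.
  move=> x _; have e20 : 0 < e / 2 by rewrite divr_gt0.
  have /cvgrPdist_lt/(_ _ e20) := cf x; rewrite /= => -[r /= r0 Hr].
  have r20 : 0 < r / 2 by rewrite divr_gt0.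
  exists ([set x' | `|x - x'| < r / 2], [set d | d < r / 2]) => /=.
    split; first by exists (r / 2).
    exact: nbhs_right_lt.
  move=> [x' d] /= [xx' dr] y yd.
  have h1 : `|f x - f x'| < e / 2 by apply: Hr => /=; apply: (lt_le_trans xx'); lra.
  have h2 : `|f x - f y| < e / 2.
    apply: Hr => /=; have -> : x - y = (x - x') + (x' - y) by ring.
    apply: (le_lt_trans (ler_normD _ _)); rewrite distrC in yd.
    by move: xx' dr yd; move: `|x - x'| `|x' - y| => A B; lra.
  have -> : f y - f x' = (f x - f x') - (f x - f y) by ring.
  apply: (le_lt_trans (ler_normB _ _)).
  by move: h1 h2; move: `|f x - f x'| `|f x - f y| => A B; lra.
move=> d /= d0 Hd; have d20 : 0 < d / 2 by rewrite divr_gt0.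
exists (d / 2) => // x y xab yx.
apply: (Hd (d / 2)) => //=; rewrite ?in_itv//=.
by rewrite sub0r normrN gtr0_norm// ltr_pdivrMr// ltr_pMr// ltr1n.
Qed.

End Primitive.

(** * The endpoint map of extremals *)

Section Endpoint.
Context {R : realType}.
Variable psi : R -> R.
Hypotheses (psi_cont : continuous psi) (psi_lt : forall a b, a < b -> psi a < psi b).

Let psi_le a b : a <= b -> psi a <= psi b.
Proof. by rewrite le_eqVlt => /orP[/eqP->//|/psi_lt/ltW]. Qed.

Definition slope_at (T c w s : R) : R := psi (c + w * (s - T / 2)).

(* Second and third coordinate, at abscissa [T], of the extremal with slope
   [slope_at T c w]. *)
Definition endpoint_y (T c w : R) : R := primitive (slope_at T c w) T.
Definition endpoint_z (T c w : R) : R :=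
  primitive (fun s => (s - T / 2) * slope_at T c w s) T.

Lemma continuous_affine (a b : R) : continuous (fun s : R => a + b * s).
Proof. by move=> s; apply: cvgD; [exact: cvg_cst|apply: cvgMr; exact: cvg_id]. Qed.

Lemma continuous_slope_at (T c w : R) : continuous (slope_at T c w).
Proof.
move=> s; apply: (@continuous_comp _ _ _ (fun s => c + w * (s - T / 2)) psi); last exact: psi_cont.
have -> : (fun s => c + w * (s - T / 2)) = (fun s => (c - w * (T / 2)) + w * s).
  by apply/funext => x; ring.
exact: continuous_affine.
Qed.

Lemma continuous_slope_moment (T c w : R) : continuous (fun s : R => (s - T / 2) * slope_at T c w s).
Proof.
move=> s; apply: cvgM; last exact: continuous_slope_at.
by apply: cvgB; [exact: cvg_id|exact: cvg_cst].
Qed.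

Hint Resolve continuous_slope_at continuous_slope_moment : core.

Variable T : R.
Hypothesis T0 : 0 < T.
Local Notation Y := (endpoint_y T).
Local Notation Z := (endpoint_z T).

Lemma endpoint_y_lt c c' w : c < c' -> Y c w < Y c' w.
Proof. by move=> cc; apply: primitive_lt => // s _; apply: psi_lt; rewrite ltrD2r. Qed.

Let half s : 0 <= s <= T -> `|s - T / 2| <= T / 2.
Proof. by move=> /andP[s0 sT]; rewrite ler_norml; apply/andP; split; lra. Qed.

Let shift_le s w : 0 <= s <= T -> `|w * (s - T / 2)| <= `|w| * (T / 2).
Proof. by move=> sT; rewrite normrM ler_wpM2l// half. Qed.

(** Changing [w] moves the covector by at most |w - w'| T/2 on [0, T], which a shift of [c]
    compensates. *)
Lemma endpoint_y_shift c w w' : Y c w <= Y (c + `|w - w'| * (T / 2)) w'.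
Proof.
apply: primitive_le => //; first exact: ltW.
move=> s sT; apply: psi_le; rewrite -lerBlDr.
have h := shift_le (w - w') sT.
have := le_trans (ler_norm _) h; move: (`|_| * _) => B.
by lra.
Qed.

Lemma endpoint_y_inj c c' w w' : Y c w = Y c' w' -> `|c' - c| <= `|w' - w| * (T / 2).
Proof.
move=> E; rewrite ler_norml; apply/andP; split; rewrite leNgt; apply/negP => h.
  have h1 := endpoint_y_shift c' w' w; rewrite -E in h1.
  have : Y (c' + `|w' - w| * (T / 2)) w < Y c w by apply: endpoint_y_lt; lra.
  by rewrite ltNge h1.
have h1 := endpoint_y_shift c w w'; rewrite E in h1.
have : Y (c + `|w - w'| * (T / 2)) w' < Y c' w' by apply: endpoint_y_lt; rewrite distrC; lra.
by rewrite ltNge h1.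
Qed.

Lemma endpoint_y_ge c w k : (forall s, 0 <= s <= T -> k <= c + w * (s - T / 2)) ->
  psi k * T <= Y c w.
Proof.
move=> H; have [s sT E] := primitive_MVT (@continuous_slope_at T c w) (ltW T0).
by rewrite /endpoint_y E ler_wpM2r ?(ltW T0)// psi_le// H.
Qed.

Lemma endpoint_y_le c w k : (forall s, 0 <= s <= T -> c + w * (s - T / 2) <= k) ->
  Y c w <= psi k * T.
Proof.
move=> H; have [s sT E] := primitive_MVT (@continuous_slope_at T c w) (ltW T0).
by rewrite /endpoint_y E ler_wpM2r ?(ltW T0)// psi_le// H.
Qed.

Let is_derive_sqr (k s : R) : is_derive s 1 (fun s => k / 2 * (s - T / 2) ^+ 2) (k * (s - T / 2)).
Proof.
have d1 : is_derive s 1 (fun s : R => s - T / 2) (1 - 0).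
  exact: is_deriveB (is_derive_id s 1) (is_derive_cst _ s 1).
have := is_deriveZ (k / 2) (is_deriveX 2 d1).
rewrite (_ : _ *: _ = k * (s - T / 2)); first exact.
by rewrite subr0 -[_ *: _]/(_ * (_ * _)) expr1 -mulr_natl; field.
Qed.

Let is_derive_cube (k s : R) : is_derive s 1 (fun s => k / 3 * (s - T / 2) ^+ 3) (k * (s - T / 2) ^+ 2).
Proof.
have d1 : is_derive s 1 (fun s : R => s - T / 2) (1 - 0).
  exact: is_deriveB (is_derive_id s 1) (is_derive_cst _ s 1).
have := is_deriveZ (k / 3) (is_deriveX 3 d1).
rewrite (_ : _ *: _ = k * (s - T / 2) ^+ 2); first exact.
by rewrite subr0 -[_ *: _]/(_ * (_ * _)) -mulr_natl; field.
Qed.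

Lemma endpoint_z0 c : Z c 0 = 0.
Proof.
have dF (s : R) : is_derive s 1 (fun s => psi c / 2 * (s - T / 2) ^+ 2)
    ((s - T / 2) * slope_at T c 0 s).
  have -> : (s - T / 2) * slope_at T c 0 s = psi c * (s - T / 2).
    by rewrite /slope_at mul0r addr0 mulrC.
  exact: is_derive_sqr.
rewrite /endpoint_z (primitiveE _ dF (ltW T0))//.
by field.
Qed.

(* [psi (c + u) - psi c] has the sign of [u], so that the part of the moment
   due to the slope at the midpoint cancels and the variation of [psi] adds up. *)
Lemma endpoint_z_ge (k c w lo hi : R) : 0 <= w ->
  (forall a b, lo <= a -> a <= b -> b <= hi -> k * (b - a) <= psi b - psi a) ->
  lo <= c - w * (T / 2) -> c + w * (T / 2) <= hi ->
  k * w * T ^+ 3 / 12 <= Z c w.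
Proof.
move=> w0 Hk clo chi.
pose g (s : R) := psi c * (s - T / 2) + k * w * (s - T / 2) ^+ 2.
pose G (s : R) := psi c / 2 * (s - T / 2) ^+ 2 + k * w / 3 * (s - T / 2) ^+ 3.
have dG (s : R) : is_derive s 1 G (g s) by exact: is_deriveD.
have csub : continuous (fun s : R => s - T / 2).
  by move=> s; apply: cvgB; [exact: cvg_id|exact: cvg_cst].
have cg : continuous g.
  move=> s; apply: cvgD; first by apply: cvgMr; exact: csub.
  by apply: cvgMr; apply: cvgM; exact: csub.
have -> : k * w * T ^+ 3 / 12 = primitive g T.
  by rewrite (primitiveE cg dG (ltW T0)) /G; field.
apply: primitive_le => //; first exact: ltW.
move=> s sT; rewrite /g /slope_at; set u := s - T / 2.
have wu : `|w * u| <= w * (T / 2) by have := shift_le w sT; rewrite (ger0_norm w0).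
move: wu; rewrite ler_norml => /andP[wu1 wu2].
have [u0|u0] := leP 0 u.
  have wu0 : 0 <= w * u by rewrite mulr_ge0.
  have := Hk c (c + w * u); rewrite lerDl => /(_ _ wu0 _) H.
  have {}H : k * (w * u) <= psi (c + w * u) - psi c.
    by have := H; rewrite addrAC subrr add0r; apply; lra.
  move: (ler_wpM2l u0 H); move: (psi c) (psi _) => A B.
  by move: (u) => v; lra.
have wu0 : w * u <= 0 by rewrite mulr_ge0_le0// ltW.
have {}H : k * (- (w * u)) <= psi c - psi (c + w * u).
  have -> : - (w * u) = c - (c + w * u) by ring.
  by apply: Hk; lra.
have nu : 0 <= - u by rewrite oppr_ge0 ltW.
move: (ler_wpM2l nu H); move: (psi c) (psi _) => A B.
by move: (u) => v; lra.
Qed.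

Lemma continuous_endpoint_y w : continuous (Y^~ w).
Proof.
move=> c; apply/cvgrPdist_lt => e e0.
have eT : 0 < e / T by rewrite divr_gt0.
have [d d0 Hd] := uniformly_continuous_segment (c - `|w| * (T / 2)) (c + `|w| * (T / 2)) psi_cont eT.
exists d => // c' /= cc'.
have [s sT E] := primitive_MVT2 (@continuous_slope_at T c' w) (@continuous_slope_at T c w) (ltW T0).
rewrite /endpoint_y E normrM (gtr0_norm T0) -ltr_pdivlMr// distrC.
apply: Hd.
  by have := shift_le w sT; rewrite ler_norml; move: (w * _) (`|w| * _) => A B; lra.
have -> : c' + w * (s - T / 2) - (c + w * (s - T / 2)) = - (c - c') by ring.
by rewrite normrN ltW.
Qed.

(* For [y] fixed, [endpoint_y T c w = y] defines [c] as a Lipschitz function of [w]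
   (lemma [endpoint_y_inj]), and the intermediate value theorem applies to
   [endpoint_z] along its graph. *)
Lemma endpoint_surj (clo chi w0 y z : R) : clo <= chi -> 0 <= w0 -> 0 <= z ->
  (forall w, 0 <= w <= w0 -> Y clo w <= y <= Y chi w) ->
  (forall c, clo <= c <= chi -> z <= Z c w0) ->
  exists c w, [/\ clo <= c <= chi, 0 <= w <= w0, Y c w = y & Z c w = z].
Proof.
move=> cc w00 z0 HY HZ.
have ex w : 0 <= w <= w0 -> exists c, clo <= c <= chi /\ Y c w = y.
  move=> ww; have [||c + Yc] := @IVT R (Y^~ w) clo chi y cc.
  - by apply: continuous_subspaceT; exact: continuous_endpoint_y.
  - by have /andP[h1 h2] := HY w ww; rewrite ge_min h1 le_max h2 orbT.
  by rewrite in_itv => cb; exists c.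
pose cw w := get [set c | clo <= c <= chi /\ Y c w = y].
have cwP w : 0 <= w <= w0 -> clo <= cw w <= chi /\ Y (cw w) w = y.
  by move=> /ex[c hc]; exact: (@getPex _ [set c | clo <= c <= chi /\ Y c w = y] (ex_intro _ c hc)).
have cZ : {within `[0, w0], continuous (fun w => Z (cw w) w)}.
  apply/subspace_continuousP => w /=; rewrite in_itv/= => ww.
  apply/cvgrPdist_lt => e e0; have eT : 0 < e / T / T by rewrite !divr_gt0.
  have [d d0 Hd] := uniformly_continuous_segment (cw w - `|w| * (T / 2))
    (cw w + `|w| * (T / 2)) psi_cont eT.
  have dT : 0 < d / T by rewrite divr_gt0.
  exists (d / T) => //= w' /= ww' w'w; rewrite in_itv/= in w'w.
  have [s sT E] := primitive_MVT2 (@continuous_slope_moment T (cw w') w')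
    (@continuous_slope_moment T (cw w) w) (ltW T0).
  rewrite /endpoint_z E normrM (gtr0_norm T0) -ltr_pdivlMr//.
  rewrite -mulrBr normrM.
  apply: (@le_lt_trans _ _ (T * `|slope_at T (cw w) w s - slope_at T (cw w') w' s|)).
    by apply: ler_wpM2r => //; apply: (le_trans (half sT)); lra.
  rewrite mulrC -ltr_pdivlMr// distrC; apply: Hd.
    by have := shift_le w sT; rewrite ler_norml; move: (w * _) (`|w| * _) => A B; lra.
  have [_ E1] := cwP w ww; have [_ E2] := cwP w' w'w; rewrite -E2 in E1.
  have h1 := endpoint_y_inj E1; have h2 := shift_le (w' - w) sT.
  have h3 : `|w' - w| * T <= d by rewrite -ler_pdivlMr// distrC ltW.
  have -> : cw w' + w' * (s - T / 2) - (cw w + w * (s - T / 2)) =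
    (cw w' - cw w) + (w' - w) * (s - T / 2) by ring.
  apply: (le_trans (ler_normD _ _)).
  by move: h1 h2 h3; move: `|_ - cw w| `|_ * (s - _)| `|w' - w| => A B D; lra.
have [|w + Zw] := @IVT R (fun w => Z (cw w) w) 0 w0 z w00 cZ.
  have [|h _] := cwP w0; first by rewrite w00 lexx.
  by rewrite endpoint_z0 ge_min z0/= le_max (HZ _ h) orbT.
rewrite in_itv/= => ww; have [h1 h2] := cwP w ww.
by exists (cw w), w.
Qed.

End Endpoint.

(** * Calibrated extremals are geodesics *)

Section Extremal.
Context {R : realType}.
Local Notation heis := (R * R * R)%type.
Local Notation heis0 := (0 : R, 0 : R, 0 : R).
Variables p q : R.
Hypotheses (p1 : 1 < p) (pq : p^-1 + q^-1 = 1).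
Local Notation N := (heis_norm p).
Local Notation psi := (slope_ext p q).
Local Notation K := (dual_height q).

Let p0 : 0 < p. Proof. exact: lt_trans p1. Qed.
Let q1 : 1 < q. Proof. exact: conj_gt1 p1 pq. Qed.
Let q0 : 0 < q. Proof. exact: lt_trans q1. Qed.

Lemma heis_norm_rotate (x y z : R) : N (- x, - y, z) = N (x, y, z).
Proof.
have := heis_norm_swapE p1 (- y) (- x) (- z); rewrite opprK => ->.
have := heis_norm_reflectE p1 y (- x) z => ->.
have := heis_norm_swapE p1 (- x) y (- z); rewrite opprK => ->.
exact: heis_norm_reflectE.
Qed.

Lemma heis_dist_rotate (x y z x' y' z' : R) :
  heis_dist p (- x, - y, z) (- x', - y', z') = heis_dist p (x, y, z) (x', y', z').
Proof.
rewrite !heis_distE//; congr EFin; rewrite /heis_mul /heis_inv/= -heis_norm_rotate.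
by congr (N (_, _, _)); ring.
Qed.

Lemma lp_norm_scale (d u v : R) : lp_norm p (d * u) (d * v) = `|d| * lp_norm p u v.
Proof.
rewrite -(lp_normZ u v p0 (normr_ge0 d)) /lp_norm !normrM normr_id.
by [].
Qed.

Variables c w : R.
Hypotheses (cb : `|c| <= 5 / 8) (w0 : 0 <= w) (w1 : w <= 1 / 16).

(** The extremal as a graph over its abscissa: [h] is the covector, [f] the second coordinate and
    [l] the arc length. The height x f/2 - Q solves z' = (x f' - f)/2, and [H] is the part of the
    calibration that depends on x alone. *)
Let h (x : R) := c + w * x.
Let f := primitive (fun x => psi (h x)).
Let Q := primitive f.
Let l := primitive (fun x => lp_norm p 1 (psi (h x))).
Let H := primitive (fun x => K (h x)).
Let gam (x : R) : heis := (x, f x, x * f x / 2 - Q x).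

Let ch : continuous h. Proof. exact: continuous_affine. Qed.

Let cpsi : continuous (fun x => psi (h x)).
Proof.
by move=> x; apply: (@continuous_comp _ _ _ h psi); [exact: ch|exact: continuous_slope_ext p1 pq _].
Qed.

Let cK : continuous (fun x => K (h x)).
Proof.
by move=> x; apply: (@continuous_comp _ _ _ h K); [exact: ch|exact: continuous_dual_height q0 _].
Qed.

Let clp : continuous (fun x => lp_norm p 1 (psi (h x))).
Proof. exact: continuous_lp_norm. Qed.

Let df (x : R) : is_derive x 1 f (psi (h x)). Proof. exact: (primitiveP cpsi).1. Qed.
Let f0 : f 0 = 0. Proof. exact: (primitiveP cpsi).2. Qed.
Let cf : continuous f. Proof. exact: is_derive_continuous df. Qed.
Let dQ (x : R) : is_derive x 1 Q (f x). Proof. exact: (primitiveP cf).1. Qed.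
Let Q0 : Q 0 = 0. Proof. exact: (primitiveP cf).2. Qed.
Let dl (x : R) : is_derive x 1 l (lp_norm p 1 (psi (h x))). Proof. exact: (primitiveP clp).1. Qed.
Let l0 : l 0 = 0. Proof. exact: (primitiveP clp).2. Qed.
Let dH (x : R) : is_derive x 1 H (K (h x)). Proof. exact: (primitiveP cK).1. Qed.

Let dz (x : R) : is_derive x 1 (fun x => x * f x / 2 - Q x) ((x * psi (h x) - f x) / 2).
Proof.
have := is_deriveB (is_deriveZ 2^-1 (is_deriveM (is_derive_id x 1) (df x))) (dQ x).
set F := (X in is_derive _ _ X _) => d.
have -> : (fun x => x * f x / 2 - Q x) = F.
  by apply/funext => y; rewrite /F/= mulrC.
rewrite (_ : (_ - _) / 2 = 2^-1 *: (x *: psi (h x) + f x *: 1) - f x)//.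
by rewrite -![_ *: _]/(_ * _); field.
Qed.

Let hb x : 0 <= x <= 1 -> `|h x| <= 3 / 4.
Proof.
move=> /andP[x0 x1]; have := cb; rewrite !ler_norml /h => /andP[c1 c2].
have wx0 : 0 <= w * x by rewrite mulr_ge0.
have wx1 : w * x <= 1 / 16 by rewrite (le_trans _ w1)// ler_piMr.
by apply/andP; split; lra.
Qed.

Let l_incr x y : x <= y -> y - x <= l y - l x.
Proof.
move=> xy; have [s _ ->] := is_derive_MVT xy dl.
by rewrite ler_peMl ?subr_ge0//; exact: lp_norm_slope_ext_ge.
Qed.

Let l_le x y : 0 <= x -> x <= y -> y <= 1 -> l y - l x <= 4 * (y - x).
Proof.
move=> x0 xy y1; have [s /andP[xs sy] ->] := is_derive_MVT xy dl.
rewrite ler_wpM2r ?subr_ge0//; apply: lp_norm_slope_ext_le p1 pq _ _; apply: hb.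
by rewrite (le_trans x0 xs) (le_trans sy y1).
Qed.

(** The sign [s] of y - x orients the arc length, so both directions are covered by one curve. *)
Let dist_le x y : (heis_dist p (gam x) (gam y) <= `|l y - l x|%:E)%E.
Proof.
pose d := y - x.
have a0 : d * 0 + x = x by rewrite mulr0 add0r.
have a1 : d * 1 + x = y by rewrite mulr1 subrK.
pose s : R := Num.sg d.
have := @heis_dist_C1 R p (fun t => d * t + x) (fun t => f (d * t + x))
  (fun t => (d * t + x) * f (d * t + x) / 2 - Q (d * t + x))
  (fun t => d * 1) (fun t => d * psi (h (d * t + x))) (fun t => s * l (d * t + x)).
rewrite a0 a1 -/(gam x) -/(gam y) => Hd.
have cp : continuous (fun t : R => psi (h (d * t + x))).
  move=> t; apply: (@continuous_comp _ _ _ (fun t => d * t + x) (fun x => psi (h x))); last exact: cpsi.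
  by apply: cvgD; [apply: cvgMr; exact: cvg_id|exact: cvg_cst].
apply: (le_trans (Hd _ _ _ _ _ _ _)).
- by move=> t; exact: cvg_cst.
- by move=> t; apply: cvgMr; exact: cp.
- rewrite (_ : (fun _ => _) = (fun t => `|d| * lp_norm p 1 (psi (h (d * t + x))))); last first.
    by apply/funext => t; rewrite lp_norm_scale.
  by move=> t; apply: cvgMr; exact: (continuous_lp_norm p1 cp).
- move=> t; have := is_deriveD (is_deriveZ d (is_derive_id t 1)) (is_derive_cst x t 1).
  by rewrite addr0.
- by move=> t; exact: (@is_derive_affine_comp R f t d x _ (df _)).
- move=> t; have := @is_derive_affine_comp R (fun x => x * f x / 2 - Q x) t d x _ (dz _).
  rewrite (_ : d * _ = ((d * t + x) * (d * psi (h (d * t + x))) - f (d * t + x) * (d * 1)) / 2)//.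
  by field.
- move=> t; rewrite lp_norm_scale [`|d|]normrEsg -/s -mulrA.
  exact: is_deriveZ (@is_derive_affine_comp R l t d x _ (dl _)).
rewrite lee_fin -mulrBr (le_trans (ler_norm _))// normrM ler_piMl//.
by rewrite normr_sg; case: (_ != _).
Qed.

(** Along the extremal Hölder's inequality is an equality, so the calibration and the arc length
    have the same derivative. *)
Let calibE x y : 0 <= x -> x <= y -> y <= 1 ->
  calib H c w (gam y) - calib H c w (gam x) = l y - l x.
Proof.
move=> x0 xy y1.
pose S (s : R) := H s + c * f s + w * ((s * f s / 2 - Q s) + s * f s / 2).
have dS (s : R) : is_derive s 1 S (K (h s) + h s * psi (h s)).
  have := is_deriveD (is_deriveD (dH s) (is_deriveZ c (df s))) (is_deriveZ w
    (is_deriveD (dz s) (is_deriveZ 2^-1 (is_deriveM (is_derive_id s 1) (df s))))).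
  set F := (X in is_derive _ _ X _) => d.
  have -> : S = F.
    apply/funext => u; rewrite /S.
    have -> : F u = H u + c * f u + w * ((u * f u / 2 - Q u) + 2^-1 * (u * f u)) by [].
    by rewrite [2^-1 * _]mulrC.
  rewrite (_ : K _ + _ = K (h s) + c *: psi (h s) + w *: ((s * psi (h s) - f s) / 2 +
    2^-1 *: (s *: psi (h s) + f s *: 1)))//.
  by rewrite -![_ *: _]/(_ * _) /h; field.
have [s /andP[xs sy]] := is_derive_MVT xy (fun s => is_deriveB (dS s) (dl s)).
have s01 : 0 <= s <= 1 by rewrite (le_trans x0 xs) (le_trans sy y1).
have hs := hb s01; have hs1 : `|h s| < 1 by apply: (le_lt_trans hs); lra.
rewrite (slope_extE p1 pq hs) (dual_pairing_slope p1 pq hs1) (lp_norm_dual_slope p1 pq hs1).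
rewrite subrr mul0r => E.
have {}E : S y - l y - (S x - l x) = 0 := E.
rewrite /calib/= -/(S y) -/(S x).
by apply/eqP; rewrite -subr_eq0 -E; apply/eqP; ring.
Qed.

(** 5/8 + 6/16 = 1. The radius 5 exceeds the length of the extremal over [0, 1], at most 4, so it
    can serve as [rho] in [heis_dist_calib]. *)
Let cond g (x : R) : 0 <= g <= 1 -> `|x - g| <= 5 -> `|c + w * x| <= 1.
Proof.
move=> /andP[g0 g1]; rewrite ler_norml => /andP[x0 x1].
apply: (le_trans (ler_normD _ _)).
have : `|w * x| <= 6 / 16.
  rewrite normrM (ger0_norm w0) (_ : 6 / 16 = 1 / 16 * 6); last by field.
  rewrite ler_pM// ler_norml; apply/andP; split; lra.
by move: cb; lra.
Qed.

(* The reversed curve is the image of a calibrated one by the isometry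
   (x, y, z) |-> (- x, - y, z). *)
Let dist_ge x y : 0 <= x -> x <= y -> y <= 1 ->
  ((l y - l x)%:E <= heis_dist p (gam x) (gam y))%E /\
  ((l y - l x)%:E <= heis_dist p (gam y) (gam x))%E.
Proof.
move=> x0 xy y1.
have ly : `|l y - l x| < 5.
  have h1 := l_le x0 xy y1; have h2 := l_incr xy.
  by rewrite ger0_norm; lra.
split.
  rewrite -(calibE x0 xy y1); apply: (@heis_dist_calib _ p q H c w 5) => //=.
    by move=> s; apply: cond; rewrite x0 (le_trans xy).
  by apply: (le_lt_trans (dist_le x y)); rewrite lte_fin.
have rotE u v : heis_dist p (gam u) (gam v) =
  heis_dist p (- u, - f u, (gam u).2) (- v, - f v, (gam v).2).
  by rewrite heis_dist_rotate.
pose H' (x : R) := - H (-1 * x + 0).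
have cE s : calib H' c (- w) (- s, - f s, (gam s).2) = - calib H c w (gam s).
  by rewrite /calib /H'/= addr0 mulN1r opprK; ring.
rewrite rotE.
have -> : l y - l x = calib H' c (- w) (- x, - f x, (gam x).2) -
    calib H' c (- w) (- y, - f y, (gam y).2).
  by rewrite !cE -(calibE x0 xy y1); ring.
apply: (@heis_dist_calib _ p q H' c (- w) 5) => //=.
- move=> s; have := is_deriveN (is_derive_affine_comp (dH (-1 * s + 0))).
  rewrite (_ : - (-1 * _) = K (c + - w * s)); first exact.
  by rewrite mulN1r opprK /h; congr (K (_ + _)); ring.
- move=> s sy; have -> : c + - w * s = c + w * (- s) by ring.
  apply: (@cond y); first by rewrite (le_trans x0).
  by have -> : - s - y = - (s - - y); [ring|rewrite normrN].
- by rewrite -[heis_dist _ _ _]rotE; apply: (le_lt_trans (dist_le y x)); rewrite lte_fin distrC.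
Qed.

Let dist_eq x y : 0 <= x <= 1 -> 0 <= y <= 1 ->
  heis_dist p (gam x) (gam y) = `|l y - l x|%:E.
Proof.
move=> /andP[x0 x1] /andP[y0 y1]; apply/le_anti; rewrite dist_le/=.
have [xy|yx] := leP x y.
  have [h1 _] := dist_ge x0 xy y1; apply: le_trans h1.
  by rewrite ger0_norm// (le_trans _ (l_incr xy))// subr_ge0.
have [_ h1] := dist_ge y0 (ltW yx) x1; apply: le_trans h1.
by rewrite distrC ger0_norm// (le_trans _ (l_incr (ltW yx)))// subr_ge0 ltW.
Qed.

Let l_inj x y : l x = l y -> x = y.
Proof.
move=> E; apply/le_anti; have [xy|yx] := leP x y.
  by have := l_incr xy; rewrite E subrr subr_le0.
by have := l_incr (ltW yx); rewrite E subrr subr_le0 leNgt yx.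
Qed.

Lemma extremal_geodesic (t T : R) : 0 < t -> t <= 1 -> 0 <= T -> T <= t / 4 ->
  exists g : R -> heis, [/\ constant_speed_geodesic (heis_dist p) g, g 0 = heis0,
    N (g 1) <= 1 &
    g t = (T, primitive (fun x => psi (c + w * x)) T,
      T * primitive (fun x => psi (c + w * x)) T / 2 -
      primitive (primitive (fun x => psi (c + w * x))) T)].
Proof.
move=> t0 t1 T0 Tt.
have T1 : T <= 1 by apply: (le_trans Tt); lra.
have lT0 : 0 <= l T by have := l_incr T0; rewrite l0; lra.
have lT : l T <= t by have := l_le (lexx 0) T0 T1; rewrite l0; lra.
have l1 : 1 <= l 1 by have := l_incr ler01; rewrite l0; lra.
(* The total length for which a constant speed curve reaches abscissa [T] at time [t]. As l T <= 4 T
   <= t, it is at most 1 <= l 1, so the whole curve stays over [0, 1]. *)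
pose L := l T / t.
have L0 : 0 <= L by rewrite divr_ge0// ltW.
have L1 : L <= 1 by rewrite ler_pdivrMr// mul1r.
have ex s : 0 <= s <= 1 -> exists x, 0 <= x <= 1 /\ l x = s * L.
  move=> /andP[s0 s1]; have [||x + lx] := @IVT R l 0 1 (s * L) ler01.
  - by apply: continuous_subspaceT; exact: is_derive_continuous dl.
  - rewrite l0 ge_min (mulr_ge0 s0 L0)/= le_max; apply/orP; right.
    by rewrite (le_trans _ l1)// (le_trans _ L1)// ler_piMl.
  by rewrite in_itv => xx; exists x.
pose x s := get [set x | 0 <= x <= 1 /\ l x = s * L].
have xP s : 0 <= s <= 1 -> 0 <= x s <= 1 /\ l (x s) = s * L.
  by move=> /ex[y hy]; exact: (@getPex _ [set x | 0 <= x <= 1 /\ l x = s * L] (ex_intro _ y hy)).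
have I01 (s : R) : 0 <= s -> s <= 1 -> 0 <= s <= 1 by move=> -> ->.
have I0 := I01 0 (lexx 0) ler01.
have I1 := I01 1 ler01 (lexx 1).
have x00 : x 0 = 0 by apply: l_inj; rewrite (xP 0 I0).2 mul0r l0.
have xt : x t = T.
  by apply: l_inj; rewrite (xP t _).2 ?(ltW t0)//= /L mulrC divfK// gt_eqF.
have g00 : gam 0 = heis0 by rewrite /gam f0 Q0 mul0r mul0r subrr.
have LE : `|l (x 1) - l (x 0)| = L.
  by rewrite (xP 1 I1).2 (xP 0 I0).2 mul1r mul0r subr0 ger0_norm.
exists (fun s => gam (x s)); split.
- move=> s u s01 u01; have [xs ls] := xP s s01; have [xu lu] := xP u u01.
  have [x0' _] := xP 0 I0; have [x1' _] := xP 1 I1.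
  rewrite !dist_eq// LE ls lu -EFinM -mulrBl normrM; congr EFin.
  by rewrite (ger0_norm L0).
- by rewrite x00.
- have [x1' _] := xP 1 I1; have := heis_normE p1 (gam (x 1)).
  rewrite -g00 dist_eq// => -[<-].
  by rewrite l0 -l0 -{1}x00 LE.
- by rewrite xt.
Qed.

End Extremal.

(** * Boxes filled by geodesics from the origin *)

Section Regions.
Context {R : realType}.
Local Notation heis := (R * R * R)%type.
Local Notation heis0 := (0 : R, 0 : R, 0 : R).
Variables p q : R.
Hypotheses (p1 : 1 < p) (pq : p^-1 + q^-1 = 1).
Local Notation N := (heis_norm p).
Local Notation psi := (slope_ext p q).

Let q1 : 1 < q. Proof. exact: conj_gt1 p1 pq. Qed.

Let cpsi := continuous_slope_ext p1 pq.
Let psi_lt := slope_ext_lt p1 pq.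

Lemma endpoint_geodesic (t T c w : R) : 0 < t -> t <= 1 -> 0 <= T -> T <= t / 4 ->
  `|c - w * (T / 2)| <= 5 / 8 -> 0 <= w -> w <= 1 / 16 ->
  exists g : R -> heis, [/\ constant_speed_geodesic (heis_dist p) g, g 0 = heis0,
    N (g 1) <= 1 & g t = (T, endpoint_y psi T c w, endpoint_z psi T c w)].
Proof.
move=> t0 t1 T0 Tt cb w0 w1.
have [g [geo g0 Ng gt]] := extremal_geodesic p1 pq cb w0 w1 t0 t1 T0 Tt.
exists g; split => //; rewrite gt.
have fE : (fun x : R => psi (c - w * (T / 2) + w * x)) = slope_at psi T c w.
  by apply/funext => x; rewrite /slope_at; congr (psi _); ring.
rewrite fE; congr (_, _, _).
have cs := @continuous_slope_at _ _ cpsi T c w.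
have [df f0] := primitiveP cs; have cf := is_derive_continuous df.
have [dQ Q0] := primitiveP cf.
set f := primitive (slope_at psi T c w) in df f0 cf dQ Q0 *.
(* Integration by parts: T f(T)/2 minus the integral of f is the moment of f' about T/2. *)
have dF (s : R) : is_derive s 1 (fun s => (s - T / 2) * f s - primitive f s)
    ((s - T / 2) * slope_at psi T c w s).
  have d1 : is_derive s 1 (fun s : R => s - T / 2) (1 - 0).
    exact: is_deriveB (is_derive_id s 1) (is_derive_cst _ s 1).
  have := is_deriveB (is_deriveM d1 (df s)) (dQ s).
  rewrite (_ : _ - _ = (s - T / 2) * slope_at psi T c w s); first exact.
  by rewrite -![_ *: _]/(_ * _) subr0 mulr1 addrK.
rewrite /endpoint_z (primitiveE (@continuous_slope_moment _ _ cpsi T c w) dF T0).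
by rewrite f0 Q0; field.
Qed.

(* At time [t], geodesics from the origin of length at most 1 fill a box of
   volume of order [t ^ s]. *)
Definition reach_volume (s : R) := exists2 c0 : R, 0 < c0 & forall t, 0 < t -> t <= 1 ->
  exists a1 a2 b1 b2 k : R, [/\ a1 <= a2, b1 <= b2, 0 <= k,
    c0 * t `^ s <= (a2 - a1) * (b2 - b1) * k &
    forall x y z, a1 <= x <= a2 -> b1 <= y <= b2 -> 0 <= z <= k ->
      exists g : R -> heis, [/\ constant_speed_geodesic (heis_dist p) g, g 0 = heis0,
        N (g 1) <= 1 & g t = (x, y, z)]].

Let n192 : 0 < 192 :> R. Proof. by rewrite ltr0n. Qed.

Let initial_covector (c w x : R) : - (1 / 2) <= c -> c <= 1 / 2 -> 0 <= w -> w <= 1 / 16 ->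
  0 <= x -> x <= 1 / 4 -> `|c - w * (x / 2)| <= 5 / 8.
Proof.
move=> c1 c2 w0 w1 x0 x4.
have wx : 0 <= w * (x / 2) by rewrite mulr_ge0// divr_ge0.
have wx2 : w * (x / 2) <= 1 / 16 * (1 / 4) by rewrite ler_pM ?divr_ge0//; lra.
by rewrite ler_norml; apply/andP; split; lra.
Qed.

Let tilt (T w s : R) : 0 <= T -> 0 <= w -> w <= 1 / 16 -> 0 <= s <= T ->
  - (T / 32) <= w * (s - T / 2) <= T / 32.
Proof.
move=> T0 w0 w1 /andP[s0 sT]; rewrite -ler_norml normrM (ger0_norm w0).
have -> : T / 32 = 1 / 16 * (T / 2) by field.
by rewrite ler_pM// ler_norml; apply/andP; split; lra.
Qed.

(** The covector varies by at most T/32 along the curve. With [c] from 1/4 to 1/2 and T <= 1/4, it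
    is below 5/16 at one end and above 7/16 at the other, so the second coordinate sweeps
    [al x, be x]; w = 1/16 gives a height of at least sg x^3/192. *)
Lemma reach_volume_generic : reach_volume 5.
Proof.
have [sg sg0 Hsg] := slope_ext_slope_inner p1 pq.
pose al := psi (5 / 16); pose be := psi (7 / 16).
have al0 : 0 < al by rewrite -(slope_ext0 p1 pq); apply: psi_lt; lra.
have ab : al < be by apply: psi_lt; lra.
have be0 : 0 < be := lt_trans al0 ab.
(* Since be * th = (al + be)/2, one interval of second coordinates serves all abscissae between th
   t/4 and t/4. *)
pose th := (al + be) / (2 * be).
have th0 : 0 < th by rewrite divr_gt0 ?addr_gt0 ?mulr_gt0.
have th1 : th < 1 by rewrite ltr_pdivrMr ?mulr_gt0// mul1r; lra.
have thb : be * th = (al + be) / 2 by rewrite /th; field; rewrite gt_eqF.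
exists ((1 - th) / 4 * ((be - al) / 8) * (sg / 192 * (th / 4) ^+ 3)).
  have h1 : 0 < 1 - th by rewrite subr_gt0.
  have h2 : 0 < be - al by rewrite subr_gt0.
  have h3 : 0 < (th / 4) ^+ 3 by rewrite exprn_gt0// divr_gt0.
  by apply: mulr_gt0; apply: mulr_gt0 => //; [exact: divr_gt0|exact: divr_gt0|exact: divr_gt0 sg0 n192].
move=> t t0 t1.
exists (th * t / 4), (t / 4), (al * t / 4), ((al + be) / 2 * t / 4), (sg / 192 * (th * t / 4) ^+ 3).
have tht : th * t <= t by rewrite ler_piMl// ltW.
have abt : al * t <= (al + be) / 2 * t by rewrite ler_wpM2r ?(ltW t0)//; lra.
have tht0 : 0 < th * t by rewrite mulr_gt0.
split.
- by rewrite ler_wpM2r.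
- by rewrite ler_wpM2r.
- apply: mulr_ge0; first exact: ltW (divr_gt0 sg0 n192).
  by rewrite exprn_ge0// divr_ge0// ltW.
- by rewrite (powR_mulrn 5 (ltW t0)) le_eqVlt; apply/orP; left; apply/eqP; field.
move=> x y z /andP[x1 x2] /andP[y1 y2] /andP[z1 z2].
have x0 : 0 < x by apply: lt_le_trans x1; rewrite divr_gt0.
have x4 : x <= 1 / 4 by apply: (le_trans x2); rewrite ler_wpM2r.
have [|||||c [w [cc ww <- <-]]] := @endpoint_surj R psi cpsi psi_lt x x0 (1 / 4) (1 / 2) (1 / 16) y z.
- lra.
- lra.
- exact: z1.
- move=> w /andP[w0 w1]; apply/andP; split.
    apply: (le_trans (endpoint_y_le cpsi psi_lt x0 (k := 5 / 16) _)).
      by move=> s sx; have := tilt (ltW x0) w0 w1 sx; move: (w * _) => W; lra.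
    by rewrite -/al (le_trans _ y1)// -mulrA ler_wpM2l// ltW.
  apply: le_trans (endpoint_y_ge cpsi psi_lt x0 (k := 7 / 16) _).
    rewrite -/be (le_trans y2)// -thb -(mulrA be) -(mulrA be).
    exact: ler_wpM2l (ltW be0) _ _ x1.
  by move=> s sx; have := tilt (ltW x0) w0 w1 sx; move: (w * _) => W; lra.
- move=> c /andP[c1 c2]; apply: (le_trans z2).
  apply: (le_trans _ (@endpoint_z_ge R psi cpsi x x0 sg c (1 / 16) (1 / 8) (5 / 8) _ _ _ _)).
  + have -> : sg * (1 / 16) * x ^+ 3 / 12 = sg / 192 * x ^+ 3 by field.
    apply: ler_wpM2l (ltW (divr_gt0 sg0 n192)) _ _ _.
    by apply: lerXn2r => //; rewrite nnegrE ltW// divr_gt0.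
  + by lra.
  + by move=> a b; exact: Hsg.
  + by move: x4 x0; lra.
  + by move: x4 x0; lra.
have /andP[w0 w1] := ww; have /andP[c1 c2] := cc.
apply: (endpoint_geodesic t0 t1 (ltW x0) x2 _ w0 w1).
have c3 : - (1 / 2) <= c by apply: le_trans c1; rewrite lerNl; lra.
exact: initial_covector c3 c2 w0 w1 (ltW x0) x4.
Qed.

(* The covector is within [O(t)] of 0, where the slope of [dual_slope] is of order
   [t ^ (q - 2)]. *)
Lemma reach_volume_degenerate : q <= 2 -> reach_volume (2 * q + 2).
Proof.
move=> q2; have q10 : 0 < q - 1 by rewrite subr_gt0.
(* For t/8 <= x <= t/4 they bound the scales used below: x/32 >= r1 t, the covector reached at c =
   x/16, and x/8 <= r2 t, the range of all covectors. *)
pose r1 : R := 1 / 8 / 32; pose r2 : R := 1 / 32.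
have r10 : 0 < r1 by rewrite !divr_gt0.
have r20 : 0 < r2 by rewrite divr_gt0.
have r80 : 0 < 1 / 8 :> R by rewrite divr_gt0.
exists (1 / 8 * (1 / 8 * r1 `^ (q - 1)) * ((q - 1) / 192 * r2 `^ (q - 2) * (1 / 8) ^+ 3)).
  have h3 : 0 < (q - 1) / 192 := divr_gt0 q10 n192.
  apply: mulr_gt0; first by rewrite !mulr_gt0// powR_gt0.
  by apply: mulr_gt0; [rewrite mulr_gt0// powR_gt0|rewrite exprn_gt0].
move=> t t0 t1.
have rt1 : 0 < r1 * t by rewrite mulr_gt0.
have rt2 : 0 < r2 * t by rewrite mulr_gt0.
exists (t / 8), (t / 4), 0, ((r1 * t) `^ (q - 1) * (t / 8)),
  ((q - 1) / 192 * (r2 * t) `^ (q - 2) * (t / 8) ^+ 3).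
split.
- lra.
- by apply: mulr_ge0; [exact: powR_ge0|rewrite divr_ge0// ltW].
- apply: mulr_ge0; last by rewrite exprn_ge0// divr_ge0// ltW.
  exact: mulr_ge0 (ltW (divr_gt0 q10 n192)) (powR_ge0 _ _).
- rewrite subr0 (powRM _ (ltW r10) (ltW t0)) (powRM _ (ltW r20) (ltW t0)).
  have -> : 2 * q + 2 = 5%:R + ((q - 1) + (q - 2)) by ring.
  rewrite (powRD_gt0 5%:R _ t0) (powRD_gt0 (q - 1) (q - 2) t0) (powR_mulrn 5 (ltW t0)).
  rewrite le_eqVlt; apply/orP; left; apply/eqP.
  by move: (r1 `^ _) (r2 `^ _) (t `^ (q - 1)) (t `^ (q - 2)) => A B D E; field.
move=> x y z /andP[x1 x2] /andP[y1 y2] /andP[z1 z2].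
have x0 : 0 < x by apply: lt_le_trans x1; rewrite divr_gt0.
have x4 : x <= 1 / 4 by apply: (le_trans x2); rewrite ler_wpM2r.
have x32 : 0 < x / 32 by rewrite divr_gt0.
have x8 : 0 < x / 8 by rewrite divr_gt0.
have [|||||c [w [cc ww <- <-]]] :=
  @endpoint_surj R psi cpsi psi_lt x x0 (- (x / 32)) (x / 16) (1 / 16) y z.
- by move: x0; lra.
- lra.
- exact: z1.
- move=> w /andP[w0 w1]; apply/andP; split.
    apply: (le_trans (endpoint_y_le cpsi psi_lt x0 (k := 0) _)).
      by move=> s sx; have := tilt (ltW x0) w0 w1 sx; move: (w * _) => W; lra.
    by rewrite (slope_ext0 p1 pq) mul0r.
  apply: le_trans (endpoint_y_ge cpsi psi_lt x0 (k := x / 32) _).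
    apply: (le_trans y2); apply: ler_pM => //; [exact: powR_ge0|by rewrite divr_ge0// ltW|].
    apply: le_trans (slope_ext_ge p1 pq (ltW x32)).
    apply: ge0_ler_powR; rewrite ?nnegrE ?(ltW q10) ?(ltW rt1) ?(ltW x32)//.
    by move: x1; rewrite /r1; lra.
  by move=> s sx; have := tilt (ltW x0) w0 w1 sx; move: (w * _) => W; lra.
- move=> c /andP[c1 c2]; apply: (le_trans z2).
  apply: (le_trans _ (@endpoint_z_ge R psi cpsi x x0 ((q - 1) * (x / 8) `^ (q - 2)) c
    (1 / 16) (- (x / 8)) (x / 8) _ _ _ _)).
  + set A := (x / 8) `^ (q - 2).
    have -> : (q - 1) * A * (1 / 16) * x ^+ 3 / 12 = (q - 1) / 192 * A * x ^+ 3 by field.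
    have q92 : 0 <= (q - 1) / 192 := ltW (divr_gt0 q10 n192).
    have t8 : 0 <= t / 8 by rewrite divr_ge0// ltW.
    apply: ler_pM; [exact: mulr_ge0 q92 (powR_ge0 _ _)|exact: exprn_ge0| |].
      apply: ler_wpM2l => //; rewrite /A.
      have -> : q - 2 = - (2 - q) by ring.
      rewrite !powRN lef_pV2 ?posrE ?powR_gt0//.
      apply: ge0_ler_powR; rewrite ?nnegrE ?(ltW rt2) ?(ltW x8) ?subr_ge0//.
      by move: x2; rewrite /r2; lra.
    by apply: lerXn2r => //; rewrite nnegrE ltW.
  + by lra.
  + move=> a b a1 ab b1; apply: (slope_ext_slope p1 pq q2 x8) => //.
    by move: x4; lra.
  + by move: x0 c1; lra.
  + by move: x0 c2; lra.
have /andP[w0 w1] := ww; have /andP[c1 c2] := cc.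
apply: (endpoint_geodesic t0 t1 (ltW x0) x2 _ w0 w1).
have [c3 c4] : - (1 / 2) <= c /\ c <= 1 / 2.
  by move: c1 c2 x4 x0; clear -p1 pq q1 cpsi psi_lt tilt initial_covector n192; split; lra.
exact: initial_covector c3 c4 w0 w1 (ltW x0) x4.
Qed.

End Regions.

(** * Intermediate sets from an arbitrary point *)

Section TranslatedBox.
Context {R : realType}.
Local Notation mu := (@lebesgue_measure R).
Local Notation heis := (R * R * R)%type.
Local Notation rect := (measurableTypeR R * measurableTypeR R)%type.

(** A left translation shears a box in the vertical direction; by Fubini's theorem each vertical
    section keeps its length [k]. *)
Lemma lebesgue3_skew_box (A B : set (measurableTypeR R)) (k : R)
  (f : measurableTypeR R * measurableTypeR R -> measurableTypeR R) : measurable A -> measurable B ->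
  measurable_fun setT f -> 0 <= k ->
  let S := [set g : measurableTypeR R * measurableTypeR R * measurableTypeR R |
     (A `*` B) g.1 /\ 0 <= g.2 - f g.1 <= k] in
  measurable S /\ @lebesgue3 R S = (mu A * mu B * k%:E)%E.
Proof.
move=> mA mB mf k0 S.
have mAB : measurable (A `*` B) by exact: measurableX.
have mS : measurable S.
  have -> : S = ((A `*` B) `*` setT) `&` (fun g => g.2 - f g.1) @^-1` `[0, k]%classic.
    apply/seteqP; split => g /=; rewrite in_itv/=.
      by move=> [h1 h2].
    by move=> [[h1 _] h2].
  apply: measurableI; first exact: measurableX.
  rewrite -[X in measurable X]setTI.
  have mg : measurable_fun setT (fun g : measurableTypeR R * measurableTypeR R * measurableTypeR R =>
      (g.2 - f g.1 : measurableTypeR R)).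
    apply: measurable_funB => //; exact: (measurableT_comp mf).
  exact: mg.
split => //.
have sec w : mu (xsection S w) = (k%:E * (\1_(A `*` B) w)%:E)%E.
  rewrite indicE; have [wAB|wAB] := boolP (w \in A `*` B).
    have -> : xsection S w = `[f w, f w + k]%classic.
      apply/seteqP; split => z; rewrite /xsection/= in_itv/=.
        by rewrite inE => -[_ /= /andP[h1 h2]]; apply/andP; split; lra.
      move=> /andP[h1 h2]; rewrite inE; split => /=; first by rewrite inE in wAB.
      by apply/andP; split; lra.
    rewrite lebesgue_measure_itvcc ?lerDl// mule1; congr EFin; ring.
  rewrite mule0; have -> : xsection S w = set0; last exact: measure0.
  apply/seteqP; split => z //; rewrite /xsection/= inE => -[h _].
  by rewrite notin_setE in wAB.
have -> : @lebesgue3 R S = (\int[mu \x mu]_w (mu (xsection S w)))%E by [].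
rewrite (eq_integral (fun w => (k%:E * (\1_(A `*` B) w)%:E)%E)); last by move=> w _; exact: sec.
rewrite ge0_integralZl_EFin//; last by apply/measurable_EFinP; exact: measurable_indic.
rewrite integral_indic// setIT muleC; congr (_ * _)%E.
exact: product_measure1E.
Qed.

End TranslatedBox.

(** * Upper bound of the dimension at every point *)

Section LowerVolume.
Context {R : realType}.
Local Notation heis := (R * R * R)%type.
Variable p : R.
Hypothesis p1 : 1 < p.
Local Notation N := (heis_norm p).

Lemma box_metric_bounded (a b c : R) : metric_bounded (heis_dist p) (box a b c).
Proof.
exists ((a + b + 4 * Num.sqrt c) + (a + b + 4 * Num.sqrt c)).
have H (x y z : R) : `|x| <= a -> `|y| <= b -> `|z| <= c -> N (x, y, z) <= a + b + 4 * Num.sqrt c.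
  move=> xa yb zc; apply: (le_trans (heis_norm_le p1 x y z)).
  by rewrite !lerD// ler_wpM2l// ler_wsqrtr.
have bP g : box a b c g -> [/\ `|g.1.1| <= a, `|g.1.2| <= b & `|g.2| <= c].
  by move=> [[/=]]; rewrite !in_itv/= => h1 h2 h3; rewrite !ler_norml.
move=> [[x y] z] [[x' y'] z'] /bP[/= h1 h2 h3] /bP[/= h4 h5 h6].
rewrite heis_distE// lee_fin; apply: (le_trans (heis_normM p1 _ _)).
by apply: lerD; [apply: H; rewrite normrN|exact: H].
Qed.

Lemma geodesic_translate (g : R -> heis) x : constant_speed_geodesic (heis_dist p) g ->
  constant_speed_geodesic (heis_dist p) (fun t => heis_mul x (g t)).
Proof. by move=> geo s t s01 t01; rewrite !heis_dist_mull; exact: geo. Qed.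

(** The box [A] contains the ball of radius N x + 1 about the origin, hence the end points of all
    geodesics of length at most 1 from [x]. It does not depend on t. *)
Lemma intermediate_set_ge (s : R) (x : heis) : reach_volume p s ->
  exists A : set (measurableTypeR R * measurableTypeR R * measurableTypeR R), exists m c : R,
  [/\ measurable A, metric_bounded (heis_dist p) A, 0 < m /\ @lebesgue3 R A = m%:E, 0 < c &
    forall t, 0 < t -> t <= 1 ->
    ((c * t `^ s)%:E <= ((@lebesgue3 R)^*)%mu (intermediate_set (heis_dist p) x A t))%E].
Proof.
move=> [c c0 Hc]; pose r := N x + 1.
have r0 : 0 < r by rewrite ltr_wpDl// (heis_norm_ge0 p1).
exists (box r r (r ^+ 2)), (8 * r * r * r ^+ 2), c; split.
- exact: measurable_box.
- exact: box_metric_bounded.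
- by rewrite lebesgue3_box ?exprn_ge0 ?(ltW r0)//; split => //; rewrite !mulr_gt0// exprn_gt0.
- exact: c0.
move=> t t0 t1; have [a1 [a2 [b1 [b2 [k [a12 b12 k0 vol Hreach]]]]]] := Hc t t0 t1.
(* The height of [x] times the horizontal vector that leads from the projection of [x] to [w]. *)
pose f (w : measurableTypeR R * measurableTypeR R) : measurableTypeR R :=
  x.2 + 2^-1 * (x.1.1 * (w.2 - x.1.2) - (w.1 - x.1.1) * x.1.2).
have mf : measurable_fun setT f.
  apply: measurable_funD => //; apply: measurable_funM => //.
  apply: measurable_funB; apply: measurable_funM => //; exact: measurable_funB.
have [mS muS] := @lebesgue3_skew_box R `[a1 + x.1.1, a2 + x.1.1]%classic
  `[b1 + x.1.2, b2 + x.1.2]%classic k f (measurable_itv _) (measurable_itv _) mf k0.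
set S := (X in measurable X) in mS muS.
apply: (@le_trans _ _ (@lebesgue3 R S)).
  rewrite muS !lebesgue_measure_itvcc ?lerD2r// -!EFinM lee_fin (le_trans vol)//.
  by rewrite le_eqVlt; apply/orP; left; apply/eqP; ring.
rewrite -(measurable_mu_extE _ mS); apply: le_mu_ext => g [[/=]].
rewrite !in_itv/= => /andP[h1 h2] /andP[h3 h4] hz.
have [|||gam [geo gam0 Ngam gamt]] := Hreach (g.1.1 - x.1.1) (g.1.2 - x.1.2) (g.2 - f g.1).
- by rewrite lerBrDr h1 lerBlDr.
- by rewrite lerBrDr h3 lerBlDr.
- exact: hz.
exists (fun u => heis_mul x (gam u)); split.
- exact: geodesic_translate.
- by rewrite gam0; exact: heis_mul0.
- have Nr : N (heis_mul x (gam 1)) <= r by rewrite (le_trans (heis_normM p1 _ _))// lerD2l.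
  apply: boxP.
  + exact: le_trans (norm_fst_le p1 _) Nr.
  + exact: le_trans (norm_snd_le p1 _) Nr.
  + apply: (le_trans (norm_height_le p1 _)).
    by apply: lerXn2r => //; rewrite nnegrE ?(heis_norm_ge0 p1)// ltW.
- rewrite gamt /heis_mul/= /f.
  case: g {h1 h2 h3 h4 hz gamt} => -[u v] w /=.
  by congr (_, _, _); ring.
Qed.

(** At the exponent s + e the rescaled ratio is at least a constant times t^(- e), so the upper
    limit is infinite. *)
Lemma geodesic_dim_at_le (s : R) (x : heis) : 0 < s -> reach_volume p s ->
  (geodesic_dim_at (@lebesgue3 R) (heis_dist p) x <= s%:E)%E.
Proof.
move=> s0 rv; apply/lee_addgt0Pr => e e0; rewrite -EFinD.
apply: ereal_inf_lbound; exists (s + e) => //; split; first by rewrite addr_gt0.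
have [A [m [c [mA Ab [m0 Am] c0 HA]]]] := intermediate_set_ge x rv.
apply/eqP; rewrite -leye_eq.
apply: (@le_trans _ _ (contraction_limsup (@lebesgue3 R) (heis_dist p) (s + e) x A)); last first.
  apply: ereal_sup_ubound; exists A => //; split => //.
  by rewrite Am lte_fin m0 ltry.
apply: le_ereal_inf_tmp => _ [V V0 <-]; rewrite leye_eq; apply/eqP; apply/eqyP => M M0.
have [d /= d0 dV] := V0.
pose a := c / m; have a0 : 0 < a by rewrite divr_gt0.
(* In the given neighbourhood, within the range of [intermediate_set_ge], and small enough for a /
   t^e to reach M. *)
pose t := Num.min (d / 2) (Num.min 1 ((a / M) `^ e^-1)).
have aM : 0 < a / M by rewrite divr_gt0.
have t0 : 0 < t by rewrite !lt_min ltr01 powR_gt0// divr_gt0.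
have t1 : t <= 1 by rewrite !ge_min lexx/= orbT.
have td : t < d.
  apply: (@le_lt_trans _ _ (d / 2)); first by rewrite ge_min lexx.
  by rewrite ltr_pdivrMr// ltr_pMr// ltr1n.
have te : t `^ e <= a / M.
  have -> : a / M = ((a / M) `^ e^-1) `^ e by rewrite -powRrM mulVf ?gt_eqF// powRr1// ltW.
  apply: ge0_ler_powR; rewrite ?nnegrE ?powR_ge0 ?(ltW e0) ?(ltW t0)//.
  by rewrite /t !ge_min lexx !orbT.
apply: (@le_trans _ _ ((t `^ (s + e))^-1%:E *
    (((@lebesgue3 R)^*)%mu (intermediate_set (heis_dist p) x A t) / @lebesgue3 R A))%E); last first.
  apply: ereal_sup_ubound; exists t => //; apply: dV => //=.
  by rewrite sub0r normrN gtr0_norm.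
have te0 : 0 < t `^ e by rewrite powR_gt0.
have ts0 : 0 < t `^ s by rewrite powR_gt0.
rewrite Am inver gt_eqF//.
apply: (@le_trans _ _ ((t `^ (s + e))^-1%:E * ((c * t `^ s)%:E * (m^-1)%:E))%E); last first.
  apply: lee_wpmul2l; first by rewrite lee_fin invr_ge0 powR_ge0.
  apply: lee_wpmul2r; first by rewrite lee_fin invr_ge0 ltW.
  exact: HA.
rewrite -!EFinM lee_fin powRD_gt0//.
have -> : (t `^ s * t `^ e)^-1 * (c * t `^ s / m) = a / t `^ e.
  by rewrite /a; move: ts0 te0; move: (t `^ s) (t `^ e) => u v u0 v0; field; rewrite !gt_eqF.
by rewrite ler_pdivlMr// mulrC -ler_pdivlMr.
Qed.

End LowerVolume.

Theorem theoremB (R : realType) (p q : R) (hp : 1 < p)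
    (hpq : p^-1 + q^-1 = 1) :
  (p <= 3 -> geodesic_dim lebesgue3 (heis_dist p) = 5%:E) /\
  (3 <= p -> geodesic_dim lebesgue3 (heis_dist p) = (2 * q + 2)%:E).
Proof.
have q1 := conj_gt1 hp hpq; have pq1 := conj_mul1 hp hpq.
have q10 : 0 <= q - 1 by rewrite subr_ge0 ltW.
have H (s : R) : 0 < s -> s <= 5 -> s <= 2 * q + 2 -> reach_volume p s ->
    geodesic_dim lebesgue3 (heis_dist p) = s%:E.
  move=> s0 s5 sq rv; apply/le_anti/andP; split.
    by apply: ge_ereal_sup => _ [x _ <-]; exact: (geodesic_dim_at_le hp).
  apply: (le_trans (geodesic_dim_at0_ge hp hpq s5 sq)).
  by apply: ereal_sup_ubound; exists (0, 0, 0).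
split => p3; apply: H; rewrite ?ltr0n//.
(* By (p - 1)(q - 1) = 1, this product is (2q + 2) - 5. *)
- have : 0 <= (3 - p) * (q - 1) by rewrite mulr_ge0// subr_ge0.
  by move: pq1; lra.
- exact: reach_volume_generic hp hpq.
- lra.
- have : 0 <= (p - 3) * (q - 1) by rewrite mulr_ge0// subr_ge0.
  by move: pq1; lra.
- apply: (reach_volume_degenerate hp hpq).
  (* The product equals 3 - 2q, so q <= 3/2. *)
  have : 0 <= (p - 3) * (q - 1) by rewrite mulr_ge0// subr_ge0.
  by move: pq1; lra.
Qed.
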